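(* Fix $(\vartheta,r)$ with $0<\vartheta<1$ and $r>0$, and consider a sequence, indexed by $p$, of Asymptotic Rare and Weak models $ARW(\vartheta,r,\Omega)$ with $\Omega=\Omega_{p,p}$, with the associated hypotheses $H_0^{(p)}$ and $H_1^{(p)}$. Let $\rho^*$ be the standard phase function for detection. If $r>\rho^*(\vartheta)$ and, as $p\to\infty$, the level $\alpha=\alpha_p$ tends to $0$ slowly enough, then the power of the Innovated Higher Criticism (IHC) test, which rejects $H_0^{(p)}$ if and only if $IHC_p^*\ge d_p^*(\Omega)\,h(p,\alpha_p)$, tends to $1$ as $p\to\infty$. If $r<\rho^*(\vartheta)$, then for any (sequence of) tests of $H_1^{(p)}$ against $H_0^{(p)}$, the sum of the Type I and Type II errors tends to $1$ as $p\to\infty$.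
   Context: The model $ARW(\vartheta,r,\Omega)$, with $\vartheta\in(0,1)$ and $r>0$ fixed, is the following. For each $p$, one observes $Y=\beta+z\in\mathbb{R}^p$ with $z\sim N(0,\Sigma)$, where $\Sigma=\Sigma_{p,p}$ is a $p\times p$ covariance matrix with precision matrix $\Omega=\Omega_{p,p}=\Sigma^{-1}$, and $\Omega$ is known. The sequence $\Omega_{p,p}$ satisfies $\Omega(i,i)=1$ for all $1\le i\le p$, and, with $d_p^*(\Omega)=\max_{1\le i\le p}\#\{1\le j\le p:\Omega(i,j)\ne 0\}$, one has $d_p^*(\Omega)\,p^{-\delta}\to 0$ as $p\to\infty$ for every fixed $\delta>0$. The vector $\beta$ is random, independent of $z$, with $$\beta_i\overset{iid}{\sim}(1-\epsilon_p)\nu_0+\epsilon_p\nu_{\tau_p},\quad 1\le i\le p,$$ where $\nu_a$ is the point mass at $a$, $\epsilon_p=p^{-\vartheta}$, and $\tau_p=\sqrt{2r\log p}$. The testing problem is: under $H_0^{(p)}$, $\beta=0$ (so $Y\sim N(0,\Sigma)$); under $H_1^{(p)}$, $\beta$ is random with the distribution just described. The Type I error is the probability of rejecting $H_0^{(p)}$ under $H_0^{(p)}$, the Type II error is the probability of not rejecting $H_0^{(p)}$ under $H_1^{(p)}$, and the power is the probability of rejecting $H_0^{(p)}$ under $H_1^{(p)}$. The standard phase function for detection is $$\rho^*(\vartheta)=\begin{cases}0,&0<\vartheta\le 1/2,\\ \vartheta-1/2,&1/2<\vartheta\le 3/4,\\ (1-\sqrt{1-\vartheta})^2,&3/4<\vartheta<1.\end{cases}$$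 IHC statistic: let $\pi_i=P(|N(0,1)|\ge |(\Omega Y)_i|)$ (with $(\Omega Y)_i$ treated as fixed), $1\le i\le p$, be two-sided $P$-values, sort them as $\pi_{(1)}<\pi_{(2)}<\cdots<\pi_{(p)}$, and set $$IHC_p^*=\max_{1\le i\le p/2} IHC_{p,i},\qquad IHC_{p,i}=\sqrt{p}\,\frac{(i/p)-\pi_{(i)}}{\sqrt{\pi_{(i)}(1-\pi_{(i)})}}.$$ Critical value $h(p,\alpha)$: this is the critical value of the Orthodox Higher Criticism statistic in the uncorrelated case $\Omega=I_p$. That is, for $Y\sim N(0,I_p)$, let $\pi_i=P(N(0,1)\ge Y_i)$ (with $Y_i$ treated as fixed), sort as $\pi_{(1)}<\cdots<\pi_{(p)}$, and let $HC_p^*=\max_{1\le i\le p/2}\sqrt{p}\,\frac{(i/p)-\pi_{(i)}}{\sqrt{\pi_{(i)}(1-\pi_{(i)})}}$; then for $0<\alpha<1$, $h(p,\alpha)$ is defined by $P\{HC_p^*>h(p,\alpha)\}=\alpha$. A sequence $\alpha_p\in(0,1)$ is said to tend to $0$ slowly enough if $\alpha_p\to 0$ and $h(p,\alpha_p)\sim\sqrt{2\log\log p}$ (ratio tending to $1$) as $p\to\infty$. *)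

(* Defs.v *)
From HB Require Import structures.
From mathcomp Require Import all_boot all_order all_algebra.
From mathcomp Require Import all_classical all_reals all_analysis.

Set Implicit Arguments.
Unset Strict Implicit.
Unset Printing Implicit Defensive.

Import Order.TTheory GRing.Theory Num.Theory.
Import numFieldNormedType.Exports.

Local Open Scope classical_set_scope.
Local Open Scope ring_scope.

Section product_law.
Context {d} {T : measurableType d} {R : realType}.

Definition tuple_cons n (x : T * n.-tuple T) : n.+1.-tuple T :=
  [tuple of x.1 :: x.2].

Lemma measurable_tuple_cons n :
  measurable_fun [set: (T * n.-tuple T)%type] (@tuple_cons n).
Proof. exact: measurable_cons. Qed.

HB.instance Definition _ n := @isMeasurableFun.Build _ _
  (T * n.-tuple T)%type (n.+1.-tuple T) (@tuple_cons n)
  (@measurable_tuple_cons n).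

Fixpoint power_prob (mu : probability T R) n : probability (n.-tuple T) R :=
  match n with
  | 0 => dirac [tuple]
  | m.+1 => distribution (mu \x power_prob mu m)%E (@tuple_cons m)
  end.

(* The coordinates of X are i.i.d. with law mu: taking some of the B i equal
   to setT gives the marginals and the product rule for all subfamilies. *)
Definition iid_with_law d' (T' : measurableType d') (P : set T' -> \bar R) n
    (X : T' -> n.-tuple T) (mu : set T -> \bar R) : Prop :=
  forall B : 'I_n -> set T, (forall i, measurable (B i)) ->
    P [set w | forall i, B i (tnth (X w) i)] = (\prod_(i < n) mu (B i))%E.

Lemma power_prob_iid (mu : probability T R) n :
  iid_with_law (power_prob mu n) id mu.
Proof.
elim: n => [|n IHn] B mB.
  rewrite big_ord0 /= diracE mem_set//.
  by move=> -[].
rewrite big_ord_recl -(IHn (fun i => B (lift ord0 i)))//=.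
rewrite /distribution /pushforward/= -product_measure1E//=.
- congr (_ _); apply/seteqP; split => [[x t]/= h|[x t]/= [h0 h] i].
    split=> /= [|i]; first by have := h ord0.
    by have := h (lift ord0 i); rewrite tnthS.
  by case: (unliftP ord0 i) => [j ->|->//]; rewrite tnthS.
- rewrite (_ : [set _ | _] =
      \bigcap_(i in [set: 'I_n]) ((@tnth _ T ^~ i) @^-1` B (lift ord0 i))).
    apply: fin_bigcap_measurable => // i _.
    by rewrite -[X in measurable X]setTI; apply: measurable_tnth.
  by apply/seteqP; split => [t h i _|t h i]; apply: h.
Qed.

End product_law.

Section model.
Context {R : realType}.
Implicit Types (p : nat) (theta r x : R).

Definition col_of_tuple p (y : p.-tuple R) : 'cV[R]_p := \col_i tnth y i.

Definition tuple_mulmx p (A : 'M[R]_p) (y : p.-tuple R) : p.-tuple R :=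
  [tuple (A *m col_of_tuple y) i 0 | i < p].

Definition tuple_add p (x y : p.-tuple R) : p.-tuple R :=
  [tuple tnth x i + tnth y i | i < p].

(* The measure normal_prob lives on measurableTypeR R, which carries the same
   sigma-algebra as R under another display; the identity transports it. *)
Definition idTR : measurableTypeR R -> R := idfun.

HB.instance Definition _ :=
  @isMeasurableFun.Build _ _ _ _ idTR (@measurable_id _ _ setT).

Definition std_normal : probability R R :=
  distribution (normal_prob (0 : R) 1) idTR.

Definition std_gaussian p : probability (p.-tuple R) R :=
  power_prob std_normal p.

(* mu is N(0, Sigma): the law of A g, with g standard Gaussian and
   A A^T = Sigma. *)
Definition centered_gaussian p (Sigma : 'M[R]_p)
    (mu : set (p.-tuple R) -> \bar R) : Prop :=
  exists2 A : 'M[R]_p, A *m A^T = Sigma &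
    forall B, measurable B -> mu B = std_gaussian p (tuple_mulmx A @^-1` B).

Definition max_degree p (Omega : 'M[R]_p) : nat :=
  \max_(i < p) #|[pred j | Omega i j != 0%R]|.

Definition signal_rate theta p : R := p%:R `^ (- theta).

Definition signal_strength r p : R := Num.sqrt (2 * r * ln p%:R).

(* (1 - eps) nu_0 + eps nu_tau *)
Definition two_point_mixture (eps tau : R) (B : set R) : \bar R :=
  ((1 - eps)%:E * \d_(0%R : R) B + eps%:E * \d_tau B)%E.

Definition independent_rv d (T : measurableType d) (P : probability T R)
    d1 (T1 : measurableType d1) (X : T -> T1)
    d2 (T2 : measurableType d2) (Y : T -> T2) : Prop :=
  forall A B, measurable A -> measurable B ->
    P (X @^-1` A `&` Y @^-1` B) = (P (X @^-1` A) * P (Y @^-1` B))%E.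

Record ARW theta r (d : nat -> measure_display)
    (T : forall p, measurableType (d p)) (P : forall p, probability (T p) R)
    (Sigma Omega : forall p, 'M[R]_p)
    (beta z : forall p, {RV (P p) >-> p.-tuple R}) : Prop := {
  ARW_Sigma_unit : forall p, Sigma p \in unitmx ;
  ARW_Omega : forall p, Omega p = invmx (Sigma p) ;
  ARW_Omega_diag : forall p i, Omega p i i = 1 ;
  ARW_Omega_sparse : forall delta : R, 0 < delta ->
    (max_degree (Omega p))%:R * p%:R `^ (- delta) @[p --> \oo] --> (0 : R) ;
  ARW_noise : forall p,
    centered_gaussian (Sigma p) (distribution (P p) (z p)) ;
  ARW_signal : forall p, iid_with_law (P p) (beta p)
    (two_point_mixture (signal_rate theta p) (signal_strength r p)) ;
  ARW_indep : forall p, independent_rv (P p) (beta p) (z p)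
}.

Definition alt_obs d (T : measurableType d) p (beta z : T -> p.-tuple R) :
  T -> p.-tuple R := fun w => tuple_add (beta w) (z w).

(* A possibly randomized test: phi y is the probability of rejecting H0 when
   y is observed. The test with rejection region D is \1_D. *)
Definition is_test p (phi : p.-tuple R -> R) : Prop :=
  measurable_fun [set: p.-tuple R] phi /\ forall y, 0 <= phi y <= 1.

Definition rejection_prob d (T : measurableType d) (P : probability T R) p
    (Y : T -> p.-tuple R) (phi : p.-tuple R -> R) : \bar R :=
  (\int[P]_w (phi (Y w))%:E)%E.

Definition type1_error d (T : measurableType d) (P : probability T R) p
    (z : T -> p.-tuple R) (phi : p.-tuple R -> R) : \bar R :=
  rejection_prob P z phi.

Definition test_power d (T : measurableType d) (P : probability T R) p
    (beta z : T -> p.-tuple R) (phi : p.-tuple R -> R) : \bar R :=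
  rejection_prob P (alt_obs beta z) phi.

Definition type2_error d (T : measurableType d) (P : probability T R) p
    (beta z : T -> p.-tuple R) (phi : p.-tuple R -> R) : \bar R :=
  (\int[P]_w (1 - phi (alt_obs beta z w))%:E)%E.

Definition rho_star theta : R :=
  if theta <= 1 / 2 then 0
  else if theta <= 3 / 4 then theta - 1 / 2
  else (1 - Num.sqrt (1 - theta)) ^+ 2.

(* pi_(i), for 1 <= i <= p *)
Definition order_stat p (pi : p.-tuple R) (i : nat) : R :=
  nth 0 (sort <=%R pi) i.-1.

Definition HC_term p (pi : p.-tuple R) (i : nat) : R :=
  let q := order_stat pi i in
  Num.sqrt p%:R * ((i%:R / p%:R - q) / Num.sqrt (q * (1 - q))).

(* The value is -oo when p < 2, where the range 1 <= i <= p / 2 is empty. *)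
Definition HC_max p (pi : p.-tuple R) : \bar R :=
  \big[maxe/-oo%E]_(1 <= i < p./2.+1) (HC_term pi i)%:E.

Definition two_sided_pvalue x : R :=
  fine (normal_prob (0 : R) 1 [set t | `|x| <= `|t|]).

Definition one_sided_pvalue x : R :=
  fine (normal_prob (0 : R) 1 [set t | x <= t]).

Definition IHC p (Omega : 'M[R]_p) (y : p.-tuple R) : \bar R :=
  HC_max [tuple two_sided_pvalue (tnth (tuple_mulmx Omega y) i) | i < p].

Definition orthodox_HC p (y : p.-tuple R) : \bar R :=
  HC_max [tuple one_sided_pvalue (tnth y i) | i < p].

(* The c such that P{HC_p^* > c} = alpha under N(0, I_p). For p >= 2 it exists
   and is unique; for p < 2 there is none and the value is a dummy. *)
Definition critical_value p (alpha : R) : R :=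
  xget 0 [set c | std_gaussian p [set y | (c%:E < orthodox_HC y)%E] = alpha%:E].

Definition slowly_enough (alpha : nat -> R) : Prop :=
  [/\ forall p, 0 < alpha p < 1,
      alpha p @[p --> \oo] --> (0 : R) &
      critical_value p (alpha p) / Num.sqrt (2 * ln (ln p%:R))
        @[p --> \oo] --> (1 : R)].

Definition IHC_test p (Omega : 'M[R]_p) (alpha : R) : p.-tuple R -> R :=
  \1_[set y | (((max_degree Omega)%:R * critical_value p alpha)%:E
                 <= IHC Omega y)%E].

End model.

(* Main.v *)
(** Write Sigma = A A^T, so that the scores X = Omega Y satisfy X_i = (Omega beta)_i
    + <v_i, g> with g standard Gaussian, v_i the i-th column of A^-1 and
    <v_i, v_j> = Omega(i, j).

    Below the boundary, split the indices into at most d_p^* classes on which Omega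
    is the identity and switch the signals on one class at a time.  Switching on a
    class commutes with adding the independent signals of the other classes, so it
    costs at most the total variation distance of the problem with independent
    N(0, 1) scores.  The second moment of the likelihood ratio truncated at
    sqrt(2 log p) bounds that distance by a negative power of p, which beats
    d_p^* = p^o(1).

    Above the boundary, count the |X_i| exceeding t = sqrt(2 q log p).  Given beta,
    each exceedance probability is at least the null one, and most signals are
    isolated in the graph of Omega, which lifts the mean by about
    p^(1 - theta) P(N(0,1) >= t - tau_p).  Scores with Omega(i, j) = 0 are
    independent, so the variance is at most d_p^* times the mean.  For a suitable q,
    Chebyshev's inequality then makes one term of the IHC statistic larger than a
    positive power of p. *)

Require Import Defs.
From mathcomp Require Import all_boot all_order all_algebra.
From mathcomp Require Import all_classical all_reals all_analysis.
From mathcomp Require Import measurable_realfun ring lra.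

Import Order.TTheory GRing.Theory Num.Theory.
Import numFieldNormedType.Exports.
Set Implicit Arguments.
Unset Strict Implicit.
Unset Printing Implicit Defensive.

Local Open Scope classical_set_scope.
Local Open Scope ring_scope.

(** * Gaussian integrals *)

(** All probabilities are pulled back to the standard Gaussian [g], so no density of N(0, Sigma) is
    ever written. The link is A v_i = e_i: moving [g] by tau v_i adds tau to coordinate i of Y
    alone, and by the Cameron-Martin formula it multiplies the law by the likelihood ratio of N(tau,
    1) to N(0, 1) at <v_i, g>. The obstacle is the dependence between scores, which spoils a product
    form for the likelihood of the whole signal. Inside one class the v_i are orthonormal, so a move
    along one of them leaves the factors of the others unchanged, and the product form returns.

    Each half has a positive power of p to spare, and that power pays for every factor p^o(1): the
    number of classes, the degree in the variance, and the degree and h in the critical value. This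
    is why crude Gaussian tails suffice (an exponential bound from above, the mass of a unit
    interval from below), and why the choice of exponents is isolated as real algebra in sqrt r and
    sqrt(1 - theta). *)

Section density.
Context d (T : measurableType d) (R : realType).
Variables (mu nu : {measure set T -> \bar R}) (g : T -> R).
Hypothesis mg : measurable_fun [set: T] g.
Hypothesis g0 : forall x, 0 <= g x.
Hypothesis nuE : forall A, measurable A -> nu A = (\int[mu]_(x in A) (g x)%:E)%E.

Local Open Scope ereal_scope.
Import HBNNSimple.

(** By monotone convergence it is enough to treat simple functions, where the claim is [nuE]. It
    serves twice: for the normal density against Lebesgue measure, and for the restriction of a
    probability to an event, whose density is an indicator. *)
Lemma ge0_integral_density (f : T -> \bar R) :
  measurable_fun [set: T] f -> (forall x, 0 <= f x) ->
  \int[nu]_x f x = \int[mu]_x (f x * (g x)%:E).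
Proof.
move=> mf f0; pose h := nnsfun_approx measurableT mf.
have mge : measurable_fun [set: T] (EFin \o g) by exact/measurable_EFinP.
have ge0 x : 0 <= (g x)%:E by rewrite lee_fin.
have fE x : f x = limn (fun n => (EFin \o h n) x).
  by apply/esym/cvg_lim => //; exact: cvg_nnsfun_approx.
have -> : \int[nu]_x f x = limn (fun n => \int[nu]_x (EFin \o h n) x).
  under eq_integral do rewrite fE.
  apply: monotone_convergence => //.
  - by move=> n; exact/measurable_EFinP.
  - by move=> n x _ /=; rewrite lee_fin.
  - by move=> x _ a b ab; rewrite lee_fin; exact/lefP/nd_nnsfun_approx.
have -> : \int[mu]_x (f x * (g x)%:E) =
    limn (fun n => \int[mu]_x ((EFin \o h n) x * (g x)%:E)).
  have fg x : f x * (g x)%:E = limn (fun n => (EFin \o h n) x * (g x)%:E).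
    apply/esym/cvg_lim => //; apply: cvgeZr => //.
    exact: cvg_nnsfun_approx.
  under eq_integral do rewrite fg.
  apply: monotone_convergence => //.
  - by move=> n; apply: emeasurable_funM => //; exact/measurable_EFinP.
  - by move=> n x _ /=; rewrite mule_ge0 ?lee_fin.
  - move=> x _ a b ab /=; rewrite lee_wpmul2r ?lee_fin//.
    exact/lefP/nd_nnsfun_approx.
congr (limn _); apply/funext => n.
transitivity (\int[nu]_x
   (\sum_(y \in range (h n)) (y * \1_(h n @^-1` [set y]) x)%:E)).
  by apply: eq_integral => t tE; rewrite /= fimfunE -fsumEFin.
have indich r : measurable_fun setT (fun x => (r * \1_(h n @^-1` [set r]) x)%:E).
  exact/measurable_EFinP/measurable_funM.
rewrite ge0_integral_fsum//; last by move=> m y Ey; exact: nnfun_muleindic_ge0.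
transitivity (\int[mu]_x (\sum_(y \in range (h n))
    (y * \1_(h n @^-1` [set y]) x)%:E * (g x)%:E)); last first.
  apply: eq_integral => x _.
  rewrite -ge0_mule_fsuml => [|y]; last exact: nnfun_muleindic_ge0.
  by rewrite fsumEFin // -(fimfunE _ x).
rewrite ge0_integral_fsum//; last 2 first.
  - by move=> y; apply: emeasurable_funM.
  - by move=> m y Ey; rewrite mule_ge0// nnfun_muleindic_ge0.
apply: eq_fsbigr => r rhn.
under eq_integral do rewrite EFinM.
rewrite integralZl_indic_nnsfun => //.
under [RHS]eq_integral do rewrite EFinM -muleA.
rewrite ge0_integralZl//.
- under [in RHS]eq_integral do rewrite muleC.
  rewrite [in RHS](eq_integral ((EFin \o g) \_ (h n @^-1` [set r]))); last first.
    by move=> x xE; rewrite epatch_indic.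
  by rewrite -integral_mkcondr setTI -nuE// integral_indic// setIT.
- by apply: emeasurable_funM => //; exact/measurable_EFinP.
- by move=> t Et; rewrite mule_ge0 ?lee_fin.
- by move: rhn; rewrite inE => -[t _ <-]; rewrite lee_fin.
Qed.

End density.

Section gaussian_line.
Context {R : realType}.
Local Notation leb := (@lebesgue_measure R).
Local Open Scope ereal_scope.

Lemma lebesgue_measure_shift (a : R) (A : set R) : measurable A ->
  pushforward leb ((fun x => x + a)%R : _ -> measurableTypeR R) A = leb A.
Proof.
move=> mA.
have ma : measurable_fun [set: measurableTypeR R]
    ((fun x => x + a)%R : measurableTypeR R -> measurableTypeR R).
  exact: (@measurable_funD _ _ _ [set: R]).
have -> : pushforward leb ((fun x => x + a)%R : _ -> measurableTypeR R) A =
  (measure_function_pushforward__canonical__measure_function_Measure leb ma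
    : {measure set _ -> \bar R}) A by [].
apply/esym/lebesgue_measure_unique => //= _ [[b c]] _ <-.
rewrite /pushforward/=.
rewrite (_ : _ @^-1` _ = `]b - a, c - a]%classic)%R; last first.
  by apply/seteqP; split => x /=; rewrite !in_itv/= ltrBlDr lerBrDr.
rewrite !lebesgue_measure_itv/= !lte_fin ltrD2r; case: ifP => // _.
by rewrite !EFinN -!EFinD; congr EFin; ring.
Qed.

Lemma ge0_integral_leb_shift (a : R) (f : R -> \bar R) :
  measurable_fun [set: R] f -> (forall x, 0 <= f x) ->
  \int[leb]_x f (x + a)%R = \int[leb]_x f x.
Proof.
move=> mf f0.
have ma : measurable_fun [set: measurableTypeR R]
    ((fun x => x + a)%R : measurableTypeR R -> measurableTypeR R).
  exact: (@measurable_funD _ _ _ [set: R]).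
have := @ge0_integral_pushforward _ _ _ _ _ _ ma leb setT f measurableT mf
  (fun x _ => f0 x).
rewrite preimage_setT => <-.
by apply: eq_measure_integral => A mA _; exact: lebesgue_measure_shift.
Qed.

Lemma ge0_integral_leb_opp (f : R -> \bar R) :
  measurable_fun [set: R] f -> (forall x, 0 <= f x) ->
  \int[leb]_x f (- x)%R = \int[leb]_x f x.
Proof.
move=> mf f0.
have ma : measurable_fun [set: measurableTypeR R]
    (-%R : measurableTypeR R -> measurableTypeR R).
  exact: (@oppr_measurable R setT).
have := @ge0_integral_pushforward _ _ _ _ _ _ ma leb setT f measurableT mf
  (fun x _ => f0 x).
rewrite preimage_setT => <-.
by apply: eq_measure_integral => A mA _; exact: lebesgue_measureN.
Qed.

Definition gauss (x : R) : R := normal_pdf 0 1 x.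

Lemma gaussE (x : R) : gauss x = ((Num.sqrt (pi *+ 2))^-1 * expR (- x ^+ 2 / 2))%R.
Proof.
rewrite /gauss normal_pdfE ?oner_eq0// /normal_peak /normal_fun.
by rewrite expr1n mul1r subr0.
Qed.

Lemma measurable_gauss : measurable_fun [set: R] gauss.
Proof. exact: measurable_normal_pdf. Qed.

Lemma gauss_ge0 x : (0 <= gauss x)%R.
Proof. exact: normal_pdf_ge0. Qed.

Lemma integral_std_normal (f : R -> \bar R) :
  measurable_fun [set: R] f -> (forall x, 0 <= f x) ->
  \int[std_normal]_x f x = \int[leb]_x (f x * (gauss x)%:E).
Proof.
move=> mf f0.
rewrite /std_normal ge0_integral_distribution//.
apply: (@ge0_integral_density _ _ _ leb (normal_prob 0 1) gauss) => //.
- exact: measurable_gauss.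
- exact: gauss_ge0.
Qed.

Lemma integral_std_normal_opp (f : R -> \bar R) :
  measurable_fun [set: R] f -> (forall x, 0 <= f x) ->
  \int[std_normal]_x f (- x)%R = \int[std_normal]_x f x.
Proof.
move=> mf f0; rewrite !integral_std_normal//; last first.
  apply: (measurableT_comp mf); exact: (@oppr_measurable R setT).
have mfg : measurable_fun [set: R] (fun x => f x * (gauss x)%:E).
  by apply: emeasurable_funM => //; apply/measurable_EFinP; exact: measurable_gauss.
have fg0 x : 0 <= f x * (gauss x)%:E by rewrite mule_ge0 ?lee_fin ?gauss_ge0.
rewrite -[RHS](ge0_integral_leb_opp mfg fg0).
by apply: eq_integral => x _; rewrite !gaussE sqrrN.
Qed.

(** One-dimensional Cameron-Martin formula: translate the Lebesgue integral and complete the square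
    in the exponent of [gauss (x - h)]. *)
Lemma integral_std_normal_shift (h : R) (f : R -> \bar R) :
  measurable_fun [set: R] f -> (forall x, 0 <= f x) ->
  \int[std_normal]_x f (x + h)%R =
  \int[std_normal]_x (f x * (expR (h * x - h ^+ 2 / 2))%:E).
Proof.
move=> mf f0.
have mg := measurable_gauss.
have mfh : measurable_fun [set: R] (fun x => f (x + h)%R).
  by apply: (measurableT_comp mf); exact: measurable_funD.
have me : measurable_fun [set: R] (fun x : R => (expR (h * x - h ^+ 2 / 2))%:E).
  apply/measurable_EFinP/measurableT_comp => //.
  by apply: measurable_funB => //; exact: measurable_funM.
have mfg : measurable_fun [set: R] (fun x => f (x + h)%R * (gauss x)%:E).
  by apply: emeasurable_funM => //; exact/measurable_EFinP.
have fg0 x : 0 <= f (x + h)%R * (gauss x)%:E by rewrite mule_ge0 ?lee_fin ?gauss_ge0.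
have fe0 x : 0 <= f x * (expR (h * x - h ^+ 2 / 2))%:E.
  by rewrite mule_ge0 ?lee_fin ?expR_ge0.
rewrite integral_std_normal// integral_std_normal//; last exact: emeasurable_funM.
rewrite -(ge0_integral_leb_shift (- h)%R mfg fg0).
apply: eq_integral => x _; rewrite subrK -muleA -EFinM; congr (_ * _%:E).
rewrite !gaussE mulrCA -expRD; congr (_ * expR _)%R; by field.
Qed.

End gaussian_line.

Section gaussian_plane.
Context {R : realType}.
Local Notation leb := (@lebesgue_measure R).
Local Notation gam := (@std_normal R).
Local Open Scope ereal_scope.
Implicit Types (F H : R * R -> \bar R).

Lemma measurable_fun_sec1 H x : measurable_fun [set: R * R] H ->
  measurable_fun [set: R] (fun y => H (x, y)).
Proof. by move=> mH; apply: (measurableT_comp mH); exact: measurable_fun_pair. Qed.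

Lemma measurable_fun_sec2 H y : measurable_fun [set: R * R] H ->
  measurable_fun [set: R] (fun x => H (x, y)).
Proof. by move=> mH; apply: (measurableT_comp mH); exact: measurable_fun_pair. Qed.

Lemma integral_shear2 (b : R) H : measurable_fun [set: R * R] H ->
  (forall z, 0 <= H z) ->
  \int[leb]_x \int[leb]_y H (x, y + b * x)%R = \int[leb]_x \int[leb]_y H (x, y).
Proof.
move=> mH H0; apply: eq_integral => x _.
exact: (ge0_integral_leb_shift (b * x) (measurable_fun_sec1 x mH)).
Qed.

Lemma leb_fubini H : measurable_fun [set: R * R] H -> (forall z, 0 <= H z) ->
  \int[leb]_x \int[leb]_y H (x, y) = \int[leb]_y \int[leb]_x H (x, y).
Proof. by move=> mH H0; exact: (@fubini_tonelli _ _ _ _ _ leb leb H). Qed.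

Lemma integral_shear1 (a : R) H : measurable_fun [set: R * R] H ->
  (forall z, 0 <= H z) ->
  \int[leb]_x \int[leb]_y H (x + a * y, y)%R = \int[leb]_x \int[leb]_y H (x, y).
Proof.
move=> mH H0.
have mS : measurable_fun [set: R * R] (fun z : R * R => (z.1 + a * z.2, z.2))%R.
  apply: measurable_fun_pair => //.
  by apply: measurable_funD => //; exact: measurable_funM.
rewrite [RHS](leb_fubini mH H0).
apply: (etrans (leb_fubini (measurableT_comp mH mS) (fun z => H0 _))).
apply: eq_integral => y _.
exact: (ge0_integral_leb_shift (a * y) (measurable_fun_sec2 y mH)).
Qed.

(* A rotation is a product of three shears, and shears preserve Lebesgue measure. *)
Lemma integral_rotation_leb (c s : R) H : (s != 0)%R -> (c ^+ 2 + s ^+ 2 = 1)%R ->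
  measurable_fun [set: R * R] H -> (forall z, 0 <= H z) ->
  \int[leb]_x \int[leb]_y H (c * x - s * y, s * x + c * y)%R =
  \int[leb]_x \int[leb]_y H (x, y).
Proof.
(* If c and s are the cosine and sine of an angle, [a] is minus the tangent of half of it. The outer
   shears have coefficient [a], the middle one [s], and a (1 + c) = - s makes their product the
   rotation. *)
move=> s0 cs mH H0; pose a := ((c - 1) / s)%R.
have mS1 : measurable_fun [set: R * R] (fun z : R * R => (z.1 + a * z.2, z.2))%R.
  apply: measurable_fun_pair => //.
  by apply: measurable_funD => //; exact: measurable_funM.
have mS2 : measurable_fun [set: R * R] (fun z : R * R => (z.1, z.2 + s * z.1))%R.
  apply: measurable_fun_pair => //.
  by apply: measurable_funD => //; exact: measurable_funM.
have mH1 := measurableT_comp mH mS1.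
have mH2 := measurableT_comp mH1 mS2.
apply: esym; apply: (etrans (esym (integral_shear1 a mH H0))).
apply: (etrans (esym (integral_shear2 s mH1 (fun z => H0 _)))).
apply: (etrans (esym (integral_shear1 a mH2 (fun z => H0 _)))); apply: esym.
apply: eq_integral => x _; apply: eq_integral => y _ /=.
have as1 : (a * s = c - 1)%R by rewrite /a divfK.
have aE : (a * (1 + c) = - s)%R.
  apply: (mulIf s0); rewrite mulrAC as1.
  have -> : (s ^+ 2 = 1 - c ^+ 2)%R -> ((c - 1) * (1 + c) = - s * s)%R.
    by rewrite mulNr -expr2 => ->; ring.
  by [].
  by rewrite -cs; ring.
congr (H (_, _)).
- have -> : (x + a * y + a * (y + s * (x + a * y)) =
             (1 + a * s) * x + a * (2 + a * s) * y)%R by ring.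
  rewrite as1 (_ : 1 + (c - 1) = c)%R; last by ring.
  by rewrite (_ : 2 + (c - 1) = 1 + c)%R ?aE ?mulNr//; ring.
- have -> : (y + s * (x + a * y) = s * x + (1 + a * s) * y)%R by ring.
  by rewrite as1; congr (_ + _ * _)%R; ring.
Qed.

Lemma std_normal2 F : measurable_fun [set: R * R] F -> (forall z, 0 <= F z) ->
  \int[gam]_x \int[gam]_y F (x, y) =
  \int[leb]_x \int[leb]_y (F (x, y) * (gauss x * gauss y)%:E).
Proof.
move=> mF F0.
have mg := @measurable_gauss R.
rewrite integral_std_normal; last 2 first.
- exact: (@measurable_fun_fubini_tonelli_F _ _ _ _ _ gam F).
- by move=> x; exact: integral_ge0.
apply: eq_integral => x _.
have mFx := measurable_fun_sec1 x mF.
rewrite integral_std_normal// -ge0_integralZr ?lee_fin ?gauss_ge0//.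
- by apply: eq_integral => y _; rewrite -muleA EFinM [(gauss x)%:E * _]muleC.
- by apply: emeasurable_funM => //; exact/measurable_EFinP.
- by move=> y _; rewrite mule_ge0// lee_fin gauss_ge0.
Qed.

(** The product density depends only on x^2 + y^2, so it can be carried along in the integrand of
    the rotation formula for Lebesgue measure. *)
Lemma integral_rotation (c s : R) F : (s != 0)%R -> (c ^+ 2 + s ^+ 2 = 1)%R ->
  measurable_fun [set: R * R] F -> (forall z, 0 <= F z) ->
  \int[gam]_x \int[gam]_y F (c * x - s * y, s * x + c * y)%R =
  \int[gam]_x \int[gam]_y F (x, y).
Proof.
move=> s0 cs mF F0.
have mS : measurable_fun [set: R * R]
    (fun z : R * R => (c * z.1 - s * z.2, s * z.1 + c * z.2))%R.
  apply: measurable_fun_pair.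
    by apply: measurable_funB => //; exact: measurable_funM.
  by apply: measurable_funD => //; exact: measurable_funM.
have mg := @measurable_gauss R.
have mgg : measurable_fun [set: R * R] (fun z => (gauss z.1 * gauss z.2)%:E).
  apply/measurable_EFinP; apply: measurable_funM.
    exact: (measurableT_comp mg).
  exact: (measurableT_comp mg).
pose H z := F z * (gauss z.1 * gauss z.2)%:E.
have mH : measurable_fun [set: R * R] H by exact: emeasurable_funM.
have H0 z : 0 <= H z by rewrite mule_ge0// lee_fin mulr_ge0// gauss_ge0.
apply: (etrans (std_normal2 (measurableT_comp mF mS) (fun z => F0 _))).
apply: (etrans _ (esym (std_normal2 mF F0))).
apply: (etrans _ (integral_rotation_leb s0 cs mH H0)).
apply: eq_integral => x _; apply: eq_integral => y _; congr (_ * _%:E).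
rewrite /= !gaussE mulrACA [RHS]mulrACA -!expRD; congr (_ * expR _)%R.
rewrite -!mulrDl -!opprD; congr (- _ / _)%R.
rewrite [RHS](_ : _ = (c ^+ 2 + s ^+ 2) * (x ^+ 2 + y ^+ 2))%R; last by ring.
by rewrite cs mul1r.
Qed.

End gaussian_plane.

(** * Orthogonal invariance of the standard Gaussian law *)

Section gaussian_space.
Context {R : realType}.
Local Notation gam := (@std_normal R).
Local Notation gamn := (@std_gaussian R).

Definition dot n (v g : n.-tuple R) : R := \sum_(i < n) tnth v i * tnth g i.

Lemma dot_cons n (x y : R) (v g : n.-tuple R) :
  dot [tuple of x :: v] [tuple of y :: g] = x * y + dot v g.
Proof.
rewrite /dot big_ord_recl /= !tnth0; congr (_ + _).
by apply: eq_bigr => i _; rewrite !tnthS.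
Qed.

Lemma dotC n (v g : n.-tuple R) : dot v g = dot g v.
Proof. by apply: eq_bigr => i _; rewrite mulrC. Qed.

Lemma dot0 n (g : n.-tuple R) : dot [tuple of nseq n 0] g = 0.
Proof.
by rewrite /dot big1// => i _; rewrite (tnth_nth 0) nth_nseq if_same mul0r.
Qed.

Lemma dotDr n (v g h : n.-tuple R) : dot v (tuple_add g h) = dot v g + dot v h.
Proof.
by rewrite /dot -big_split; apply: eq_bigr => i _; rewrite tnth_mktuple mulrDr.
Qed.

Lemma measurable_dot n (v : n.-tuple R) : measurable_fun [set: n.-tuple R] (dot v).
Proof.
apply: measurable_sum => i; apply: measurable_funM => //.
exact: measurable_tnth.
Qed.

Lemma measurable_tuple_add n (h : n.-tuple R) :
  measurable_fun [set: n.-tuple R] (fun g => tuple_add g h).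
Proof.
apply/measurable_fun_tnthP => i.
rewrite (_ : _ \o _ = fun g => tnth g i + tnth h i); last first.
  by apply/funext => g /=; rewrite tnth_mktuple.
by apply: measurable_funD => //; exact: measurable_tnth.
Qed.

Lemma measurable_thead n : measurable_fun [set: n.+1.-tuple R] (fun g => thead g).
Proof. exact: measurable_tnth. Qed.

Lemma behead_cons_tuple n (x : R) (t : n.-tuple R) :
  [tuple of behead [tuple of x :: t]] = t.
Proof. by apply/val_inj. Qed.

Lemma integral_gaussian_cons n (F : n.+1.-tuple R -> \bar R) :
  measurable_fun [set: n.+1.-tuple R] F -> (forall z, 0 <= F z)%E ->
  (\int[gamn n.+1]_g F g = \int[gam]_x \int[gamn n]_t F [tuple of x :: t])%E.
Proof.
move=> mF F0.
have mc := @measurable_tuple_cons _ R n.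
rewrite [LHS](@ge0_integral_pushforward _ _ _ _ _ _ mc
  (gam \x gamn n)%E setT F measurableT mF (fun x _ => F0 x)).
rewrite preimage_setT.
apply: (etrans (fubini_tonelli1 (F \o @tuple_cons _ R n) (measurableT_comp mF mc) (fun z => F0 _))).
by [].
Qed.

Lemma integral_gaussian0 (F : 0.-tuple R -> \bar R) :
  measurable_fun [set: 0.-tuple R] F -> (forall z, 0 <= F z)%E ->
  (\int[gamn 0]_g F g = F [tuple])%E.
Proof.
move=> mF F0; rewrite integral_dirac// diracT mul1e.
by [].
Qed.

(** An orthogonal map [T] with its transpose [Ts], recorded through its effect on integrals and
    inner products instead of a matrix. [T] acts on the Gaussian point and [Ts] on the directions.
    In this form the notion is stable under composition and under adding a fixed first coordinate,
    so planar rotations generate all the maps used. *)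
Record gauss_isometry n (T Ts : n.-tuple R -> n.-tuple R) : Prop := GaussIsometry {
  gi_measurable : measurable_fun setT T ;
  gi_integral : forall F, measurable_fun [set: n.-tuple R] F ->
    (forall z, 0 <= F z)%E -> (\int[gamn n]_g F (T g) = \int[gamn n]_g F g)%E ;
  gi_adjoint : forall v g, dot v (T g) = dot (Ts v) g ;
  gi_dot : forall v w, dot (Ts v) (Ts w) = dot v w }.

Lemma gauss_isometry_id n : gauss_isometry (@id (n.-tuple R)) id.
Proof. by split => //; exact: measurable_id. Qed.

Lemma gauss_isometry_comp n (T Ts U Us : n.-tuple R -> n.-tuple R) :
  gauss_isometry T Ts -> gauss_isometry U Us ->
  gauss_isometry (T \o U) (Us \o Ts).
Proof.
move=> [mT iT aT dT] [mU iU aU dU]; split => [|F mF F0|v g|v w] /=.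
- exact: measurableT_comp.
- have mFT := measurableT_comp mF mT.
  by rewrite (iU _ mFT (fun z => F0 _)) iT.
- by rewrite aT aU.
- by rewrite dU dT.
Qed.

Definition cons_map n (T : n.-tuple R -> n.-tuple R) (g : n.+1.-tuple R) :
  n.+1.-tuple R := [tuple of thead g :: T [tuple of behead g]].

Lemma cons_mapE n (T : n.-tuple R -> n.-tuple R) (x : R) (t : n.-tuple R) :
  cons_map T [tuple of x :: t] = [tuple of x :: T t].
Proof. by rewrite /cons_map theadE behead_cons_tuple. Qed.

Lemma gauss_isometry_cons n (T Ts : n.-tuple R -> n.-tuple R) :
  gauss_isometry T Ts -> gauss_isometry (cons_map T) (cons_map Ts).
Proof.
move=> [mT iT aT dT].
have mC : measurable_fun setT (cons_map T).
  apply: measurable_cons; first exact: measurable_thead.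
  by apply: (measurableT_comp mT); exact: measurable_behead.
split => [//|F mF F0|v g|v w].
- rewrite (integral_gaussian_cons (measurableT_comp mF mC) (fun z => F0 _)).
  rewrite (integral_gaussian_cons mF F0); apply: eq_integral => x _.
  under eq_integral => t _ do rewrite /= cons_mapE.
  apply: (iT (fun t => F [tuple of x :: t])) => //.
  by apply: (measurableT_comp mF); apply: measurable_cons.
- by case/tupleP: v => x v; case/tupleP: g => y g;
    rewrite !cons_mapE !dot_cons aT.
- by case/tupleP: v => x v; case/tupleP: w => y w;
    rewrite !cons_mapE !dot_cons dT.
Qed.

Definition rot_map n (c s : R) (g : n.+2.-tuple R) : n.+2.-tuple R :=
  let x := thead g in let y := thead [tuple of behead g] in
  [tuple of c * x - s * y :: [tuple of s * x + c * y ::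
    [tuple of behead [tuple of behead g]]]].

Lemma rot_map_cons n (c s x y : R) (t : n.-tuple R) :
  rot_map c s [tuple of x :: [tuple of y :: t]] =
  [tuple of c * x - s * y :: [tuple of s * x + c * y :: t]].
Proof. by rewrite /rot_map !(theadE, behead_cons_tuple). Qed.

Lemma gauss_isometry_rot n (c s : R) : s != 0 -> c ^+ 2 + s ^+ 2 = 1 ->
  gauss_isometry (@rot_map n c s) (@rot_map n c (- s)).
Proof.
move=> s0 cs.
have mth : measurable_fun [set: n.+2.-tuple R] (fun g => thead g).
  exact: measurable_thead.
have mth2 : measurable_fun [set: n.+2.-tuple R] (fun g => thead [tuple of behead g]).
  exact: (measurableT_comp (@measurable_thead n) (@measurable_behead _ _ n.+1)).
have mC : measurable_fun setT (@rot_map n c s).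
  apply: measurable_cons.
    by apply: measurable_funB; exact: measurable_funM.
  apply: measurable_cons.
    by apply: measurable_funD; exact: measurable_funM.
  exact: (measurableT_comp (@measurable_behead _ _ n) (@measurable_behead _ _ n.+1)).
split => [//|F mF F0|v g|v w].
- have mFC := measurableT_comp mF mC.
  have mcc x : measurable_fun [set: n.+1.-tuple R] (fun t => F [tuple of x :: t]).
    by apply: (measurableT_comp mF); apply: measurable_cons.
  have mccC x : measurable_fun [set: n.+1.-tuple R]
      (fun t => F (rot_map c s [tuple of x :: t])).
    by apply: (measurableT_comp mFC); apply: measurable_cons.
  rewrite (integral_gaussian_cons mFC (fun z => F0 _)).
  rewrite (integral_gaussian_cons mF F0).
  under eq_integral => x _ do
    rewrite /= (integral_gaussian_cons (mccC x) (fun z => F0 _)).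
  under [RHS]eq_integral => x _ do
    rewrite (integral_gaussian_cons (mcc x) (fun z => F0 _)).
  pose K (z : R * R) : \bar R :=
    (\int[gamn n]_t F [tuple of z.1 :: [tuple of z.2 :: t]])%E.
  have mK : measurable_fun [set: R * R] K.
    apply: (@measurable_fun_fubini_tonelli_F _ _ _ _ _ (gamn n)
      (fun w : (R * R) * n.-tuple R =>
         F [tuple of w.1.1 :: [tuple of w.1.2 :: w.2]])) => //.
    apply: (measurableT_comp mF); apply: measurable_cons.
      exact: (measurableT_comp measurable_fst).
    apply: measurable_cons => //.
    exact: (measurableT_comp measurable_snd).
  apply: (etrans _ (integral_rotation s0 cs mK (fun z => integral_ge0 _ (fun t _ => F0 _)))).
  apply: eq_integral => x _; apply: eq_integral => y _.
  by apply: eq_integral => t _; rewrite rot_map_cons.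
- case/tupleP: v => x v; case/tupleP: v => x' v.
  case/tupleP: g => y g; case/tupleP: g => y' g.
  by rewrite !rot_map_cons !dot_cons; ring.
- case/tupleP: v => x v; case/tupleP: v => x' v.
  case/tupleP: w => y g; case/tupleP: g => y' g.
  rewrite !rot_map_cons !dot_cons addrA [RHS]addrA; congr (_ + _).
  rewrite [RHS](_ : _ = (c ^+ 2 + s ^+ 2) * (x * y + x' * y')); first by ring.
  by rewrite cs mul1r.
Qed.

(** Givens rotations: by induction the tail of the vector is brought to (a, 0, ..., 0), and one
    rotation in the first two coordinates then merges [a] into the head. *)
Lemma gauss_isometry_axis n (v : n.+1.-tuple R) :
  exists T Ts, gauss_isometry T Ts /\
    exists a, Ts v = [tuple of a :: [tuple of nseq n 0]].
Proof.
elim: n v => [|n IH] v.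
  exists id, id; split; first exact: gauss_isometry_id.
  exists (thead v); case/tupleP: v => x v; rewrite theadE.
  by apply/val_inj => /=; rewrite (tuple0 v).
case/tupleP: v => x v.
have [T [Ts [gT [a Tsv]]]] := IH v.
have gC := gauss_isometry_cons gT.
have CE : cons_map Ts [tuple of x :: v] =
    [tuple of x :: [tuple of a :: [tuple of nseq n 0]]].
  by rewrite cons_mapE Tsv.
(* If [a] vanishes the vector already lies on the axis. The rotation used otherwise would have sine
   0, which [gauss_isometry_rot] excludes. *)
have [a0|a0] := eqVneq a 0.
  exists (cons_map T), (cons_map Ts); split=> //; exists x.
  by rewrite CE a0; apply/val_inj.
have q0 : 0 < x ^+ 2 + a ^+ 2.
  by rewrite ltr_wpDl ?sqr_ge0// exprn_even_gt0.
pose r := Num.sqrt (x ^+ 2 + a ^+ 2).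
have r0 : r != 0 by rewrite gt_eqF// sqrtr_gt0.
have r2 : r ^+ 2 = x ^+ 2 + a ^+ 2 by rewrite sqr_sqrtr// ltW.
have s0 : a / r != 0 by rewrite mulf_neq0// invr_eq0.
have cs : (x / r) ^+ 2 + (a / r) ^+ 2 = 1.
  by rewrite !expr_div_n -mulrDl -r2 divff// expf_neq0.
have gR := @gauss_isometry_rot n _ _ s0 cs.
exists (cons_map T \o rot_map (x / r) (a / r)),
  (rot_map (x / r) (- (a / r)) \o cons_map Ts).
split; first exact: gauss_isometry_comp.
exists (x / r * x + a / r * a).
rewrite /= CE rot_map_cons; apply/val_inj => /=; congr [:: _, _ & _]; ring.
Qed.

End gaussian_space.

Section gaussian_projections.
Context {R : realType}.
Local Notation gam := (@std_normal R).
Local Notation gamn := (@std_gaussian R).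

(* Rotate one vector onto the first coordinate axis: orthogonality confines the
   others to the remaining coordinates. *)
Lemma integral_gaussian_orthonormal n (I : eqType) (s : seq I)
    (v : I -> n.-tuple R) (f : I -> R -> R) :
  uniq s -> {in s, forall i, dot (v i) (v i) = 1} ->
  {in s &, forall i j, i != j -> dot (v i) (v j) = 0} ->
  (forall i, measurable_fun [set: R] (f i)) -> (forall i x, 0 <= f i x) ->
  (\int[gamn n]_g (\prod_(i <- s) f i (dot (v i) g))%:E =
   \prod_(i <- s) \int[gam]_x (f i x)%:E)%E.
Proof.
move=> + + + mf f0.
have mprod m (t : seq I) (u : I -> m.-tuple R) : measurable_fun [set: m.-tuple R]
    (fun g => (\prod_(i <- t) f i (dot (u i) g))%:E).
  apply/measurable_EFinP/measurable_prod => i _.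
  by apply: (measurableT_comp (mf i)); exact: measurable_dot.
have prod0 m (t : seq I) (u : I -> m.-tuple R) g :
    (0 <= (\prod_(i <- t) f i (dot (u i) g))%:E)%E.
  by rewrite lee_fin prodr_ge0.
elim: n s v => [|n IH] [|i s] v us v1 vo.
- by under eq_integral do rewrite big_nil; rewrite big_nil integral_cst//= probability_setT mul1e.
- by have := v1 i (mem_head _ _); rewrite /dot big_ord0 => /eqP; rewrite eq_sym oner_eq0.
- by under eq_integral do rewrite big_nil; rewrite big_nil integral_cst//= probability_setT mul1e.
have [T [Ts [gT [a Tva]]]] := gauss_isometry_axis (v i).
have iE : (\int[gamn n.+1]_g (\prod_(j <- i :: s) f j (dot (v j) g))%:E =
  \int[gamn n.+1]_g (\prod_(j <- i :: s) f j (dot (Ts (v j)) g))%:E)%E.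
  rewrite -(gi_integral gT (mprod _ (i :: s) v) (prod0 _ _ _)).
  by apply: eq_integral => g _; under eq_bigr do rewrite (gi_adjoint gT).
rewrite iE {iE}.
have a1 : a ^+ 2 = 1.
  have := v1 i (mem_head _ _); rewrite -(gi_dot gT) Tva dot_cons dot0 addr0.
  by rewrite expr2.
have sIs j : j \in s -> j \in i :: s by rewrite in_cons => ->; rewrite orbT.
pose w j := [tuple of behead (Ts (v j))].
have wE j : j \in s -> Ts (v j) = [tuple of 0 :: w j].
  move=> js.
  have ji : i != j by apply: contraTneq js => <-; case/andP: us.
  have := vo i j (mem_head _ _) (sIs _ js) ji.
  rewrite -(gi_dot gT) Tva /w; case/tupleP: (Ts (v j)) => x u.
  rewrite dot_cons dot0 addr0 behead_cons_tuple => /eqP.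
  rewrite mulf_eq0 => /orP[/eqP a0|/eqP ->//].
  by move: a1; rewrite a0 expr0n/= => /esym/eqP; rewrite oner_eq0.
rewrite (integral_gaussian_cons (mprod _ (i :: s) _) (prod0 _ _ _)).
transitivity (\int[gam]_x ((f i (a * x))%:E *
    \int[gamn n]_t (\prod_(j <- s) f j (dot (w j) t))%:E))%E.
  apply: eq_integral => x _.
  rewrite -ge0_integralZl ?lee_fin//; last exact: mprod.
  apply: eq_integral => t _; rewrite big_cons -EFinM; congr (_ * _)%:E.
    by rewrite Tva dot_cons dot0 addr0.
  rewrite big_seq [RHS]big_seq; apply: eq_bigr => j js.
  by rewrite (wE _ js) dot_cons mul0r add0r.
have mfi : measurable_fun [set: R] (fun x => (f i x)%:E) by exact/measurable_EFinP.
have mfia : measurable_fun [set: R] (fun x => (f i (a * x))%:E).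
  by apply: (measurableT_comp mfi); exact: measurable_funM.
rewrite ge0_integralZr//; last 2 first.
- by move=> x _; rewrite lee_fin.
- by apply: integral_ge0 => t _; exact: prod0.
rewrite IH; last 3 first.
- by case/andP: us.
- move=> j js; have := v1 j (sIs _ js).
  by rewrite -(gi_dot gT) (wE _ js) dot_cons mul0r add0r.
- move=> j k js ks jk; have := vo j k (sIs _ js) (sIs _ ks) jk.
  by rewrite -(gi_dot gT) (wE _ js) (wE _ ks) dot_cons mul0r add0r.
rewrite big_cons; congr (_ * _)%E.
(* The image of a unit vector on the axis has coordinate 1 or -1, and the symmetry of N(0, 1)
   settles the second case. *)
have /eqP : a ^+ 2 = 1 by [].
rewrite sqrf_eq1 => /orP[/eqP ->|/eqP ->].
  by apply: eq_integral => x _; rewrite mul1r.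
rewrite -[RHS](integral_std_normal_opp mfi); last by move=> x; rewrite lee_fin.
by apply: eq_integral => x _; rewrite mulN1r.
Qed.

(** Cameron-Martin formula in dimension n, obtained one coordinate at a time with Fubini. *)
Lemma integral_gaussian_shift n (h : n.-tuple R) (F : n.-tuple R -> \bar R) :
  measurable_fun [set: n.-tuple R] F -> (forall z, 0 <= F z)%E ->
  (\int[gamn n]_g F (tuple_add g h) =
   \int[gamn n]_g (F g * (expR (dot h g - dot h h / 2))%:E))%E.
Proof.
have mexp m (k : m.-tuple R) : measurable_fun [set: m.-tuple R]
    (fun g => (expR (dot k g - dot k k / 2))%:E).
  apply/measurable_EFinP/measurableT_comp => //.
  by apply: measurable_funB => //; exact: measurable_dot.
elim: n h F => [|n IH] h F mF F0.
  have mFe : measurable_fun [set: 0.-tuple R]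
      (fun g => F g * (expR (dot h g - dot h h / 2))%:E)%E.
    exact: (emeasurable_funM mF (mexp _ h)).
  rewrite !integral_gaussian0//; last 2 first.
  - by move=> z; rewrite mule_ge0// lee_fin expR_ge0.
  - exact: (measurableT_comp mF (measurable_tuple_add h)).
  rewrite /dot !big_ord0 mul0r subr0 expR0 mule1.
  by congr F; rewrite [LHS]tuple0.
case/tupleP: h => a h.
have FE0 z : (0 <= F z * (expR (dot [tuple of a :: h] z -
    dot [tuple of a :: h] [tuple of a :: h] / 2))%:E)%E.
  by rewrite mule_ge0// lee_fin expR_ge0.
rewrite (integral_gaussian_cons
  (measurableT_comp mF (measurable_tuple_add [tuple of a :: h])) (fun z => F0 _)).
rewrite (integral_gaussian_cons (emeasurable_funM mF (mexp _ [tuple of a :: h])) FE0).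
have mFx x : measurable_fun [set: n.-tuple R] (fun t => F [tuple of x :: t]).
  by apply: (measurableT_comp mF); exact: measurable_cons.
have mFz : measurable_fun [set: R * n.-tuple R]
    (fun z : R * n.-tuple R => F [tuple of z.1 :: z.2]).
  by apply: (measurableT_comp mF); exact: measurable_cons.
pose K x := (\int[gamn n]_t (F [tuple of x :: t] * (expR (dot h t - dot h h / 2))%:E))%E.
have K0 x : (0 <= K x)%E.
  by apply: integral_ge0 => t _; rewrite mule_ge0// lee_fin expR_ge0.
have mK : measurable_fun [set: R] K.
  apply: (@measurable_fun_fubini_tonelli_F _ _ _ _ _ (gamn n)
    (fun z => F [tuple of z.1 :: z.2] * (expR (dot h z.2 - dot h h / 2))%:E)%E) => //.
  - apply: emeasurable_funM => //.
    exact: (measurableT_comp (mexp _ h) measurable_snd).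
  - by move=> z; rewrite mule_ge0// lee_fin expR_ge0.
transitivity (\int[gam]_x K (x + a)%R)%E.
  apply: eq_integral => x _; rewrite /K -IH//.
  apply: eq_integral => t _ /=; congr F; apply: eq_from_tnth => i.
  rewrite tnth_mktuple; case: (unliftP ord0 i) => [j ->|->].
    by rewrite !tnthS tnth_mktuple.
  by rewrite !tnth0.
rewrite (integral_std_normal_shift a mK K0); apply: eq_integral => x _.
rewrite /K -ge0_integralZr ?lee_fin ?expR_ge0//; last 2 first.
- exact: (emeasurable_funM (mFx x) (mexp _ h)).
- by move=> t _; rewrite mule_ge0// lee_fin expR_ge0.
apply: eq_integral => t _; rewrite -muleA -EFinM -expRD !dot_cons.
by congr (_ * (expR _)%:E)%E; field.
Qed.

End gaussian_projections.

(** * Likelihood ratios of the sparse mixture *)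

Section mean_calculus.
Context d (T : measurableType d) (R : realType) (P : probability T R).
Implicit Types (g h : T -> R) (a b c : R).

(** Measurability, sign and a finite value of the integral travel together, so an inequality between
    expectations reduces to a pointwise one through [le_mean]. The price is that differences have to
    be rearranged until both sides are nonnegative. *)
Definition mean g a : Prop :=
  [/\ measurable_fun [set: T] g, forall x, 0 <= g x &
      (\int[P]_x (g x)%:E)%E = a%:E].

Lemma mean_uniq g a b : mean g a -> mean g b -> a = b.
Proof. by move=> [_ _ ga] [_ _]; rewrite ga => -[]. Qed.

Lemma mean_eq g h a : g =1 h -> mean g a -> mean h a.
Proof. by move=> /funext ->. Qed.

Lemma mean_cst c : 0 <= c -> mean (fun=> c) c.
Proof.
move=> c0; split => //.
by rewrite integral_cst//= probability_setT mule1.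
Qed.

Lemma meanD g h a b : mean g a -> mean h b -> mean (fun x => g x + h x) (a + b).
Proof.
move=> [mg g0 ga] [mh h0 hb]; split.
- exact: measurable_funD.
- by move=> x; rewrite addr_ge0.
- rewrite EFinD -ga -hb -ge0_integralD//.
  + by move=> x _; rewrite lee_fin.
  + exact/measurable_EFinP.
  + by move=> x _; rewrite lee_fin.
  + exact/measurable_EFinP.
Qed.

Lemma meanZ c g a : 0 <= c -> mean g a -> mean (fun x => c * g x) (c * a).
Proof.
move=> c0 [mg g0 ga]; split.
- exact: measurable_funM.
- by move=> x; rewrite mulr_ge0.
- rewrite EFinM -ga -ge0_integralZl//.
  + exact/measurable_EFinP.
  + by move=> x _; rewrite lee_fin.
Qed.

Lemma mean_sum (I : Type) (s : seq I) (g : I -> T -> R) (a : I -> R) :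
  (forall i, mean (g i) (a i)) ->
  mean (fun x => \sum_(i <- s) g i x) (\sum_(i <- s) a i).
Proof.
move=> ga; elim: s => [|i s IH].
  rewrite big_nil; apply: mean_eq (mean_cst (lexx 0)) => x.
  by rewrite big_nil.
rewrite big_cons; apply: mean_eq (meanD (ga i) IH) => x.
by rewrite big_cons.
Qed.

Lemma le_mean g h a b : mean g a -> mean h b -> (forall x, g x <= h x) -> a <= b.
Proof.
move=> [mg g0 ga] [mh h0 hb] gh; rewrite -lee_fin -ga -hb.
apply: ge0_le_integral => //.
- by move=> x _; rewrite lee_fin.
- exact/measurable_EFinP.
- exact/measurable_EFinP.
- by move=> x _; rewrite lee_fin.
Qed.

Lemma mean_ge0 g a : mean g a -> 0 <= a.
Proof.
move=> [mg g0 ga]; rewrite -lee_fin -ga; apply: integral_ge0 => x _.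
by rewrite lee_fin.
Qed.

Lemma mean_dominated g h b : measurable_fun [set: T] g ->
  (forall x, 0 <= g x <= h x) -> mean h b -> exists a, mean g a.
Proof.
move=> mg gh [mh h0 hb].
have g0 x : 0 <= g x by case/andP: (gh x).
exists (fine (\int[P]_x (g x)%:E)%E); split => //.
rewrite fineK// ge0_fin_numE; last by apply: integral_ge0 => x _; rewrite lee_fin.
apply: (@le_lt_trans _ _ (\int[P]_x (h x)%:E)%E); last by rewrite hb ltry.
apply: ge0_le_integral => //.
- by move=> x _; rewrite lee_fin.
- exact/measurable_EFinP.
- exact/measurable_EFinP.
- by move=> x _; rewrite lee_fin; case/andP: (gh x).
Qed.

Lemma mean_indic (A : set T) : measurable A -> mean \1_A (fine (P A)).
Proof.
move=> mA; split; first exact: measurable_indic.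
  by move=> x; rewrite indicE.
by rewrite integral_indic// setIT fineK// fin_num_measure.
Qed.

End mean_calculus.

Section normal_moments.
Context {R : realType}.
Local Notation gam := (@std_normal R).
Local Notation gamn := (@std_gaussian R).

Lemma mean_orthonormal n (I : eqType) (s : seq I) (v : I -> n.-tuple R)
    (f : I -> R -> R) (a : I -> R) :
  uniq s -> {in s, forall i, dot (v i) (v i) = 1} ->
  {in s &, forall i j, i != j -> dot (v i) (v j) = 0} ->
  (forall i, mean gam (f i) (a i)) ->
  mean (gamn n) (fun g => \prod_(i <- s) f i (dot (v i) g)) (\prod_(i <- s) a i).
Proof.
move=> us v1 vo fa.
have mf i : measurable_fun [set: R] (f i) by case: (fa i).
have f0 i x : 0 <= f i x by case: (fa i).
split.
- apply: measurable_prod => i _.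
  by apply: (measurableT_comp (mf i)); exact: measurable_dot.
- by move=> g; rewrite prodr_ge0.
- rewrite integral_gaussian_orthonormal// -prodEFin.
  by apply: eq_bigr => i _; case: (fa i).
Qed.

(** The shift formula applied to the constant function 1. *)
Lemma mean_expR (k : R) : mean gam (fun x => expR (k * x)) (expR (k ^+ 2 / 2)).
Proof.
have mk : measurable_fun [set: R] (fun x => expR (k * x)).
  by apply: measurableT_comp => //; exact: measurable_funM.
split => //.
have := @integral_std_normal_shift R k (cst 1%E) (measurable_cst _) (fun=> lee01).
rewrite integral_cst//= probability_setT mule1.
under eq_integral do rewrite mul1e expRD EFinM.
have mkE : measurable_fun [set: R] (fun x => (expR (k * x))%:E).
  exact/measurable_EFinP.
rewrite ge0_integralZr ?lee_fin ?expR_ge0//.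
move/(congr1 (fun z => z * (expR (k ^+ 2 / 2))%:E)%E).
by rewrite mul1e -muleA -EFinM -expRD addNr expR0 mule1 => <-.
Qed.

(** Density of N(tau, 1) with respect to N(0, 1). *)
Definition likelihood (tau x : R) := expR (tau * x - tau ^+ 2 / 2).

Lemma mean_expR_affine (k c : R) :
  mean gam (fun x => expR (k * x + c)) (expR (k ^+ 2 / 2 + c)).
Proof.
rewrite expRD mulrC; apply: mean_eq (meanZ (expR_ge0 c) (mean_expR k)) => x.
by rewrite expRD mulrC.
Qed.

Lemma mean_likelihood tau : mean gam (likelihood tau) 1.
Proof.
by have := mean_expR_affine tau (- (tau ^+ 2 / 2)); rewrite addrN expR0.
Qed.

Definition mixture_lr (eps tau x : R) := 1 - eps + eps * likelihood tau x.

Definition truncated_lr (eps tau t x : R) :=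
  1 - eps + eps * (likelihood tau x * \1_(`]-oo, t] : set R) x).

Lemma mean_mixture_lr eps tau : 0 <= eps <= 1 ->
  mean gam (mixture_lr eps tau) 1.
Proof.
move=> /andP[e0 e1].
have e1' : 0 <= 1 - eps by rewrite subr_ge0.
have := meanD (mean_cst gam e1') (meanZ e0 (mean_likelihood tau)).
by rewrite mulr1 subrK.
Qed.

Lemma truncated_lr_le eps tau t x : 0 <= eps <= 1 ->
  0 <= truncated_lr eps tau t x <= mixture_lr eps tau x.
Proof.
move=> /andP[e0 e1]; rewrite /truncated_lr /mixture_lr.
have l0 : 0 <= likelihood tau x by exact: expR_ge0.
rewrite addr_ge0 ?subr_ge0//=; last by rewrite !mulr_ge0.
rewrite lerD2l ler_wpM2l// ler_piMr//.
Qed.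

Lemma measurable_truncated_lr eps tau t :
  measurable_fun [set: R] (truncated_lr eps tau t).
Proof.
apply: measurable_funD => //; apply: measurable_funM => //.
apply: measurable_funM; last exact: measurable_indic.
by case: (mean_likelihood tau).
Qed.

(* Beyond the threshold t >= tau the factor e^{(t - tau)(x - t)} is >= 1. *)
Lemma mean_truncated_lr eps tau t : 0 <= eps <= 1 -> tau <= t ->
  exists2 a, mean gam (truncated_lr eps tau t) a &
    1 - eps * expR (- (t - tau) ^+ 2 / 2) <= a.
Proof.
move=> e01 tt; have [e0 e1] := andP e01.
have [a ma] := mean_dominated (measurable_truncated_lr eps tau t)
  (fun x => truncated_lr_le tau t x e01) (mean_mixture_lr tau e01).
exists a => //.
pose c := - ((t - tau) * t) - tau ^+ 2 / 2.
have := meanD ma (meanZ e0 (mean_expR_affine t c)).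
rewrite (_ : t ^+ 2 / 2 + c = - (t - tau) ^+ 2 / 2); last by rewrite /c; field.
move=> /(le_mean (mean_mixture_lr tau e01)) H.
rewrite lerBlDr; apply: H => x; rewrite /mixture_lr /truncated_lr.
rewrite -[leRHS]addrA lerD2l -mulrDr ler_wpM2l// indicE mem_setE in_itv/=.
case: (leP x t) => xt; first by rewrite mulr1 lerDl expR_ge0.
rewrite mulr0 add0r /likelihood ler_expR /c addrA lerD2r -subr_ge0.
rewrite (_ : _ - _ = (t - tau) * (x - t)); last by ring.
by rewrite mulr_ge0// subr_ge0// ltW.
Qed.

(** On x <= t one has 2 tau x <= k x + (2 tau - k) t, so the truncated second moment is bounded by a
    full exponential moment and no Gaussian tail has to be estimated. The slope [k] stays free: k =
    2 tau gives the bound without truncation, smaller values exploit it. The remaining terms add up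
    to 1 - eps^2, which is at most 1. *)
Lemma mean_truncated_lr_sqr eps tau t k : 0 <= eps <= 1 -> k <= 2 * tau ->
  exists2 b, mean gam (fun x => truncated_lr eps tau t x ^+ 2) b &
    b <= 1 + eps ^+ 2 * expR (k ^+ 2 / 2 + (2 * tau - k) * t - tau ^+ 2).
Proof.
move=> e01 kt; have [e0 e1] := andP e01.
have e1' : 0 <= 1 - eps by rewrite subr_ge0.
have m1 := mean_cst gam (exprn_ge0 2 e1').
have c2 : 0 <= 2 * (eps * (1 - eps)) by rewrite !mulr_ge0.
have m2 := meanZ c2 (mean_likelihood tau).
have m3 := meanZ (exprn_ge0 2 e0) (mean_expR_affine k ((2 * tau - k) * t - tau ^+ 2)).
have m := meanD (meanD m1 m2) m3.
have le x : 0 <= truncated_lr eps tau t x ^+ 2 <= (1 - eps) ^+ 2 +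
    2 * (eps * (1 - eps)) * likelihood tau x +
    eps ^+ 2 * expR (k * x + ((2 * tau - k) * t - tau ^+ 2)).
  rewrite sqr_ge0/= /truncated_lr indicE mem_setE in_itv/=.
  have l0 : 0 <= likelihood tau x by exact: expR_ge0.
  case: (leP x t) => xt; last first.
    rewrite !mulr0 addr0 -addrA lerDl addr_ge0// mulr_ge0 ?expR_ge0//.
    exact: sqr_ge0.
  rewrite mulr1 [leLHS](_ : _ = (1 - eps) ^+ 2 +
    2 * (eps * (1 - eps)) * likelihood tau x + eps ^+ 2 * likelihood tau x ^+ 2);
    last by ring.
  rewrite lerD2l ler_wpM2l ?sqr_ge0// /likelihood -expRM_natl ler_expR -subr_ge0.
  rewrite (_ : _ - _ = (2 * tau - k) * (t - x)); last by field.
  by rewrite mulr_ge0 ?subr_ge0.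
have [b mb] := mean_dominated (measurable_funX 2 (measurable_truncated_lr eps tau t)) le m.
exists b => //; apply: (le_trans (le_mean mb m (fun x => (andP (le x)).2))).
rewrite -[_ - tau ^+ 2 in leRHS]addrA lerD2r mulr1 -subr_ge0.
by rewrite (_ : _ - _ = eps ^+ 2) ?sqr_ge0//; ring.
Qed.

End normal_moments.

(** * Splitting the coordinates into independent classes *)

Section resampling.
Context {R : realFieldType} (I : finType) (eps : R).
Hypothesis eps01 : 0 <= eps <= 1.
Implicit Types (F : {set I} -> R) (S T : {set I}) (s : seq I).

Definition resample F (i : I) S : R := (1 - eps) * F (S :\ i)%SET + eps * F (i |: S)%SET.

Definition resample_all s F : {set I} -> R := foldr (fun i G => resample G i) F s.

Definition bernoulli_weight S : R := \prod_i (if i \in S then eps else 1 - eps).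

Lemma bernoulli_weight_sum : \sum_S bernoulli_weight S = 1.
Proof.
transitivity (\prod_(i : I) (eps + (1 - eps))).
  by rewrite bigA_distr.
by rewrite big1// => i _; rewrite addrC subrK.
Qed.

Lemma bernoulli_weight_ge0 S : 0 <= bernoulli_weight S.
Proof.
have /andP[e0 e1] := eps01.
by apply: prodr_ge0 => i _; case: ifP => _ //; rewrite subr_ge0.
Qed.

Lemma sum_set_split (i : I) F :
  \sum_S F S = \sum_(S : {set I} | i \notin S) (F S + F (i |: S)%SET).
Proof.
rewrite (bigID (fun S => i \notin S)) big_split /=; congr (_ + _).
rewrite (reindex_onto (fun S => i |: S)%SET (fun S => S :\ i)%SET); last first.
  by move=> S; rewrite negbK => /finset.setD1K.
apply: eq_bigl => S; rewrite negbK in_setU1 eqxx/=.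
apply/eqP/idP => [<-|iS]; first by rewrite setD11.
by rewrite setU1K.
Qed.

Lemma sum_resample F (i : I) :
  \sum_S bernoulli_weight S * F S =
  \sum_S bernoulli_weight S * resample F i S.
Proof.
rewrite (sum_set_split i) [RHS](sum_set_split i); apply: eq_bigr => S iS.
have bw T : bernoulli_weight T = (if i \in T then eps else 1 - eps) *
    \prod_(j | j != i) (if j \in T then eps else 1 - eps).
  by rewrite /bernoulli_weight (bigD1 i).
rewrite !bw (negbTE iS) in_setU1 eqxx/=.
have -> : \prod_(j | j != i) (if j \in (i |: S)%SET then eps else 1 - eps) =
    \prod_(j | j != i) (if j \in S then eps else 1 - eps).
  by apply: eq_bigr => j ji; rewrite in_setU1 (negbTE ji).
rewrite /resample setU1K// finset.setUA finset.setUid.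
have -> : (S :\ i = S)%SET.
  by apply/setP => j; rewrite in_setD1; case: eqP => // ->; rewrite (negbTE iS).
by ring.
Qed.

Lemma resample_all_const s F S T :
  (forall i, i \notin s -> (i \in S) = (i \in T)) ->
  resample_all s F S = resample_all s F T.
Proof.
elim: s S T => [|i s IH] S T ST /=.
  by congr F; apply/setP => i; exact: ST.
rewrite /resample; congr (_ * _ + _ * _); apply: IH => j js.
  rewrite !in_setD1; case: (eqVneq j i) => //= ji.
  by apply: ST; rewrite inE negb_or ji.
rewrite !in_setU1; case: (eqVneq j i) => //= ji.
by apply: ST; rewrite inE negb_or ji.
Qed.

(** Re-drawing one index preserves the weighted sum, and once all indices are re-drawn the result no
    longer depends on the starting set. The sum is therefore that constant, read off at the empty
    set. *)
Lemma sum_resample_all s F : (forall i, i \in s) ->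
  \sum_S bernoulli_weight S * F S = resample_all s F finset.set0.
Proof.
move=> sT; transitivity (\sum_S bernoulli_weight S * resample_all s F S).
  by elim: {sT} s => // i s IH; rewrite IH; exact: sum_resample.
rewrite -[RHS]mul1r -bernoulli_weight_sum mulr_suml; apply: eq_bigr => S _.
by congr (_ * _); apply: resample_all_const => i; rewrite sT.
Qed.

(** Re-drawing is an averaging. The hypothesis is restricted to sets inside the union of [S] and
    [s], since only those are reached; this keeps the indices of the other blocks switched off in
    [resample_all_flatten]. *)
Lemma resample_all_dist (c : R) s F G S :
  (forall T, {subset T <= [predU S & s]} -> `|F T - G T| <= c) ->
  `|resample_all s F S - resample_all s G S| <= c.
Proof.
have /andP[e0 e1] := eps01.
elim: s S => [|i s IH] S FG /=; first by apply: FG => i /= iS; rewrite inE iS.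
rewrite /resample (_ : _ - _ =
  (1 - eps) * (resample_all s F (S :\ i)%SET - resample_all s G (S :\ i)%SET) +
  eps * (resample_all s F (i |: S)%SET - resample_all s G (i |: S)%SET)); last by ring.
apply: (le_trans (ler_normD _ _)); rewrite !normrM.
rewrite (ger0_norm e0) (@ger0_norm _ (1 - eps)) ?subr_ge0//.
rewrite [leRHS](_ : c = (1 - eps) * c + eps * c); last by ring.
rewrite lerD// ler_wpM2l ?subr_ge0//; apply: IH => T TS; apply: FG => j /TS.
- rewrite !inE => /orP[/andP[_ ->]//|->]; by rewrite !orbT.
- by rewrite !inE => /orP[/orP[->|->]|->]; rewrite ?orbT.
Qed.

(* Each block moves the average by at most c, because re-drawing the other
   coordinates is a contraction for the sup norm. *)
Lemma resample_all_flatten (c : R) (ls : seq (seq I)) F S :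
  uniq (flatten ls) -> {in flatten ls, forall i, i \notin S} ->
  (forall l T, l \in ls -> {in l, forall i, i \notin T} ->
    `|resample_all l F T - F T| <= c) ->
  `|resample_all (flatten ls) F S - F S| <= (size ls)%:R * c.
Proof.
elim: ls S => [|l ls IH] S /= us lS H; first by rewrite subrr normr0 mul0r.
rewrite /resample_all foldr_cat -/(resample_all _ _) -/(resample_all _ _).
rewrite -(subrKA (resample_all l F S)) (le_trans (ler_normD _ _))//.
rewrite -natr1 mulrDl mul1r lerD//.
- apply: resample_all_dist => T TS; apply: IH.
  + by move: us; rewrite cat_uniq => /and3P[].
  + move=> i ils; apply/negP => /TS; rewrite inE => /orP[iS|il].
      by have := lS i; rewrite mem_cat ils orbT iS => /(_ isT).
    by move: us; rewrite cat_uniq => /and3P[_ /hasPn/(_ _ ils)]; rewrite /= il.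
  + by move=> l' T' l'ls; apply: H; rewrite inE l'ls orbT.
- apply: H; first by rewrite mem_head.
  by move=> i il; apply: lS; rewrite mem_cat il.
Qed.

End resampling.

Section coloring.
Context (I : finType) (e : rel I).
Hypotheses (e_refl : reflexive e) (e_sym : symmetric e).

(** Greedy colouring. By reflexivity a vertex counts among its own neighbours, so d = 0 forces [U]
    to be empty and [d] classes suffice where [d] proper neighbours would need d + 1. *)
Lemma independent_classes d (U : {set I}) :
  (forall i, i \in U -> (#|[set j in U | e i j]%SET| <= d)%N) ->
  exists ls : seq (seq I), [/\ (size ls <= d)%N, flatten ls =i U,
    uniq (flatten ls) &
    forall l, l \in ls -> {in l &, forall i j, i != j -> ~~ e i j}].
Proof.
elim: d U => [|d IH] U Ud.
  exists [::]; split => //= i; rewrite in_nil; apply/esym/negP => iU.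
  have := Ud i iU; rewrite leqn0 cards_eq0 => /eqP/setP/(_ i).
  by rewrite !inE iU e_refl.
pose Q (B : {set I}) := (B \subset U) &&
  [forall i in B, forall j in B, (i != j) ==> ~~ e i j].
have Q0 : Q finset.set0.
  by rewrite /Q finset.sub0set; apply/forall_inP => i; rewrite finset.in_set0.
(* Remove a maximal independent set: every vertex left loses a neighbour. *)
have [B /maxsetP[/andP[BU /forall_inP Be] Bmax] _] := maxset_exists Q0.
have Bi i j : i \in B -> j \in B -> i != j -> ~~ e i j.
  by move=> iB jB; have /forall_inP/(_ j jB)/implyP := Be i iB.
have [|ls [lsd lsU lsu lse]] := IH (U :\: B)%SET.
  move=> i; rewrite finset.in_setD => /andP[iB iU].
  have [/exists_inP[j jB eij]|] := boolP [exists j in B, e i j].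
    have jU : j \in U by move/fintype.subsetP: BU; apply.
    rewrite -ltnS (leq_trans _ (Ud i iU))// proper_card//.
    apply/fintype.properP; split.
      by apply/fintype.subsetP => k; rewrite !inE => /andP[/andP[_ ->] ->].
    by exists j; rewrite !inE ?jU ?jB.
  move=> /exists_inPn iBe.
  have /Bmax : Q (i |: B)%SET.
    apply/andP; split; first by rewrite finset.subUset finset.sub1set iU.
    apply/forall_inP => j; rewrite in_setU1 => /orP[/eqP ->|jB];
      apply/forall_inP => k; rewrite in_setU1 => /orP[/eqP ->|kB].
    - by rewrite eqxx.
    - by rewrite iBe// implybT.
    - by rewrite e_sym iBe// implybT.
    - by apply/implyP; exact: Bi.
  move=> /(_ (finset.subsetUr _ _)) /setP/(_ i).
  by rewrite in_setU1 eqxx (negbTE iB).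
exists (enum B :: ls); split => /=.
- by rewrite ltnS.
- move=> i; rewrite mem_cat mem_enum lsU finset.in_setD.
  case: (boolP (i \in B)) => //= iB; apply/esym.
  by move/fintype.subsetP: BU; apply.
- rewrite cat_uniq enum_uniq lsu andbT/=; apply/hasPn => i.
  by rewrite lsU finset.in_setD mem_enum => /andP[].
- move=> l; rewrite inE => /orP[/eqP -> i j|/lse//].
  by rewrite !mem_enum; exact: Bi.
Qed.

End coloring.

(** * Total variation bound for one class *)

Section product_likelihood.
Context {R : realType}.
Local Notation gam := (@std_normal R).
Local Notation gamn := (@std_gaussian R).

Lemma bernoulli_ineq (x : R) m : 0 <= x <= 1 -> 1 - m%:R * (1 - x) <= x ^+ m.
Proof.
move=> /andP[x0 x1]; elim: m => [|m IH]; first by rewrite mul0r subr0 expr0.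
rewrite exprS (@le_trans _ _ (x * (1 - m%:R * (1 - x))))//; last exact: ler_wpM2l.
rewrite -subr_ge0 -natr1 (_ : _ - _ = m%:R * (1 - x) ^+ 2); last by ring.
by rewrite mulr_ge0// sqr_ge0.
Qed.

(** With L the product likelihood ratio and Lt its truncation, 0 <= psi <= 1 bounds the difference
    by E(L - Lt) + E|Lt - 1|. The first term is at most m a by Bernoulli's inequality, m being the
    size of [s]. The second is controlled by E(Lt - 1)^2 <= e^(m b) - 1 + 2 m a, where the last part
    is due to E Lt being below 1. The parameter [lam] comes from |u| <= u^2 / (2 lam) + lam / 2 and
    avoids the Cauchy-Schwarz inequality. *)
Lemma mixture_product_distance n (I : eqType) (s : seq I) (v : I -> n.-tuple R)
    (eps tau t k lam a b : R) (psi : n.-tuple R -> R) (P0 P1 : R) :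
  uniq s -> {in s, forall i, dot (v i) (v i) = 1} ->
  {in s &, forall i j, i != j -> dot (v i) (v j) = 0} ->
  0 <= eps <= 1 -> tau <= t -> k <= 2 * tau -> 0 < lam ->
  a = eps * expR (- (t - tau) ^+ 2 / 2) ->
  b = eps ^+ 2 * expR (k ^+ 2 / 2 + (2 * tau - k) * t - tau ^+ 2) ->
  (forall g, psi g <= 1) -> mean (gamn n) psi P0 ->
  mean (gamn n) (fun g => psi g * \prod_(i <- s) mixture_lr eps tau (dot (v i) g)) P1 ->
  `|P1 - P0| <= (size s)%:R * a +
    (expR ((size s)%:R * b) - 1 + 2 * ((size s)%:R * a)) / (2 * lam) + lam / 2.
Proof.
move=> us v1 vo e01 tt kt lam0 -> -> psi1 mpsi mpsiL.
set a' := eps * _; set b' := eps ^+ 2 * _; set m := size s.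
have [x mx xa] := mean_truncated_lr e01 tt.
have [y my yb] := mean_truncated_lr_sqr t e01 kt.
have x01 : 0 <= x <= 1.
  rewrite (mean_ge0 mx)/=; apply: (le_mean mx (mean_mixture_lr tau e01)) => z.
  by case/andP: (truncated_lr_le tau t z e01).
have prodc (c : R) : \prod_(i <- s) c = c ^+ m by rewrite big_const_seq count_predT iter_mulr_1.
have mL := mean_orthonormal us v1 vo (fun=> mean_mixture_lr tau e01).
have mLt := mean_orthonormal us v1 vo (fun=> mx).
have mLt2 := mean_orthonormal us v1 vo (fun=> my).
rewrite !prodc in mL mLt mLt2; rewrite expr1n in mL.
set L := (fun g => _) in mL; set Lt := (fun g => _) in mLt.
have Lt2E g : \prod_(i <- s) truncated_lr eps tau t (dot (v i) g) ^+ 2 = Lt g ^+ 2.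
  by rewrite /Lt -prodrXl.
have {}mLt2 := mean_eq Lt2E mLt2.
have [_ psi0 _] := mpsi.
have xm : 1 - m%:R * a' <= x ^+ m.
  apply: le_trans (bernoulli_ineq m x01).
  by rewrite lerD2l lerN2 ler_wpM2l// lerBlDl -lerBlDr.
have ym : y ^+ m <= expR (m%:R * b').
  rewrite expRM_natl; apply: lerXn2r; rewrite ?nnegrE ?expR_ge0 ?(mean_ge0 my)//.
  by rewrite (le_trans yb)// expR_ge1Dx.
have l20 : 0 <= (2 * lam)^-1 by rewrite invr_ge0 mulr_ge0// ltW.
have lam20 : 0 <= lam / 2 by rewrite divr_ge0// ltW.
have l11 : 0 <= 1 + lam^-1 by rewrite addr_ge0// invr_ge0 ltW.
have mR := meanD mL (meanD (meanZ l20 (meanD mLt2 (mean_cst _ ler01))) (mean_cst _ lam20)).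
have mX := meanZ l11 mLt.
have eqle (u w : R) : u = w -> u <= w by move=> ->.
(* From |u| <= u^2 / (2 lam) + lam / 2 with u = Lt g - 1; the terms are moved so
   that only nonnegative functions get integrated. *)
have key g (A B : R) : A - B <= (L g - Lt g) + `|Lt g - 1| ->
    A + (1 + lam^-1) * Lt g <=
    B + (L g + ((2 * lam)^-1 * (Lt g ^+ 2 + 1) + lam / 2)).
  move=> H.
  have : `|Lt g - 1| <= (2 * lam)^-1 * (Lt g - 1) ^+ 2 + lam / 2.
    rewrite -subr_ge0 -[(Lt g - 1) ^+ 2](real_normK (num_real _)).
    rewrite (_ : _ - _ = (2 * lam)^-1 * (`|Lt g - 1| - lam) ^+ 2).
      by rewrite mulr_ge0// sqr_ge0.
    by field; rewrite gt_eqF.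
  move=> /(le_trans _) H2; rewrite -subr_ge0.
  have {}H : A - B <= L g - Lt g + ((2 * lam)^-1 * (Lt g - 1) ^+ 2 + lam / 2).
    by apply: (le_trans H); rewrite lerD2l; exact: H2.
  rewrite -subr_ge0 in H; apply: (le_trans H); apply: eqle.
  by field; rewrite gt_eqF.
have Ltp g : 0 <= Lt g <= L g.
  apply/andP; split.
    by apply: prodr_ge0 => i _; case/andP: (truncated_lr_le tau t (dot (v i) g) e01).
  by apply: ler_prod => i _; exact: truncated_lr_le.
have LtL g : 0 <= L g - Lt g by rewrite subr_ge0; case/andP: (Ltp g).
have dist g : `|psi g * L g - psi g| <= (L g - Lt g) + `|Lt g - 1|.
  rewrite -{2}[psi g]mulr1 -mulrBr normrM (ger0_norm (psi0 g)).
  apply: (@le_trans _ _ `|L g - 1|); first by rewrite ler_piMl.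
  rewrite -(subrKA (Lt g)) (le_trans (ler_normD _ _))//.
  by rewrite lerD2r ger0_norm.
have fin (A B : R) : A + (1 + lam^-1) * x ^+ m <=
    B + (1 + ((2 * lam)^-1 * (y ^+ m + 1) + lam / 2)) ->
    A - B <= m%:R * a' +
      (expR (m%:R * b') - 1 + 2 * (m%:R * a')) / (2 * lam) + lam / 2.
  move=> H.
  have h1 : A - B <= (1 - x ^+ m) + (y ^+ m + 1 - 2 * x ^+ m) * (2 * lam)^-1 + lam / 2.
    rewrite -subr_ge0 in H; rewrite -subr_ge0; apply: (le_trans H).
    by apply: eqle; field; rewrite gt_eqF.
  apply: (le_trans h1); rewrite lerD2r lerD//; first by rewrite lerBlDl -lerBlDr.
  rewrite ler_wpM2r//; move: xm ym.
  by move: (x ^+ m) (y ^+ m) (m%:R * a') (expR (m%:R * b')) => u w u' w'; lra.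
rewrite ler_norml; apply/andP; split.
  rewrite lerNl opprB; apply: fin.
  apply: (le_mean (meanD mpsi mX) (meanD mpsiL mR)) => g; apply: key.
  by apply: le_trans (dist g); rewrite distrC ler_norm.
apply: fin.
apply: (le_mean (meanD mpsiL mX) (meanD mpsi mR)) => g; apply: key.
by apply: le_trans (dist g); rewrite ler_norm.
Qed.

End product_likelihood.

(** * The Gaussian sequence model *)

Section sequence_model.
Context {R : realType} (p : nat) (A : 'M[R]_p).
Local Notation gamn := (@std_gaussian R).
Let Omega := invmx (A *m A^T).
Hypothesis uS : A *m A^T \in unitmx.

Definition signal_vec (tau : R) (S : {set 'I_p}) : p.-tuple R :=
  [tuple if i \in S then tau else 0 | i < p].

(* The i-th column of A^-1; X_i = (Omega A g)_i is its inner product with g. *)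
Definition innovation (i : 'I_p) : p.-tuple R := [tuple invmx A j i | j < p].

Lemma factor_unit : A \in unitmx.
Proof. by have := uS; rewrite unitmx_mul => /andP[]. Qed.

Lemma OmegaE : Omega = (invmx A)^T *m invmx A.
Proof.
have uA := factor_unit.
have E : ((invmx A)^T *m invmx A) *m (A *m A^T) = 1%:M.
  rewrite mulmxA -(mulmxA _ (invmx A)) mulVmx// mulmx1 -trmx_mul mulmxV//.
  exact: trmx1.
by rewrite -[RHS]mulmx1 -(mulmxV uS) mulmxA E mul1mx.
Qed.

Lemma Omega_sym i j : Omega i j = Omega j i.
Proof.
suff -> : Omega i j = Omega^T i j by rewrite mxE.
by rewrite OmegaE trmx_mul trmxK.
Qed.

Lemma dot_innovation i j : dot (innovation i) (innovation j) = Omega i j.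
Proof.
rewrite OmegaE mxE; apply: eq_bigr => k _.
by rewrite !tnth_mktuple mxE.
Qed.

Lemma tnth_tuple_mulmx (M : 'M[R]_p) g i :
  tnth (tuple_mulmx M g) i = \sum_(j < p) M i j * tnth g j.
Proof. by rewrite tnth_mktuple mxE; apply: eq_bigr => j _; rewrite mxE. Qed.

Lemma measurable_tuple_mulmx (M : 'M[R]_p) :
  measurable_fun [set: p.-tuple R] (tuple_mulmx M).
Proof.
apply/measurable_fun_tnthP => i.
rewrite (_ : _ \o _ = fun g => \sum_(j < p) M i j * tnth g j); last first.
  by apply/funext => g; exact: tnth_tuple_mulmx.
apply: measurable_sum => j; apply: measurable_funM => //.
exact: measurable_tnth.
Qed.

Lemma innovationE i g : tnth (tuple_mulmx Omega (tuple_mulmx A g)) i = dot (innovation i) g.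
Proof.
rewrite tnth_mktuple.
have -> : col_of_tuple (tuple_mulmx A g) = A *m col_of_tuple g.
  by apply/matrixP => k l; rewrite mxE tnth_mktuple ord1.
rewrite mulmxA OmegaE -(mulmxA _ (invmx A)) mulVmx ?factor_unit// mulmx1 mxE.
by apply: eq_bigr => k _; rewrite !mxE tnth_mktuple.
Qed.

Definition shift_vec (tau : R) (i : 'I_p) : p.-tuple R :=
  [tuple tau * tnth (innovation i) j | j < p].

Lemma dot_shift_vec tau i g : dot (shift_vec tau i) g = tau * dot (innovation i) g.
Proof.
by rewrite /dot mulr_sumr; apply: eq_bigr => j _; rewrite tnth_mktuple mulrA.
Qed.

(** [A] maps [innovation i] to the i-th unit vector, so a signal at [i] can be traded for a shift of
    the noise. *)
Lemma signal_vec_shift tau (S : {set 'I_p}) i g : i \notin S ->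
  tuple_add (signal_vec tau S) (tuple_mulmx A (tuple_add g (shift_vec tau i))) =
  tuple_add (signal_vec tau (i |: S)%SET) (tuple_mulmx A g).
Proof.
move=> iS; apply: eq_from_tnth => j.
rewrite [LHS]tnth_mktuple [RHS]tnth_mktuple !tnth_tuple_mulmx.
under eq_bigr do rewrite !tnth_mktuple mulrDr mulrCA.
rewrite !tnth_mktuple.
rewrite big_split -mulr_sumr/= addrCA [RHS]addrC; congr (_ + _).
rewrite (_ : \sum_(k < p) _ = (A *m invmx A) j i); last by rewrite mxE.
rewrite mulmxV ?factor_unit// mxE in_setU1.
have [->|ji] := eqVneq j i; first by rewrite (negbTE iS)/= mulr1 add0r.
by rewrite mulr0 addr0.
Qed.

Context (eps tau : R) (phi : p.-tuple R -> R).
Hypotheses (eps01 : 0 <= eps <= 1) (mphi : measurable_fun [set: p.-tuple R] phi).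
Hypothesis phi01 : forall y, 0 <= phi y <= 1.

Definition cond_test (S : {set 'I_p}) (g : p.-tuple R) : R :=
  phi (tuple_add (signal_vec tau S) (tuple_mulmx A g)).

Definition cond_mean (S : {set 'I_p}) : R :=
  fine (\int[gamn p]_g (cond_test S g)%:E)%E.

Lemma measurable_shifted_obs (b : p.-tuple R) : measurable_fun [set: p.-tuple R]
  (fun g => tuple_add b (tuple_mulmx A g)).
Proof.
rewrite (_ : (fun _ => _) = (fun g => tuple_add g b) \o tuple_mulmx A).
  exact: (measurableT_comp (measurable_tuple_add b) (measurable_tuple_mulmx A)).
by apply/funext => g /=; apply: eq_from_tnth => i; rewrite !tnth_mktuple addrC.
Qed.

Lemma mean_cond_test (S : {set 'I_p}) : mean (gamn p) (cond_test S) (cond_mean S).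
Proof.
have [|||a ma] := @mean_dominated _ _ _ (gamn p) (cond_test S) (fun=> 1) 1.
- exact: (measurableT_comp mphi (measurable_shifted_obs _)).
- by move=> g; exact: phi01.
- exact: mean_cst.
by rewrite /cond_mean; case: (ma) => _ _ ->.
Qed.

(** Switching on [i] is a shift of [g] by [shift_vec tau i], hence a factor [likelihood tau] at
    <v_i, g>. The factors already collected depend on [g] through directions orthogonal to v_i, so
    the shift does not change them. *)
Lemma mean_resample_all (s : seq 'I_p) (S : {set 'I_p}) : uniq s -> {in s, forall i, i \notin S} ->
  {in s, forall i, Omega i i = 1} ->
  {in s &, forall i j, i != j -> Omega i j = 0} ->
  mean (gamn p) (fun g => cond_test S g *
      \prod_(i <- s) mixture_lr eps tau (dot (innovation i) g))
    (resample_all eps s cond_mean S).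
Proof.
have [e0 e1] := andP eps01.
elim: s S => [|i s IH] S.
  move=> _ _ _ _; apply: mean_eq (mean_cond_test S) => g.
  by rewrite big_nil mulr1.
move=> /= /andP[is_ us] iS O1 O0.
have sI j : j \in s -> j \in i :: s by rewrite inE => ->; rewrite orbT.
have O1' : {in s, forall i, Omega i i = 1} by move=> j /sI; exact: O1.
have O0' : {in s &, forall i j, i != j -> Omega i j = 0}.
  by move=> j k /sI + /sI; exact: O0.
have iS' : i \notin S by apply: iS; rewrite mem_head.
have m0 := IH S us (fun j js => iS j (sI j js)) O1' O0'.
have m1 : mean (gamn p) (fun g => cond_test (i |: S)%SET g *
      \prod_(i <- s) mixture_lr eps tau (dot (innovation i) g))
    (resample_all eps s cond_mean (i |: S)%SET).
  apply: IH => // j js; rewrite in_setU1 negb_or (iS j (sI j js)) andbT.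
  by apply: contraNneq is_ => <-.
pose F g := cond_test S g * \prod_(i <- s) mixture_lr eps tau (dot (innovation i) g).
have m1' : mean (gamn p) (fun g => likelihood tau (dot (innovation i) g) * F g)
    (resample_all eps s cond_mean (i |: S)%SET).
  have [mF F0 _] := m0; have [mG _ GE] := m1.
  split.
  - apply: measurable_funM => //.
    apply: (measurableT_comp _ (measurable_dot (innovation i))).
    by case: (mean_likelihood tau).
  - by move=> g; exact: mulr_ge0 (expR_ge0 _) (F0 g).
  - rewrite -GE; have mFE : measurable_fun [set: p.-tuple R] (EFin \o F).
      exact/measurable_EFinP.
    have := integral_gaussian_shift (shift_vec tau i) mFE (fun g => F0 g).
    rewrite (_ : (\int[_]_g (EFin \o F) _)%E = \int[gamn p]_g ((cond_test (i |: S)%SET g *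
      \prod_(i <- s) mixture_lr eps tau (dot (innovation i) g))%:E))%E.
      move=> ->; apply: eq_integral => g _.
      rewrite /= dot_shift_vec [dot (shift_vec _ _) (shift_vec _ _)]dot_shift_vec.
      rewrite [dot (innovation i) (shift_vec _ _)]dotC dot_shift_vec dot_innovation.
      rewrite O1 ?mem_head// mulr1 -expr2 -EFinM mulrC.
      by rewrite /likelihood.
    apply: eq_integral => g _ /=; rewrite /F /cond_test signal_vec_shift//.
    congr (_ * _)%:E; rewrite big_seq [RHS]big_seq; apply: eq_bigr => j js.
    rewrite dotDr [dot _ (shift_vec _ _)]dotC dot_shift_vec dot_innovation O0//.
    + by rewrite mulr0 addr0.
    + exact: mem_head.
    + exact: sI.
    + by apply: contraNneq is_ => ->.
have e1' : 0 <= 1 - eps by rewrite subr_ge0.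
rewrite /= {1}/resample.
have -> : (S :\ i = S)%SET.
  by apply/setP => j; rewrite in_setD1; case: eqP => // ->; rewrite (negbTE iS').
apply: mean_eq (meanD (meanZ e1' m0) (meanZ e0 m1')) => g.
by rewrite big_cons /F /mixture_lr; ring.
Qed.

Hypothesis Omega1 : forall i, Omega i i = 1.

(** Each class is charged as if it had p members, so the total is the number of classes times a
    single bound. *)
Lemma hybrid_bound (t k lam : R) (a b : R) :
  tau <= t -> k <= 2 * tau -> 0 < lam ->
  a = eps * expR (- (t - tau) ^+ 2 / 2) ->
  b = eps ^+ 2 * expR (k ^+ 2 / 2 + (2 * tau - k) * t - tau ^+ 2) ->
  `|\sum_S bernoulli_weight eps S * cond_mean S - cond_mean finset.set0| <=
  (max_degree Omega)%:R * (p%:R * a +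
    (expR (p%:R * b) - 1 + 2 * (p%:R * a)) / (2 * lam) + lam / 2).
Proof.
move=> tt kt lam0 aE bE.
have a0 : 0 <= a by rewrite aE mulr_ge0 ?expR_ge0//; case/andP: eps01.
have b0 : 0 <= b by rewrite bE mulr_ge0 ?expR_ge0// sqr_ge0.
pose e : rel 'I_p := fun i j => Omega i j != 0.
have e_refl : reflexive e by move=> i; rewrite /e Omega1 oner_eq0.
have e_sym : symmetric e by move=> i j; rewrite /e Omega_sym.
have [|ls [lsd lsT lsu lse]] :=
  @independent_classes _ e e_refl e_sym (max_degree Omega) [set: 'I_p].
  move=> i _; apply: leq_trans (leq_bigmax i).
  by apply: subset_leq_card; apply/fintype.subsetP => j; rewrite !inE.
rewrite (@sum_resample_all _ _ eps (flatten ls)); last by move=> i; rewrite lsT inE.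
set B := (X in _ * X).
have B0 : 0 <= B.
  have pa0 : 0 <= p%:R * a by rewrite mulr_ge0.
  have pb0 : 0 <= expR (p%:R * b) - 1.
    by rewrite subr_ge0 -[leLHS]expR0 ler_expR mulr_ge0.
  have l0 := ltW lam0.
  by rewrite addr_ge0 ?divr_ge0// addr_ge0// divr_ge0 ?mulr_ge0// addr_ge0// mulr_ge0.
apply: (@le_trans _ _ ((size ls)%:R * B)); last first.
  by rewrite ler_wpM2r// ler_nat.
apply: resample_all_flatten => //; first by move=> i _; rewrite finset.in_set0.
move=> l T lls lT.
have ul : uniq l.
  move: lsu lls; elim: (ls) => //= l' ls' IH; rewrite cat_uniq => /and3P[ul' _ uls].
  by rewrite inE => /orP[/eqP ->//|]; exact: IH.
have O0 : {in l &, forall i j, i != j -> Omega i j = 0}.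
  by move=> i j il jl ij; have := lse l lls i j il jl ij; rewrite negbK => /eqP.
have mp := mean_resample_all ul lT (fun i _ => Omega1 i) O0.
have szl : (size l <= p)%N.
  by rewrite -[leqRHS]card_ord; have /card_uniqP <- := ul; exact: max_card.
apply: (le_trans (mixture_product_distance ul _ _ eps01 tt kt lam0 aE bE _
  (mean_cond_test T) mp)).
- by move=> i il; rewrite dot_innovation Omega1.
- by move=> i j il jl ij; rewrite dot_innovation O0.
- by move=> g; case/andP: (phi01 (tuple_add (signal_vec tau T) (tuple_mulmx A g))).
have sa : (size l)%:R * a <= p%:R * a by rewrite ler_wpM2r// ler_nat.
have sb : (size l)%:R * b <= p%:R * b by rewrite ler_wpM2r// ler_nat.
rewrite lerD2r lerD// ler_wpM2r ?invr_ge0 ?mulr_ge0 ?(ltW lam0)//.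
by rewrite lerD ?ler_wpM2l// lerD2r ler_expR.
Qed.

End sequence_model.

(** * Conditioning the observation on the support of the signal *)

Section independence.
Context d (T : measurableType d) (R : realType) (P : probability T R).
Context d' (T' : measurableType d') (Y : {RV P >-> T'}).

(** Restrict [P] to [D] and push forward by [Y]: independence says that the result is the law of [Y]
    scaled by the probability of [D]. *)
Lemma mean_indep (D : set T) (h : T' -> R) (a : R) : measurable D ->
  (forall B, measurable B -> P (D `&` Y @^-1` B) = (P D * distribution P Y B)%E) ->
  mean (distribution P Y) h a ->
  mean P (fun w => \1_D w * h (Y w)) (fine (P D) * a).
Proof.
move=> mD indep [mh h0 ha].
have mhY : measurable_fun [set: T] (h \o Y) by exact: (measurableT_comp mh).
split.
- by apply: measurable_funM => //; exact: measurable_indic.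
- by move=> w; rewrite mulr_ge0// indicE.
have mhE : measurable_fun [set: T'] (EFin \o h) by exact/measurable_EFinP.
have mhYE : measurable_fun [set: T] (EFin \o (h \o Y)) by exact/measurable_EFinP.
have h0E y : (0 <= (EFin \o h) y)%E by rewrite lee_fin.
transitivity (\int[mrestr P mD]_w ((h \o Y) w)%:E)%E.
  rewrite (@ge0_integral_density _ _ _ P (mrestr P mD) \1_D)//.
  - by apply: eq_integral => w _; rewrite /= -EFinM mulrC.
  - by move=> A mA; rewrite integral_indic// setIC.
  - by move=> w; rewrite lee_fin; exact: h0.
have := @ge0_integral_pushforward _ _ _ _ _ _ (measurable_funPT Y) (mrestr P mD)
  setT (EFin \o h) measurableT mhE (fun y _ => h0E y).
rewrite preimage_setT => E. apply: (etrans (esym E)).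
have k0 : 0 <= fine (P D) by rewrite fine_ge0.
transitivity (\int[mscale (NngNum k0) (distribution P Y)]_y (EFin \o h) y)%E.
  apply: eq_measure_integral => B mB _.
  transitivity (P D * distribution P Y B)%E.
    by rewrite -indep// /pushforward/= /mrestr setIC.
  have PDE := fineK (fin_num_measure P D mD).
  by apply: (etrans (esym (congr1 (fun c => (c * distribution P Y B)%E) PDE))).
by rewrite ge0_integral_mscale// EFinM -ha.
Qed.

End independence.

Section le_integral.
Context d (T : measurableType d) (R : realType) (mu : {measure set T -> \bar R}).

(* No measurability is needed: the integral of a nonnegative function is a
   supremum over the simple functions below it. *)
Lemma ge0_le_integral_nomeas (f g : T -> \bar R) :
  (forall x, 0 <= f x)%E -> (forall x, f x <= g x)%E ->
  (\int[mu]_x f x <= \int[mu]_x g x)%E.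
Proof.
move=> f0 fg; rewrite !ge0_integralTE//; last first.
  by move=> x; exact: le_trans (f0 x) (fg x).
apply: ereal_sup_le => _ [h hf <-].
by exists h => // x; exact: le_trans (hf x) (fg x).
Qed.

End le_integral.

Section mixture_law.
Context {R : realType} (p : nat) (A : 'M[R]_p) (eps tau : R).
Context d (T : measurableType d) (P : probability T R).
Context (beta z : {RV P >-> p.-tuple R}).
Hypotheses (tau0 : tau != 0) (eps01 : 0 <= eps <= 1).
Hypothesis zA : forall B, measurable B ->
  distribution P z B = std_gaussian p (tuple_mulmx A @^-1` B).
Hypothesis beta_iid : iid_with_law P beta (two_point_mixture eps tau).
Hypothesis beta_z : independent_rv P beta z.

Definition support_event (S : {set 'I_p}) : set T :=
  [set w | beta w = signal_vec tau S].

Let in_set1_eq (x y : R) : (x \in [set y]) = (x == y).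
Proof. by apply/idP/eqP; rewrite inE. Qed.

Lemma two_point_tau : two_point_mixture eps tau [set tau] = eps%:E.
Proof.
rewrite /two_point_mixture !diracE in_set1_eq in_set1_eq eqxx.
by rewrite eq_sym (negbTE tau0) mule0 add0e mule1.
Qed.

Lemma two_point_0 : two_point_mixture eps tau [set 0] = (1 - eps)%:E.
Proof.
rewrite /two_point_mixture !diracE in_set1_eq in_set1_eq eqxx.
by rewrite (negbTE tau0) mule0 adde0 mule1.
Qed.

Lemma support_eventE (S : {set 'I_p}) : support_event S =
  [set w | forall i, (if i \in S then [set tau] else [set 0]) (tnth (beta w) i)].
Proof.
apply/seteqP; split => w /=.
  by move=> -> i; rewrite tnth_mktuple; case: ifP.
move=> H; apply: eq_from_tnth => i; rewrite tnth_mktuple.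
by have := H i; case: ifP.
Qed.

Lemma support_event_prob (S : {set 'I_p}) : P (support_event S) = (bernoulli_weight eps S)%:E.
Proof.
rewrite support_eventE (beta_iid (B := fun i => if i \in S then [set tau] else [set 0]));
  last by move=> i; case: ifP.
rewrite -prodEFin; apply: eq_bigr => i _.
by case: ifP; rewrite (two_point_tau, two_point_0).
Qed.

Lemma measurable_signal_vec (S : {set 'I_p}) : measurable [set signal_vec tau S].
Proof.
rewrite (_ : [set _] = \bigcap_(i in [set: 'I_p])
    ((fun y : p.-tuple R => tnth y i) @^-1` [set tnth (signal_vec tau S) i])).
  apply: fin_bigcap_measurable => // i _.
  by rewrite -[X in measurable X]setTI; apply: measurable_tnth.
apply/seteqP; split => [y -> i _//|y H].
by apply: eq_from_tnth => i; exact: H.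
Qed.

Lemma measurable_support_event (S : {set 'I_p}) : measurable (support_event S).
Proof.
rewrite -[X in measurable X]setTI.
exact: (measurable_funPT beta _ _ (measurable_signal_vec S)).
Qed.

Lemma signal_vec_inj (S S' : {set 'I_p}) : signal_vec tau S = signal_vec tau S' -> S = S'.
Proof.
move=> E; apply/setP => i; have := congr1 (fun y => tnth y i) E.
rewrite !tnth_mktuple; case: ifP => _; case: ifP => _ // /eqP.
  by rewrite (negbTE tau0).
by rewrite eq_sym (negbTE tau0).
Qed.

Lemma mean_noise (h : p.-tuple R -> R) a :
  measurable_fun [set: p.-tuple R] h -> (forall y, 0 <= h y) ->
  mean (std_gaussian p) (fun g => h (tuple_mulmx A g)) a ->
  mean (distribution P z) h a.
Proof.
move=> mh h0 [_ _ ha]; split => //.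
have mA := @measurable_tuple_mulmx R p A.
have mhE : measurable_fun [set: p.-tuple R] (EFin \o h) by exact/measurable_EFinP.
have := @ge0_integral_pushforward _ _ _ _ _ _ mA (std_gaussian p) setT
  (EFin \o h) measurableT mhE (fun y _ => h0 y).
rewrite preimage_setT => E; apply: (etrans _ ha); apply: (etrans _ E).
by apply: eq_measure_integral => B mB _; exact: zA.
Qed.

Lemma mean_null_obs (h : p.-tuple R -> R) a :
  measurable_fun [set: p.-tuple R] h -> (forall y, 0 <= h y) ->
  mean (std_gaussian p) (fun g => h (tuple_mulmx A g)) a ->
  mean P (fun w => h (z w)) a.
Proof.
move=> mh h0 /(mean_noise mh h0)[_ _ ha]; split => //.
  exact: (measurableT_comp mh).
rewrite -ha ge0_integral_distribution//; exact/measurable_EFinP.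
Qed.

Variables (h : p.-tuple R -> R).
Hypotheses (mh : measurable_fun [set: p.-tuple R] h) (h01 : forall y, 0 <= h y <= 1).

Lemma mean_alt_obs :
  mean P (fun w => h (alt_obs beta z w))
    (\sum_S bernoulli_weight eps S * cond_mean A tau h S).
Proof.
have h0 y : 0 <= h y by case/andP: (h01 y).
pose hS S w := \1_(support_event S) w * h (tuple_add (signal_vec tau S) (z w)).
have madd b : measurable_fun [set: p.-tuple R] (fun y => h (tuple_add b y)).
  apply: (measurableT_comp mh).
  rewrite (_ : tuple_add b = fun g => tuple_add g b); first exact: measurable_tuple_add.
  by apply/funext => g; apply: eq_from_tnth => i; rewrite !tnth_mktuple addrC.
have mS S : mean P (hS S) (bernoulli_weight eps S * cond_mean A tau h S).
  have := @mean_indep _ _ _ P _ _ z (support_event S)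
    (fun y => h (tuple_add (signal_vec tau S) y)) (cond_mean A tau h S)
    (measurable_support_event S).
  rewrite support_event_prob/=; apply; last first.
    by apply: mean_noise => //; exact: mean_cond_test.
  move=> B mB; rewrite -support_event_prob.
  exact: beta_z (measurable_signal_vec S) mB.
have mI S : mean P \1_(support_event S) (bernoulli_weight eps S).
  by have := mean_indic P (measurable_support_event S); rewrite support_event_prob.
have mG := mean_sum (index_enum _) mS.
have mI1 := mean_sum (index_enum _) mI.
rewrite bernoulli_weight_sum in mI1.
have mobs : measurable_fun [set: T] (alt_obs beta z).
  apply/measurable_fun_tnthP => i.
  rewrite (_ : _ \o _ = fun w => tnth (beta w) i + tnth (z w) i); last first.
    by apply/funext => w /=; rewrite tnth_mktuple.
  apply: measurable_funD.
    exact: (measurableT_comp (@measurable_tnth _ _ p i)).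
  exact: (measurableT_comp (@measurable_tnth _ _ p i)).
have [||| a ma] := @mean_dominated _ _ _ P (fun w => h (alt_obs beta z w)) (fun=> 1) 1.
- exact: (measurableT_comp mh mobs).
- by move=> w; exact: h01.
- exact: mean_cst.
have off w S S' : support_event S w -> S' != S -> \1_(support_event S') w = 0 :> R.
  move=> wS S'S; rewrite indicE memNset// /support_event/= => wS'.
  by move/eqP: S'S; apply; apply: signal_vec_inj; rewrite -wS -wS'.
have alt w : (exists S, support_event S w) \/
    (forall S, \1_(support_event S) w = 0 :> R).
  have [|nE] := pselect (exists S, support_event S w); first by left.
  by right => S; rewrite indicE memNset// => wS; apply: nE; exists S.
have sumI w S : support_event S w -> \sum_S \1_(support_event S) w = 1 :> R.
  move=> wS; rewrite (bigD1 S)//= big1 ?addr0; first by rewrite indicE mem_set.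
  by move=> S' S'S; exact: off wS S'S.
have sumG w S : support_event S w -> \sum_S hS S w = h (alt_obs beta z w).
  move=> wS; rewrite (bigD1 S)//= big1 ?addr0.
    by rewrite /hS indicE mem_set// mul1r /alt_obs wS.
  by move=> S' S'S; rewrite /hS (off _ _ _ wS S'S) mul0r.
suff -> : \sum_S bernoulli_weight eps S * cond_mean A tau h S = a by [].
apply/eqP; rewrite eq_le; apply/andP; split.
  apply: (le_mean mG ma) => w; have [[S wS]|w0] := alt w.
    by rewrite (sumG _ _ wS).
  by rewrite big1 ?h0// => S _; rewrite /hS w0 mul0r.
(* The support events can miss a null set, because the coordinates of [beta] lie in {0, tau} only
   almost surely. Adding the sum of their indicators, whose mean is 1, to the left and 1 to the
   right gives an inequality valid everywhere: off these events it reads h <= 1. *)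
rewrite -(lerD2r 1); apply: (le_mean (meanD ma mI1) (meanD mG (mean_cst P ler01))) => w.
have [[S wS]|w0] := alt w; first by rewrite (sumG _ _ wS) (sumI _ _ wS).
rewrite [X in _ + X <= _]big1// addr0.
rewrite big1; last by move=> S _; rewrite /hS w0 mul0r.
by rewrite add0r; case/andP: (h01 (alt_obs beta z w)).
Qed.

End mixture_law.

(** * The undetectable region *)

Section asymptotics.
Context {R : realType}.
Implicit Types (p : nat) (theta r : R).

Lemma natr_pos p : (1 < p)%N -> 0 < p%:R :> R.
Proof. by move=> p1; rewrite ltr0n ltnW. Qed.

Lemma powR_natE p (x : R) : (1 < p)%N -> p%:R `^ x = expR (x * ln p%:R).
Proof. by move=> p1; rewrite /powR gt_eqF// natr_pos. Qed.

Lemma expR_ln_nat p : (1 < p)%N -> expR (ln p%:R) = p%:R :> R.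
Proof. by move=> p1; rewrite lnK// posrE natr_pos. Qed.

Lemma ln_nat_gt0 p : (1 < p)%N -> 0 < ln p%:R :> R.
Proof. by move=> p1; rewrite ln_gt0// ltr1n. Qed.

Lemma ln_nat_large (x : R) : \forall p \near \oo, x <= ln p%:R.
Proof.
near=> p; rewrite -[x]expRK ler_ln ?posrE ?expR_gt0//.
  by near: p; exact: nbhs_infty_ger.
by rewrite natr_pos//; near: p; exact: nbhs_infty_ge.
Unshelve. all: by end_near. Qed.

Lemma signal_rateE theta p : (1 < p)%N ->
  signal_rate theta p = expR (- theta * ln p%:R).
Proof. exact: powR_natE. Qed.

Lemma signal_rate01 theta p : 0 < theta -> (1 < p)%N -> 0 <= signal_rate theta p <= 1.
Proof.
move=> th p1; rewrite signal_rateE// expR_ge0 -[leRHS]expR0 ler_expR.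
by rewrite mulNr oppr_le0 mulr_ge0 ?(ltW th) ?(ltW (ln_nat_gt0 p1)).
Qed.

Lemma sqrt_2ln_sqr p : (1 < p)%N -> Num.sqrt (2 * ln p%:R) ^+ 2 = 2 * ln p%:R :> R.
Proof. by move=> p1; rewrite sqr_sqrtr// mulr_ge0// ltW// ln_nat_gt0. Qed.

Lemma signal_strengthE r p : 0 < r -> (1 < p)%N ->
  signal_strength r p = Num.sqrt r * Num.sqrt (2 * ln p%:R).
Proof. by move=> r0 p1; rewrite /signal_strength mulrAC mulrC sqrtrM// ltW. Qed.

Lemma signal_strength_gt0 r p : 0 < r -> (1 < p)%N -> 0 < signal_strength r p.
Proof. by move=> r0 p1; rewrite sqrtr_gt0 !mulr_gt0// ln_nat_gt0. Qed.

Lemma expR_le1D2x (x : R) : 0 <= x <= 1 / 2 -> expR x <= 1 + 2 * x.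
Proof.
move=> /andP[x0 x1]; rewrite -[expR x]invrK -expRN.
have h : 1 - x <= expR (- x) by exact: expR_ge1Dx.
have h0 : 0 < 1 - x by lra.
apply: (@le_trans _ _ (1 - x)^-1).
  by rewrite lef_pV2// posrE expR_gt0.
rewrite -div1r ler_pdivrMr//; nra.
Qed.

(** With t = sqrt(2 log p), tau = sqrt r t and k = kap t, the two expressions are the exponents of p
    in p a and p b. The second is least at kap = min(1, 2 sqrt r). For sqrt r <= 1/2 it is then 1 -
    2 theta + 2 r, negative below theta - 1/2. For larger r it is twice the first exponent, which is
    negative below (1 - sqrt(1 - theta))^2. So the two nontrivial branches of [rho_star] are the
    untruncated and the truncated second moment. *)
Lemma subcritical_exponents theta r : 0 < theta < 1 -> 0 < r -> r < rho_star theta ->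
  exists kap eta : R, [/\ 0 < eta, Num.sqrt r <= 1, kap <= 2 * Num.sqrt r,
    1 - theta - (1 - Num.sqrt r) ^+ 2 <= - (2 * eta) &
    1 - 2 * theta + kap ^+ 2 + 2 * (2 * Num.sqrt r - kap) - 2 * r <= - (2 * eta)].
Proof.
move=> /andP[th0 th1] r0 rr.
pose x := Num.sqrt r; have x0 : 0 < x by rewrite sqrtr_gt0.
have xr : x ^+ 2 = r by rewrite sqr_sqrtr// ltW.
pose u := Num.sqrt (1 - theta).
have u0 : 0 < u by rewrite sqrtr_gt0 subr_gt0.
have ur : u ^+ 2 = 1 - theta by rewrite sqr_sqrtr// subr_ge0 ltW.
have key : [/\ x <= 1, u ^+ 2 < (1 - x) ^+ 2 &
    (x <= 1 / 2 -> x ^+ 2 < 1 / 2 - u ^+ 2)].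
  move: rr; rewrite /rho_star -/u -xr.
  case: ifP => [_|_]; first by nra.
  case: ifP => [t34|/negbT].
    move=> h; have x12 : x < 1 / 2 by nra.
    by split => //; [lra|nra|move=> _; nra].
  rewrite -ltNge => t34 h.
  have u12 : u < 1 / 2 by nra.
  have xu : x < 1 - u by nra.
  by split; [lra|nra|move=> xx; nra].
have [xle1 h1 h2] := key.
have [x12|x12] := lerP x (1 / 2).
  pose eta := Num.min ((1 - x) ^+ 2 - u ^+ 2) (1 / 2 - u ^+ 2 - x ^+ 2) / 2.
  have e1 : 2 * eta <= (1 - x) ^+ 2 - u ^+ 2.
    by rewrite mulrC divfK// ge_min lexx.
  have e2 : 2 * eta <= 1 / 2 - u ^+ 2 - x ^+ 2.
    by rewrite mulrC divfK// ge_min lexx orbT.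
  exists (2 * x), eta; split => //.
  - by rewrite divr_gt0// lt_min subr_gt0 h1/=; have := h2 x12; lra.
  - by rewrite -ur -/x; lra.
  - by rewrite -/x; nra.
pose eta := ((1 - x) ^+ 2 - u ^+ 2) / 2.
have e1 : 2 * eta = (1 - x) ^+ 2 - u ^+ 2 by rewrite mulrC divfK.
exists 1, eta; split => //.
- by rewrite divr_gt0// subr_gt0.
- by rewrite -/x; lra.
- by rewrite -ur -/x; lra.
- by rewrite -/x; nra.
Qed.

Lemma lower_bound_fixed theta r (kap eta : R) p (A : 'M[R]_p) (phi : p.-tuple R -> R) :
  0 < theta -> 0 < r -> (1 < p)%N ->
  0 < eta -> Num.sqrt r <= 1 -> kap <= 2 * Num.sqrt r ->
  1 - theta - (1 - Num.sqrt r) ^+ 2 <= - (2 * eta) ->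
  1 - 2 * theta + kap ^+ 2 + 2 * (2 * Num.sqrt r - kap) - 2 * r <= - (2 * eta) ->
  p%:R `^ (- eta) <= 1 / 2 ->
  A *m A^T \in unitmx ->
  measurable_fun [set: p.-tuple R] phi -> (forall y, 0 <= phi y <= 1) ->
  (forall i, invmx (A *m A^T) i i = 1) ->
  forall tau, tau = signal_strength r p ->
  `|\sum_S bernoulli_weight (signal_rate theta p) S * cond_mean A tau phi S
     - cond_mean A tau phi finset.set0| <=
  4 * ((max_degree (invmx (A *m A^T)))%:R * p%:R `^ (- eta)).
Proof.
move=> th0 r0 p1 eta0 x1 kx E1 E2 del uS mphi phi01 O1 tau tauE.
set x := Num.sqrt r in x1 kx E1 E2.
have xr : x ^+ 2 = r by rewrite sqr_sqrtr// ltW.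
pose t : R := Num.sqrt (2 * ln p%:R).
have t2 : t ^+ 2 = 2 * ln p%:R by exact: sqrt_2ln_sqr.
have t0 : 0 <= t by exact: sqrtr_ge0.
rewrite signal_strengthE// -/x -/t in tauE.
have tt : tau <= t by rewrite tauE ler_piMl.
have kt : kap * t <= 2 * tau by rewrite tauE mulrA ler_wpM2r.
(* [delta] is also the value given to [lam]. Since p a and p b are at most delta^2, the three terms
   of the bound are at most delta^2, 2 delta and delta / 2, and delta <= 1/2 brings their sum below
   4 delta. *)
set delta := p%:R `^ (- eta) in del *.
have delta0 : 0 < delta by rewrite powR_gt0// natr_pos.
have L0 := ltW (ln_nat_gt0 p1).
have delta2 : delta ^+ 2 = expR (- (2 * eta) * ln p%:R).
  by rewrite /delta powR_natE// -expRM_natl; congr expR; ring.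
have := hybrid_bound uS (signal_rate01 th0 p1) mphi phi01 O1 tt kt delta0 erefl erefl.
set a := signal_rate theta p * _; set b := signal_rate theta p ^+ 2 * _.
move=> /le_trans; apply.
rewrite [leRHS]mulrCA ler_wpM2l//.
have pa : p%:R * a <= delta ^+ 2.
  rewrite /a delta2 signal_rateE// -{1}(expR_ln_nat p1) -!expRD ler_expR.
  rewrite tauE (_ : _ + _ = (1 - theta) * ln p%:R - (1 - x) ^+ 2 * (t ^+ 2) / 2); last by field.
  rewrite t2 (_ : _ - _ = (1 - theta - (1 - x) ^+ 2) * ln p%:R); last by field.
  by rewrite ler_wpM2r.
have pb : p%:R * b <= delta ^+ 2.
  rewrite /b delta2 signal_rateE// -{1}(expR_ln_nat p1) -expRM_natl -!expRD ler_expR.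
  rewrite tauE (_ : _ + _ = (1 - 2 * theta) * ln p%:R +
    (kap ^+ 2 / 2 + (2 * x - kap) - x ^+ 2) * (t ^+ 2)); last by field.
  rewrite t2 xr (_ : _ + _ = (1 - 2 * theta + kap ^+ 2 + 2 * (2 * x - kap) - 2 * r)
    * ln p%:R); last by field.
  by rewrite ler_wpM2r.
have pb0 : 0 <= p%:R * b.
  by rewrite /b mulr_ge0// mulr_ge0 ?expR_ge0 ?sqr_ge0.
have pbe : expR (p%:R * b) <= 1 + 2 * delta ^+ 2.
  apply: (@le_trans _ _ (1 + 2 * (p%:R * b))); last by rewrite lerD2l ler_wpM2l.
  apply: expR_le1D2x; rewrite pb0/=; apply: (le_trans pb); nra.
apply: (@le_trans _ _ (delta ^+ 2 + (4 * delta ^+ 2) / (2 * delta) + delta / 2)).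
  rewrite lerD2r lerD// ler_wpM2r ?invr_ge0 ?mulr_ge0 ?(ltW delta0)//.
  move: pbe pa; move: (expR _) (p%:R * a) (delta ^+ 2) => u v w; lra.
rewrite (_ : 4 * delta ^+ 2 / (2 * delta) = 2 * delta); last by field; rewrite gt_eqF.
nra.
Qed.

End asymptotics.

Section lower_bound.
Context {R : realType}.

Lemma powRN_small (eta e : R) : 0 < eta -> 0 < e ->
  \forall p \near \oo, p%:R `^ (- eta) <= e.
Proof.
move=> eta0 e0; near=> p.
have p1 : (1 < p)%N by near: p; exact: nbhs_infty_ge.
rewrite powR_natE// mulNr -[e]lnK ?posrE// ler_expR lerNl mulrC -ler_pdivrMr//.
by near: p; exact: ln_nat_large.
Unshelve. all: by end_near. Qed.

Lemma type_errors_dist d (T : measurableType d) (P : probability T R) p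
    (Sigma : 'M[R]_p) (theta r : R) (beta z : {RV P >-> p.-tuple R})
    (phi : p.-tuple R -> R) (kap eta : R) :
  0 < theta -> 0 < r -> (1 < p)%N -> Sigma \in unitmx ->
  (forall i, invmx Sigma i i = 1) ->
  centered_gaussian Sigma (distribution P z) ->
  iid_with_law P beta (two_point_mixture (signal_rate theta p) (signal_strength r p)) ->
  independent_rv P beta z -> is_test phi ->
  0 < eta -> Num.sqrt r <= 1 -> kap <= 2 * Num.sqrt r ->
  1 - theta - (1 - Num.sqrt r) ^+ 2 <= - (2 * eta) ->
  1 - 2 * theta + kap ^+ 2 + 2 * (2 * Num.sqrt r - kap) - 2 * r <= - (2 * eta) ->
  p%:R `^ (- eta) <= 1 / 2 ->
  exists2 s, (type1_error P z phi + type2_error P beta z phi)%E = s%:E &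
    `|1 - s| <= 4 * ((max_degree (invmx Sigma))%:R * p%:R `^ (- eta)).
Proof.
move=> th0 r0 p1 uS O1 [A AE zA] biid bz [mphi phi01] eta0 x1 kx E1 E2 del.
rewrite -AE in uS O1 *.
have t0 := signal_strength_gt0 r0 p1.
have m2 := mean_alt_obs (lt0r_neq0 t0) zA biid bz mphi phi01.
set tau := signal_strength r p in t0 m2.
have m1 : mean P (fun w => phi (z w)) (cond_mean A tau phi finset.set0).
  apply: (mean_null_obs zA mphi) => [y|]; first by case/andP: (phi01 y).
  apply: mean_eq (mean_cond_test A tau mphi phi01 finset.set0) => g.
  rewrite /cond_test; congr phi; apply: eq_from_tnth => i.
  by rewrite [LHS]tnth_mktuple tnth_mktuple finset.in_set0 add0r.
have [mphi2 phi20 _] := m2.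
have [|w||b mb] := @mean_dominated _ _ _ P (fun w => 1 - phi (alt_obs beta z w)) (fun=> 1) 1.
- exact: measurable_funB.
- by case/andP: (phi01 (alt_obs beta z w)) => ? ?; rewrite subr_ge0 gerBl; apply/andP.
- exact: mean_cst.
have b1 : \sum_S bernoulli_weight (signal_rate theta p) S * cond_mean A tau phi S + b = 1.
  apply: (mean_uniq _ (mean_cst P ler01)).
  by apply: mean_eq (meanD m2 mb) => w; rewrite addrC subrK.
exists (cond_mean A tau phi finset.set0 + b).
  rewrite EFinD; congr (_ + _)%E; [by case: m1|by case: mb].
have -> : 1 - (cond_mean A tau phi finset.set0 + b) =
    \sum_S bernoulli_weight (signal_rate theta p) S * cond_mean A tau phi S
    - cond_mean A tau phi finset.set0 by lra.
exact: (lower_bound_fixed th0 r0 p1 eta0 x1 kx E1 E2 del uS mphi phi01 O1 erefl).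
Qed.

Lemma lower_bound (theta r : R) (d : nat -> measure_display)
    (T : forall p : nat, measurableType (d p)) (P : forall p, probability (T p) R)
    (Sigma Omega : forall p : nat, 'M[R]_p)
    (beta z : forall p, {RV (P p) >-> p.-tuple R})
    (phi : forall p : nat, p.-tuple R -> R) :
  0 < theta < 1 -> 0 < r -> ARW theta r Sigma Omega beta z ->
  r < rho_star theta -> (forall p : nat, is_test (phi p)) ->
  (type1_error (P p) (z p) (phi p)
        + type2_error (P p) (beta p) (z p) (phi p))%E @[p --> \oo] --> 1%E.
Proof.
move=> th r0 [uS OE O1 Osp zN biid bz] rr tphi.
have [th0 _] := andP th.
have [kap [eta [eta0 x1 kx E1 E2]]] := subcritical_exponents th r0 rr.
have main : \forall p \near \oo,
  exists2 s, (type1_error (P p) (z p) (phi p)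
        + type2_error (P p) (beta p) (z p) (phi p))%E = s%:E &
    `|1 - s| <= 4 * ((max_degree (Omega p))%:R * p%:R `^ (- eta)).
  near=> p; rewrite OE.
  have p1 : (1 < p)%N by near: p; exact: nbhs_infty_ge.
  have del : p%:R `^ (- eta) <= 1 / 2.
    by near: p; apply: powRN_small => //; rewrite divr_gt0.
  apply: (type_errors_dist th0 r0 p1 (uS p) _ (zN p) (biid p) (bz p) (tphi p)
    eta0 x1 kx E1 E2 del) => i.
  by rewrite -OE.
apply/fine_cvgP; split.
  by near=> p; have [//|s ->] := near main p.
apply/cvgrPdist_le => e e0; near=> p.
have [//|s /= -> h] := near main p.
apply: (le_trans h).
rewrite mulrC -ler_pdivlMr//.
by near: p; apply: (cvgr_le _ (Osp eta eta0)); rewrite divr_gt0.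
Unshelve. all: by end_near. Qed.

End lower_bound.

(** * Exceedance counts *)

Section gaussian_tails.
Context {R : realType}.
Local Notation gam := (@std_normal R).
Local Notation leb := (@lebesgue_measure R).

Definition exceed (a t : R) : set R := [set u | t <= `|a + u|].

(** The probability that |N(a, 1)| is at least t. *)
Definition tail2 (a t : R) : R := fine (gam (exceed a t)).

Lemma measurable_exceed a t : measurable (exceed a t).
Proof.
have mf : measurable_fun [set: R] (fun u : R => `|a + u|).
  by apply: measurableT_comp => //; exact: measurable_funD.
rewrite -[X in measurable X]setTI.
rewrite (_ : exceed a t = (fun u : R => `|a + u|) @^-1` `[t, +oo[); last first.
  by apply/seteqP; split => u; rewrite /exceed/= in_itv/= andbT.
exact: mf.
Qed.

Lemma mean_exceed a t : mean gam \1_(exceed a t) (tail2 a t).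
Proof. exact: mean_indic (measurable_exceed a t). Qed.

Lemma pvalueE (x : R) : two_sided_pvalue x = tail2 0 `|x|.
Proof.
rewrite /two_sided_pvalue /tail2; congr (fine (normal_prob _ _ _)).
by apply/seteqP; split => u; rewrite /exceed/= add0r.
Qed.

Lemma std_normal_itv (a b : R) : gam `]a, b[%classic =
  (\int[leb]_(x in `]a, b[) (gauss x)%:E)%E.
Proof. by []. Qed.

Lemma gauss_le (x y : R) : (gauss x <= gauss y) = (y ^+ 2 <= x ^+ 2).
Proof.
rewrite !gaussE ler_pM2l; last by rewrite invr_gt0 sqrtr_gt0 mulrn_wgt0// pi_gt0.
by rewrite ler_expR !mulNr lerN2 ler_pM2r.
Qed.

Lemma gauss_gt0 (x : R) : 0 < gauss x.
Proof. by rewrite gaussE mulr_gt0 ?expR_gt0// invr_gt0 sqrtr_gt0 mulrn_wgt0// pi_gt0. Qed.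

(* With c the density at the endpoint t, the integrand (density - c) is
   nonnegative exactly on the centred interval. *)
Lemma centred_interval_max (a t : R) : 0 < t ->
  (gam `](- t - a)%R, (t - a)%R[%classic <= gam `](- t)%R, t[%classic)%E.
Proof.
move=> t0; rewrite !std_normal_itv.
set I := `](- t), t[%classic; set J := `](- t - a), (t - a)[%classic.
have mI : measurable I by exact: measurable_itv.
have mJ : measurable J by exact: measurable_itv.
have lI : leb I = (t + t)%:E.
  rewrite lebesgue_measure_itv/= lte_fin ifT; first by rewrite -EFinD opprK.
  by rewrite gtrN.
have lJ : leb J = (t + t)%:E.
  rewrite lebesgue_measure_itv/= lte_fin ifT; last by rewrite ltrD2r gtrN.
  by rewrite -EFinD; congr EFin; ring.
have mg := @measurable_gauss R.
pose f (A : set R) (x : R) := (\1_A x * gauss x)%:E.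
have mf A : measurable A -> measurable_fun [set: R] (f A).
  by move=> mA; apply/measurable_EFinP/measurable_funM => //; exact: measurable_indic.
pose c := gauss t.
pose h (A : set R) (x : R) := (c * \1_A x)%:E.
have mh A : measurable A -> measurable_fun [set: R] (h A).
  by move=> mA; apply/measurable_EFinP/measurable_funM => //; exact: measurable_indic.
have f0 A x : (0 <= f A x)%E by rewrite lee_fin mulr_ge0 ?gauss_ge0// indicE.
have h0 A x : (0 <= h A x)%E by rewrite lee_fin mulr_ge0 ?gauss_ge0// indicE.
have intf A : measurable A -> (\int[leb]_(x in A) (gauss x)%:E = \int[leb]_x f A x)%E.
  move=> mA; rewrite integral_mkcond; apply: eq_integral => x _.
  by rewrite /f patchE indicE; case: ifP => _; rewrite ?mul1r ?mul0r.
have inth A : measurable A -> (\int[leb]_x h A x = c%:E * leb A)%E.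
  move=> mA; rewrite /h; under eq_integral do rewrite EFinM.
  rewrite ge0_integralZl_EFin ?gauss_ge0//.
  - by rewrite integral_indic// setIT.
  - by apply/measurable_EFinP; exact: measurable_indic.
have key : (\int[leb]_x (f J x + h I x) <= \int[leb]_x (f I x + h J x))%E.
  apply: ge0_le_integral => //.
  - by move=> x _; rewrite adde_ge0.
  - by apply: emeasurable_funD; [exact: mf|exact: mh].
  - by apply: emeasurable_funD; [exact: mf|exact: mh].
  move=> x _; rewrite /f /h -!EFinD lee_fin !indicE.
  have xI : (x \in I) = (`|x| < t) by rewrite mem_setE in_itv/= ltr_norml.
  have gI : (`|x| < t) -> c <= gauss x.
    by move=> xt; rewrite gauss_le -(real_normK (num_real x)) ler_sqr ?nnegrE ?(ltW xt)// ltW.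
  have gI' : ~~ (`|x| < t) -> gauss x <= c.
    rewrite -leNgt => xt.
    by rewrite gauss_le -(real_normK (num_real x)) ler_sqr ?nnegrE// ltW.
  rewrite xI; case: (x \in J); case: ltP gI gI' => _ gI gI' /=;
    rewrite ?mul1r ?mul0r ?mulr1 ?mulr0 ?addr0 ?add0r//; [exact: gI'|exact: gI].
rewrite !ge0_integralD// in key; try by [apply: mf|apply: mh].
rewrite !inth// lI lJ -!intf// in key.
by rewrite -(leeD2rE _ _ (x := c%:E * (t + t)%:E)%E).
Qed.

Lemma fin_gam (A : set R) : measurable A -> gam A \is a fin_num.
Proof. by move=> mA; exact: fin_num_measure. Qed.

Lemma tail2_interval (a t : R) :
  tail2 a t = 1 - fine (gam `](- t - a), (t - a)[%classic).
Proof.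
have mJ : measurable `](- t - a), (t - a)[%classic by exact: measurable_itv.
have -> : tail2 a t = fine (gam (~` `](- t - a), (t - a)[%classic)).
  congr (fine (gam _)); apply/seteqP; split => u; rewrite /exceed/= in_itv/=.
    move=> h /andP[u1 u2]; move: h; rewrite leNgt => /negP; apply.
    by rewrite ltr_norml; apply/andP; split; lra.
  move=> h; rewrite leNgt; apply/negP; rewrite ltr_norml => /andP[u1 u2]; apply: h.
  by apply/andP; split; lra.
by rewrite probability_setC// fineB// fin_gam.
Qed.

(** Off-diagonal entries of Omega give drifts of either sign near a signal. This inequality ensures
    that none of them lowers the expected count. *)
Lemma tail2_min (a t : R) : 0 < t -> tail2 0 t <= tail2 a t.
Proof.
move=> t0; rewrite !tail2_interval lerD2l lerN2 !subr0.
by apply: fine_le; [exact: fin_gam| exact: fin_gam|exact: centred_interval_max].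
Qed.

(** The indicator of |u| >= t is at most e^(t u - t^2) + e^(- t u - t^2). *)
Lemma tail2_le (t : R) : 0 <= t -> tail2 0 t <= 2 * expR (- (t ^+ 2 / 2)).
Proof.
move=> t0; have m := meanD (mean_expR_affine t (- t ^+ 2)) (mean_expR_affine (- t) (- t ^+ 2)).
rewrite (_ : 2 * _ = expR (t ^+ 2 / 2 + - t ^+ 2) + expR ((- t) ^+ 2 / 2 + - t ^+ 2));
  last first.
  by rewrite sqrrN -mulr2n mulr_natl; congr (expR _ *+ 2); field.
apply: (le_mean (mean_exceed 0 t) m) => u; rewrite indicE.
have e1 := expR_ge0 (t * u + - t ^+ 2); have e2 := expR_ge0 (- t * u + - t ^+ 2).
case: (boolP (u \in _)) => [|_]; last by rewrite addr_ge0.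
rewrite inE /exceed/= add0r => tu.
have [u0|u0] := lerP 0 u.
  rewrite ger0_norm// in tu; rewrite ler_wpDr// -[leLHS]expR0 ler_expR; nra.
rewrite ltr0_norm// in tu; rewrite ler_wpDl// -[leLHS]expR0 ler_expR; nra.
Qed.

(** The event contains [y, y + 1], where the density is at least its value at the right end. *)
Lemma tail2_ge (a t y : R) : 0 <= y -> t - a <= y -> gauss (y + 1) <= tail2 a t.
Proof.
move=> y0 ty.
have mI : measurable `[y, (y + 1)]%classic by exact: measurable_itv.
have le1 : (gam `[y, (y + 1)%R]%classic <= gam (exceed a t))%E.
  apply: le_measure; rewrite ?inE//; first exact: measurable_exceed.
  move=> u /=; rewrite in_itv/= => /andP[yu _]; rewrite /exceed/=.
  by apply: le_trans (ler_norm _); lra.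
have le2 : ((gauss (y + 1))%:E <= gam `[y, (y + 1)%R]%classic)%E.
  have -> : (gauss (y + 1))%:E = (\int[leb]_(x in `[y, (y + 1)%R]) (gauss (y + 1)%R)%:E)%E.
    rewrite integral_cst//= lebesgue_measure_itv/= lte_fin ltrDl ltr01 -EFinD.
    by rewrite addrAC addrN add0r mule1.
  apply: ge0_le_integral => //.
  - by move=> x _; rewrite lee_fin gauss_ge0.
  - apply/measurable_EFinP; apply: measurable_funTS; exact: measurable_gauss.
  - move=> x; rewrite /= in_itv/= lee_fin gauss_le => /andP[yx xy]; nra.
rewrite -lee_fin /tail2 fineK ?fin_gam//; last exact: measurable_exceed.
exact: le_trans le2 le1.
Qed.

Lemma tail2_anti (a t t' : R) : t <= t' -> tail2 a t' <= tail2 a t.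
Proof.
move=> tt'; apply: (le_mean (mean_exceed a t') (mean_exceed a t)) => u.
rewrite !indicE ler_nat; case: (boolP (u \in exceed a t')) => //.
by rewrite inE /exceed/= => h; rewrite mem_set//= (le_trans tt').
Qed.

Lemma pvalue_gt0 (x : R) : 0 < two_sided_pvalue x.
Proof.
rewrite pvalueE; apply: lt_le_trans (@tail2_ge _ _ `|x| _ _) => //.
  exact: gauss_gt0.
by rewrite subr0.
Qed.

End gaussian_tails.

(** * Chebyshev's inequality for counts with few dependent pairs *)

Section count_events.
Context d (T : measurableType d) (R : realType) (P : probability T R).
Context (I : finType) (E : I -> set T) (D : rel I) (m : nat).
Hypotheses (mE : forall i, measurable (E i)).
Hypothesis indep : forall i j, ~~ D i j ->
  fine (P (E i `&` E j)) = fine (P (E i)) * fine (P (E j)).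
Hypothesis degD : forall i, (#|[pred j | D i j]| <= m)%N.

Let count w : R := \sum_i \1_(E i) w.
Let mu : R := \sum_i fine (P (E i)).

(** Pairs outside [D] contribute products of probabilities. Each [i] has at most [m] partners in
    [D], and a joint probability is at most that of E i; hence the variance is at most m mu. *)
Lemma count_lower_tail (M : R) : M < mu ->
  fine (P [set w | count w < M]) <= m%:R * mu / (mu - M) ^+ 2.
Proof.
move=> Mmu.
have mN : mean P count mu.
  exact: (mean_sum (index_enum I) (fun i => mean_indic P (mE i))).
have mEE i j := mean_indic P (measurableI _ _ (mE i) (mE j)).
have mN2 := mean_sum (index_enum I) (fun i => mean_sum (index_enum I) (mEE i)).
have {}mN2 := mean_eq (h := fun w => count w ^+ 2) _ mN2.
have {}mN2 : mean P (fun w => count w ^+ 2) (\sum_i \sum_j fine (P (E i `&` E j))).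
  apply: mN2 => w; rewrite expr2 mulr_suml; apply: eq_bigr => i _.
  by rewrite mulr_sumr; apply: eq_bigr => j _; rewrite indicI.
set B := [set w | count w < M].
have mB : measurable B.
  have [mc _ _] := mN; rewrite -[X in measurable X]setTI.
  rewrite (_ : B = count @^-1` `]-oo, M[%classic); first exact: mc.
  by apply/seteqP; split => w; rewrite /B/= in_itv.
have mu0 : 0 <= mu := mean_ge0 mN.
have sq : \sum_i \sum_j fine (P (E i `&` E j)) <= mu ^+ 2 + m%:R * mu.
  rewrite expr2 {1}/mu mulr_suml mulr_sumr -big_split/=; apply: ler_sum => i _.
  have q0 : 0 <= fine (P (E i)) by rewrite fine_ge0.
  rewrite (bigID (D i)) /= addrC lerD//.
    rewrite (eq_bigr (fun j => fine (P (E i)) * fine (P (E j)))); last by move=> j; exact: indep.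
    rewrite -mulr_sumr ler_wpM2l// [leRHS](bigID (D i))/= lerDr.
    by apply: sumr_ge0 => j _; rewrite fine_ge0.
  apply: (@le_trans _ _ (\sum_(j | D i j) fine (P (E i)))).
    apply: ler_sum => j _; apply: fine_le; rewrite ?fin_num_measure//.
    + exact: measurableI.
    + by apply: le_measure; rewrite ?inE//; exact: measurableI.
  by rewrite sumr_const -[leLHS]mulr_natl ler_wpM2r// ler_nat; exact: degD.
have d0 : 0 < (mu - M) ^+ 2 by rewrite exprn_gt0// subr_gt0.
rewrite ler_pdivlMr//.
(* Pointwise, (mu - M)^2 times the indicator of [B] is at most (count - mu)^2. The cross term 2 mu
   count is moved to the left to keep both sides nonnegative. *)
have mL := meanD (meanZ (ltW d0) (mean_indic P mB)) (meanZ (mulr_ge0 (ler0n R 2) mu0) mN).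
have mR := meanD mN2 (mean_cst P (sqr_ge0 mu)).
have := le_mean mL mR.
move=> H; rewrite mulrC -(lerD2r (2%:R * mu * mu)).
apply: (le_trans (H _)).
  move=> w; rewrite indicE; case: (boolP (w \in B)) => [|_].
    rewrite inE /B/= => cM; rewrite mulr1 -subr_ge0.
    rewrite (_ : _ - _ = (count w - mu) ^+ 2 - (mu - M) ^+ 2); last by ring.
    by rewrite subr_sqr; nra.
  rewrite mulr0 add0r -subr_ge0 (_ : _ - _ = (count w - mu) ^+ 2) ?sqr_ge0//; ring.
apply: (@le_trans _ _ (mu ^+ 2 + m%:R * mu + mu ^+ 2)); first by rewrite lerD2r.
by rewrite le_eqVlt; apply/orP; left; apply/eqP; ring.
Qed.

End count_events.

Section exceedance_count.
Context {R : realType} (p : nat).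
Local Notation gamn := (@std_gaussian R).

Definition exceed_count (Om : 'M[R]_p) (t : R) (y : p.-tuple R) : R :=
  \sum_i \1_(exceed 0 t) (tnth (tuple_mulmx Om y) i).

(** A measurable test placed pointwise below the IHC test in [power_lower_bound], so that the power
    is bounded through [mean]. *)
Definition count_test (Om : 'M[R]_p) (t M : R) : p.-tuple R -> R :=
  \1_[set y | M <= exceed_count Om t y].

Lemma measurable_exceed_count Om t :
  measurable_fun [set: p.-tuple R] (exceed_count Om t).
Proof.
apply: measurable_sum => i.
have [mi _ _] := mean_exceed 0 t.
apply: (measurableT_comp mi).
exact: (measurableT_comp (@measurable_tnth _ _ p i) (measurable_tuple_mulmx Om)).
Qed.

Lemma measurable_count_test Om t M :
  measurable_fun [set: p.-tuple R] (count_test Om t M).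
Proof.
apply: measurable_indic; rewrite -[X in measurable X]setTI.
rewrite (_ : [set _ | _] = exceed_count Om t @^-1` `[M, +oo[%classic).
  exact: measurable_exceed_count.
by apply/seteqP; split => y /=; rewrite in_itv/= andbT.
Qed.

Lemma count_test01 Om t M y : 0 <= count_test Om t M y <= 1.
Proof. by rewrite /count_test indicE; case: (_ \in _); rewrite ?lexx ?ler01. Qed.

Context (A : 'M[R]_p).
Let Omega := invmx (A *m A^T).
Hypothesis uS : A *m A^T \in unitmx.
Hypothesis Omega1 : forall i, Omega i i = 1.
Variables (tau t : R) (S : {set 'I_p}).
Hypothesis t0 : 0 < t.

Definition drift (i : 'I_p) : R := tnth (tuple_mulmx Omega (signal_vec tau S)) i.

Lemma score_decomposition i g :
  tnth (tuple_mulmx Omega (tuple_add (signal_vec tau S) (tuple_mulmx A g))) i =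
  drift i + dot (innovation A i) g.
Proof.
rewrite -innovationE// /drift !tnth_tuple_mulmx -big_split/=.
by apply: eq_bigr => j _; rewrite [tnth (tuple_add _ _) _]tnth_mktuple mulrDr.
Qed.

Definition isolated (i : 'I_p) : bool :=
  (i \in S) && [forall j, (j \in S) && (Omega i j != 0) ==> (j == i)].

Lemma drift_isolated i : isolated i -> drift i = tau.
Proof.
move=> /andP[iS /forallP iso]; rewrite /drift tnth_tuple_mulmx (bigD1 i)//=.
rewrite Omega1 mul1r tnth_mktuple iS big1 ?addr0// => j ji.
rewrite tnth_mktuple; case: ifP => jS; last by rewrite mulr0.
have := iso j; rewrite jS (negbTE ji)/= implybF negbK => /eqP ->.
by rewrite mul0r.
Qed.

Definition exceed_event (i : 'I_p) : set (p.-tuple R) :=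
  [set g | exceed (drift i) t (dot (innovation A i) g)].

Lemma measurable_exceed_event i : measurable (exceed_event i).
Proof.
rewrite -[X in measurable X]setTI.
exact: (@measurable_dot R p (innovation A i) _ _ (measurable_exceed _ _)).
Qed.

Lemma exceed_event_prob i : fine (gamn p (exceed_event i)) = tail2 (drift i) t.
Proof.
have v1 : {in [:: i], forall j, dot (innovation A j) (innovation A j) = 1}.
  by move=> j; rewrite inE => /eqP ->; rewrite dot_innovation// Omega1.
have v0 : {in [:: i] &, forall j k, j != k ->
    dot (innovation A j) (innovation A k) = 0}.
  by move=> j k; rewrite !inE => /eqP -> /eqP ->; rewrite eqxx.
have := mean_orthonormal (s := [:: i]) isT v1 v0
  (fun j => mean_exceed (drift j) t).
rewrite big_seq1 => m; apply: (mean_uniq (mean_indic _ (measurable_exceed_event i))).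
by apply: mean_eq m => g; rewrite big_seq1.
Qed.

Lemma exceed_event_indep i j : ~~ (Omega i j != 0) ->
  fine (gamn p (exceed_event i `&` exceed_event j)) =
  fine (gamn p (exceed_event i)) * fine (gamn p (exceed_event j)).
Proof.
rewrite negbK => /eqP ij0.
have ij : i != j.
  by apply/eqP => e; move/eqP: ij0; rewrite e Omega1 oner_eq0.
have us : uniq [:: i; j] by rewrite /= inE ij.
have v1 : {in [:: i; j], forall j, dot (innovation A j) (innovation A j) = 1}.
  by move=> k _; rewrite dot_innovation// Omega1.
have v0 : {in [:: i; j] &, forall j k, j != k ->
    dot (innovation A j) (innovation A k) = 0}.
  move=> k l; rewrite !inE dot_innovation// => /orP[/eqP ->|/eqP ->] /orP[/eqP ->|/eqP ->];
    rewrite ?eqxx//.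
  by rewrite Omega_sym.
have := mean_orthonormal (s := [:: i; j]) us v1 v0
  (fun j => mean_exceed (drift j) t).
rewrite big_cons big_seq1 !exceed_event_prob => m.
apply: (mean_uniq (mean_indic _ (measurableI _ _ (measurable_exceed_event i)
  (measurable_exceed_event j)))).
by apply: mean_eq m => g; rewrite big_cons big_seq1 indicI.
Qed.

Definition exceed_mean : R := \sum_i tail2 (drift i) t.

Lemma cond_count_test M : M < exceed_mean ->
  1 - (max_degree Omega)%:R * exceed_mean / (exceed_mean - M) ^+ 2 <=
  cond_mean A tau (count_test Omega t M) S.
Proof.
move=> Mmu.
have muE : exceed_mean = \sum_i fine (gamn p (exceed_event i)).
  by apply: eq_bigr => i _; rewrite exceed_event_prob.
have deg i : (#|[pred j | Omega i j != 0%R]| <= max_degree Omega)%N by exact: leq_bigmax.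
have := count_lower_tail (P := gamn p) measurable_exceed_event exceed_event_indep deg.
rewrite -muE => /(_ M Mmu).
set B := [set w | _] => PB.
have countE g : exceed_count Omega t
    (tuple_add (signal_vec tau S) (tuple_mulmx A g)) = \sum_i \1_(exceed_event i) g.
  apply: eq_bigr => i _; rewrite !indicE score_decomposition.
  by congr (nat_of_bool _)%:R; apply/idP/idP; rewrite !inE /exceed_event /exceed/= add0r.
have mB : measurable B.
  have mc : measurable_fun [set: p.-tuple R] (fun g => \sum_i \1_(exceed_event i) g : R).
    apply: measurable_sum => i.
    by have [] := mean_indic (gamn p) (measurable_exceed_event i).
  rewrite -[X in measurable X]setTI.
  rewrite (_ : B = (fun g => \sum_i \1_(exceed_event i) g : R) @^-1` `]-oo, M[%classic).
    exact: mc.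
  by apply/seteqP; split => w; rewrite /B/= in_itv.
have m1 := mean_cond_test A tau (measurable_count_test Omega t M)
  (count_test01 Omega t M) S.
suff H : cond_mean A tau (count_test Omega t M) S + fine (gamn p B) = 1.
  by rewrite lerBlDr -[leLHS]H lerD2l.
apply: (mean_uniq (meanD m1 (mean_indic (gamn p) mB))).
apply: mean_eq (mean_cst _ ler01) => g; apply: esym; rewrite /cond_test /count_test !indicE.
case: (boolP (g \in B)).
  rewrite inE /B/= -countE => h.
  by rewrite memNset ?add0r//= => /(lt_le_trans h); rewrite ltxx.
rewrite addr0 => /negP h; rewrite mem_set//= countE leNgt.
by apply/negP => h'; apply: h; rewrite inE.
Qed.

Lemma exceed_mean_ge (K : R) : K <= #|isolated|%:R -> 0 <= K ->
  p%:R * tail2 0 t + K * (tail2 tau t - tail2 0 t) <= exceed_mean.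
Proof.
move=> Kle K0.
have d0 : 0 <= tail2 tau t - tail2 0 t by rewrite subr_ge0 tail2_min.
apply: (@le_trans _ _ (p%:R * tail2 0 t + #|isolated|%:R * (tail2 tau t - tail2 0 t))).
  by rewrite lerD2l ler_wpM2r.
rewrite /exceed_mean (bigID isolated)/=.
rewrite [X in _ <= X + _](eq_bigr (fun=> tail2 tau t)); last first.
  by move=> i /drift_isolated ->.
rewrite sumr_const -[X in _ <= X + _]mulr_natl.
have le2 : \sum_(i | ~~ isolated i) tail2 0 t <= \sum_(i | ~~ isolated i) tail2 (drift i) t.
  by apply: ler_sum => i _; exact: tail2_min.
apply: (@le_trans _ _ (#|isolated|%:R * tail2 tau t +
    \sum_(i | ~~ isolated i) tail2 0 t)); last first.
  by rewrite lerD2l.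
have -> : p%:R * tail2 0 t = #|isolated|%:R * tail2 0 t + \sum_(i | ~~ isolated i) tail2 0 t.
  transitivity (\sum_(i < p) tail2 0 t); first by rewrite sumr_const card_ord mulr_natl.
  by rewrite (bigID isolated)/= sumr_const mulr_natl.
by rewrite le_eqVlt; apply/orP; left; apply/eqP; ring.
Qed.

End exceedance_count.

Section chebyshev_ratio.
Context {R : realFieldType}.

(** The mean [mu] occurs in the numerator but is only bounded from below. Writing mu = b + D, one
    has mu - M >= D / 2, and the resulting bound 4 m (b / D^2 + 1 / D) decreases in D. *)
Lemma chebyshev_ratio (m b Delta mu M : R) : 0 <= m -> 0 <= b -> 0 < Delta ->
  b + Delta <= mu -> M <= b + Delta / 2 ->
  m * mu / (mu - M) ^+ 2 <= 4 * m * (b / Delta ^+ 2 + Delta^-1).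
Proof.
move=> m0 b0 D0 Dmu MD.
pose D := mu - b.
have DD : Delta <= D by rewrite /D; lra.
have Dp : 0 < D by exact: lt_le_trans DD.
have h : D / 2 <= mu - M by rewrite /D; lra.
apply: (@le_trans _ _ (m * mu / (D / 2) ^+ 2)).
  have mu0 : 0 <= mu by rewrite (le_trans _ Dmu)// addr_ge0// ltW.
  have D20 : 0 < D / 2 by rewrite divr_gt0.
  have M0 : 0 < mu - M := lt_le_trans D20 h.
  rewrite ler_wpM2l ?mulr_ge0// lef_pV2 ?posrE ?exprn_gt0//.
  by apply: lerXn2r; rewrite ?nnegrE ?(ltW D20) ?(ltW M0).
rewrite (_ : m * mu / (D / 2) ^+ 2 = 4 * m * (b / D ^+ 2 + D^-1)); last first.
  by rewrite (_ : mu = b + D); [field; rewrite gt_eqF|rewrite /D; ring].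
rewrite ler_wpM2l ?mulr_ge0// lerD//.
  rewrite ler_wpM2l// lef_pV2 ?posrE ?exprn_gt0//.
  by apply: lerXn2r; rewrite ?nnegrE ?(ltW D0) ?(ltW Dp).
by rewrite lef_pV2.
Qed.

End chebyshev_ratio.

(** * Most signals are isolated *)

Section isolated_signals.
Context {R : realFieldType} (I : finType) (eps : R) (e : rel I) (m : nat).
Hypothesis eps01 : 0 <= eps <= 1.
Hypothesis deg_e : forall i, (#|[pred j | e i j]| <= m)%N.
Implicit Types (S : {set I}).
Local Notation w := (bernoulli_weight eps).

Definition isolated_in S (i : I) : bool :=
  (i \in S) && [forall j, (j \in S) && e i j ==> (j == i)].

Let ind S (i : I) : R := (i \in S)%:R.

Lemma bernoulli_mean1 i : \sum_(S : {set I}) w S * ind S i = eps.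
Proof.
rewrite (sum_resample _ _ i) -[RHS]mulr1 -(bernoulli_weight_sum I eps) mulr_sumr.
apply: eq_bigr => S _; rewrite /resample /ind setD11 setU11/=; ring.
Qed.

Lemma bernoulli_mean2 i j : i != j -> \sum_(S : {set I}) w S * (ind S i * ind S j) = eps ^+ 2.
Proof.
move=> ij; rewrite (sum_resample _ _ i).
transitivity (eps * \sum_(S : {set I}) w S * ind S j); last by rewrite bernoulli_mean1 expr2.
rewrite mulr_sumr; apply: eq_bigr => S _.
rewrite /resample /ind setD11 setU11 in_setU1 eq_sym (negbTE ij)/=; ring.
Qed.

Lemma bernoulli_variance (mu : R) : mu = #|I|%:R * eps ->
  \sum_(S : {set I}) w S * (#|S|%:R - mu) ^+ 2 <= mu.
Proof.
move=> muE; have [e0 e1] := andP eps01.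
have cardE (S : {set I}) : #|S|%:R = \sum_i ind S i :> R.
  by rewrite -sum1_card natr_sum big_mkcond; apply: eq_bigr => i _; rewrite /ind; case: ifP.
have E1 : \sum_(S : {set I}) w S * #|S|%:R = mu.
  under eq_bigr do rewrite cardE mulr_sumr.
  rewrite exchange_big /=; under eq_bigr do rewrite bernoulli_mean1.
  by rewrite sumr_const muE mulr_natl.
have E2 : \sum_(S : {set I}) w S * #|S|%:R ^+ 2 <= mu + mu ^+ 2.
  have -> : \sum_(S : {set I}) w S * #|S|%:R ^+ 2 =
      \sum_i \sum_j \sum_(S : {set I}) w S * (ind S i * ind S j).
    transitivity (\sum_(S : {set I}) \sum_i \sum_j w S * (ind S i * ind S j)).
      apply: eq_bigr => S _; rewrite cardE expr2 mulr_suml mulr_sumr.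
      by apply: eq_bigr => i _; rewrite !mulr_sumr.
    by rewrite exchange_big /=; apply: eq_bigr => i _; rewrite exchange_big.
  apply: (@le_trans _ _ (\sum_(i : I) (eps + #|I|%:R * eps ^+ 2))).
    apply: ler_sum => i _; rewrite (bigD1 i)//= lerD//.
      rewrite -[leRHS](bernoulli_mean1 i); apply: ler_sum => S _.
      by rewrite /ind; case: (i \in S); rewrite ?mulr1 ?mulr0.
    apply: (@le_trans _ _ (\sum_(j | j != i) eps ^+ 2)).
      by apply: ler_sum => j ji; rewrite bernoulli_mean2// eq_sym.
    rewrite sumr_const -[leLHS]mulr_natl ler_wpM2r ?sqr_ge0// ler_nat.
    exact: max_card.
  rewrite sumr_const -[leLHS]mulr_natl muE le_eqVlt; apply/orP; left; apply/eqP; ring.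
have -> : \sum_(S : {set I}) w S * (#|S|%:R - mu) ^+ 2 =
    \sum_(S : {set I}) w S * #|S|%:R ^+ 2 -
    2 * mu * (\sum_(S : {set I}) w S * #|S|%:R) +
    mu ^+ 2 * \sum_(S : {set I}) w S.
  by rewrite !mulr_sumr -sumrB -big_split/=; apply: eq_bigr => S _; ring.
by rewrite E1 bernoulli_weight_sum; move: E2; nra.
Qed.

Let pairs S : R := \sum_i \sum_(j | e i j && (j != i)) ind S i * ind S j.

Lemma pairs_mean : \sum_(S : {set I}) w S * pairs S <= #|I|%:R * (m%:R * eps ^+ 2).
Proof.
have -> : \sum_(S : {set I}) w S * pairs S =
    \sum_i \sum_(j | e i j && (j != i)) \sum_(S : {set I}) w S * (ind S i * ind S j).
  transitivity (\sum_(S : {set I}) \sum_i \sum_(j | e i j && (j != i)) w S * (ind S i * ind S j)).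
    by apply: eq_bigr => S _; rewrite mulr_sumr; apply: eq_bigr => i _; rewrite mulr_sumr.
  by rewrite exchange_big /=; apply: eq_bigr => i _; rewrite exchange_big.
apply: (@le_trans _ _ (\sum_(i : I) (m%:R * eps ^+ 2))); last first.
  by rewrite sumr_const -[leLHS]mulr_natl.
apply: ler_sum => i _.
rewrite (eq_bigr (fun=> eps ^+ 2)); last first.
  by move=> j /andP[_ ji]; rewrite bernoulli_mean2// eq_sym.
rewrite sumr_const -[leLHS]mulr_natl ler_wpM2r ?sqr_ge0// ler_nat.
apply: leq_trans (deg_e i); apply: subset_leq_card; apply/fintype.subsetP => j.
by rewrite !inE => /andP[].
Qed.

(* Every non-isolated signal contributes to at least one dependent pair. *)
Lemma isolated_card_ge S : #|S|%:R - pairs S <= #|isolated_in S|%:R.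
Proof.
rewrite lerBlDr -!sum1_card !natr_sum [X in X <= _]big_mkcond.
rewrite [X in _ <= X + _]big_mkcond -big_split/=; apply: ler_sum => i _.
have p0 : 0 <= \sum_(j | e i j && (j != i)) ind S i * ind S j.
  by apply: sumr_ge0 => j _; rewrite mulr_ge0// ler0n.
case: ifP => iS; last by rewrite addr_ge0//; case: ifP.
case: ifP => [_|/negbT]; first by rewrite lerDl.
rewrite unfold_in /isolated_in iS/= => /forallPn[j].
rewrite negb_imply => /andP[/andP[jS eij] ji].
rewrite add0r (bigD1 j)/= ?eij ?ji// /ind iS jS mulr1 lerDl.
by apply: sumr_ge0 => k _; rewrite mulr_ge0// ler0n.
Qed.

(** If fewer than mu / 4 signals are isolated, then either at most mu / 2 signals are present, which
    Chebyshev's inequality bounds by 4 / mu, or there are more than mu / 4 dependent pairs, which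
    Markov's inequality bounds by 4 m eps. *)
Lemma few_isolated_weight (mu : R) : mu = #|I|%:R * eps -> 0 < mu ->
  \sum_(S : {set I}) w S * (#|isolated_in S|%:R < mu / 4)%R%:R <= 4 / mu + 4 * (m%:R * eps).
Proof.
move=> muE mu0; have [e0 e1] := andP eps01.
have p0 (S : {set I}) : 0 <= pairs S.
  by apply: sumr_ge0 => i _; apply: sumr_ge0 => j _; rewrite mulr_ge0// ler0n.
have pt (S : {set I}) : (#|isolated_in S|%:R < mu / 4)%R%:R <=
    (4 / mu ^+ 2) * (#|S|%:R - mu) ^+ 2 + (4 / mu) * pairs S.
  have a0 : 0 <= 4 / mu ^+ 2 by rewrite divr_ge0// sqr_ge0.
  have b0 : 0 <= 4 / mu by rewrite divr_ge0// ltW.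
  have A0 : 0 <= (4 / mu ^+ 2) * (#|S|%:R - mu) ^+ 2 by rewrite mulr_ge0// sqr_ge0.
  have B0 : 0 <= (4 / mu) * pairs S by rewrite mulr_ge0.
  case: ltP => [K|_]; last by rewrite addr_ge0.
  have iso := isolated_card_ge S.
  have [Sle|Sgt] := lerP #|S|%:R (mu / 2).
    rewrite ler_wpDr// mulrAC ler_pdivlMr ?exprn_gt0// mul1r; nra.
  rewrite ler_wpDl// mulrAC ler_pdivlMr// mul1r.
  move: iso K Sgt; move: (#|S|%:R) (#|isolated_in S|%:R) (pairs S) => a b c; lra.
apply: (@le_trans _ _ (\sum_(S : {set I}) ((4 / mu ^+ 2) * (w S * (#|S|%:R - mu) ^+ 2) +
    (4 / mu) * (w S * pairs S)))).
  apply: ler_sum => S _; apply: (le_trans (ler_wpM2l (bernoulli_weight_ge0 eps01 S) (pt S))).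
  by rewrite le_eqVlt; apply/orP; left; apply/eqP; ring.
rewrite big_split -!mulr_sumr/= lerD//.
  apply: (@le_trans _ _ (4 / mu ^+ 2 * mu)).
    by rewrite ler_wpM2l ?bernoulli_variance// divr_ge0// sqr_ge0.
  by rewrite le_eqVlt; apply/orP; left; apply/eqP; field; rewrite gt_eqF.
apply: (@le_trans _ _ (4 / mu * (#|I|%:R * (m%:R * eps ^+ 2)))).
  by rewrite ler_wpM2l ?pairs_mean// divr_ge0// ltW.
have -> : #|I|%:R * (m%:R * eps ^+ 2) = mu * (m%:R * eps) by rewrite muE; ring.
by rewrite le_eqVlt; apply/orP; left; apply/eqP; field; rewrite gt_eqF.
Qed.

End isolated_signals.

(** * Order statistics and a single term of the maximum *)

Section higher_criticism.
Context {R : realType}.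

Lemma order_stat_le p (pi : p.-tuple R) (k : nat) (c : R) : (0 < k)%N ->
  (k <= count (fun x => (x <= c)%R) pi)%N -> order_stat pi k <= c.
Proof.
move=> k0 kc; rewrite /order_stat leNgt; apply/negP => h.
have srt : sorted <=%R (sort <=%R pi) by exact: (sort_sorted (@le_total _ R)).
have : (count (fun x => (x <= c)%R) (sort <=%R pi) <= k.-1)%N.
  rewrite -(cat_take_drop k.-1 (sort <=%R pi)) count_cat.
  have -> : count (fun x => (x <= c)%R) (drop k.-1 (sort <=%R pi)) = 0%N.
    apply/eqP; rewrite eqn0Ngt -has_count -all_predC; apply/(all_nthP 0) => i.
    rewrite size_drop nth_drop ltn_subRL /= -ltNge => isz.
    apply: (lt_le_trans h); apply: (sorted_leq_nth (@le_trans _ R) (@lexx _ R)) => //.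
    - by rewrite inE (leq_ltn_trans _ isz)// leq_addr.
    - exact: leq_addr.
  by rewrite addn0 (leq_trans (count_size _ _))// size_take; case: ltnP => // /ltnW.
rewrite count_sort => h2; move: (leq_trans kc h2).
by rewrite -ltnS prednK// ltnn.
Qed.

Lemma order_stat_mem p (pi : p.-tuple R) (k : nat) : (0 < k <= p)%N ->
  order_stat pi k \in pi.
Proof.
move=> /andP[k0 kp]; rewrite /order_stat -(mem_sort <=%R) mem_nth// size_sort size_tuple.
by rewrite prednK.
Qed.

(** If at least [k] P-values are at most [c], the k-th smallest, q, satisfies q <= c. Replacing q by
    [c] lowers the numerator k / p - q, and q (1 - q) <= c. Positive P-values and c <= 1/2 keep the
    denominator nonzero; a negative [thr] is below the term trivially. *)
Lemma HC_max_ge p (pi : p.-tuple R) (k : nat) (c thr : R) :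
  (0 < k)%N -> (k <= p./2)%N -> (forall x, x \in pi -> 0 < x) -> c <= 1 / 2 ->
  (k <= count (fun x => (x <= c)%R) pi)%N ->
  0 <= k%:R / p%:R - c ->
  thr * Num.sqrt c <= Num.sqrt p%:R * (k%:R / p%:R - c) ->
  (thr%:E <= HC_max pi)%E.
Proof.
move=> k0 kp pi0 c2 kc d0 hthr.
have kp' : (0 < k <= p)%N.
  by rewrite k0 (leq_trans kp)// -{2}(odd_double_half p) -addnn addnA leq_addl.
set q := order_stat pi k.
have q0 : 0 < q by apply: pi0; exact: order_stat_mem.
have qc : q <= c by exact: order_stat_le.
have c0 : 0 < c := lt_le_trans q0 qc.
apply: (@le_trans _ _ (HC_term pi k)%:E); last first.
  rewrite /HC_max; apply: (@bigmax_sup_seq _ _ _ _ _ k) => //.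
  by rewrite mem_index_iota k0 ltnS.
rewrite lee_fin /HC_term -/q mulrA.
have qq : 0 < q * (1 - q) by rewrite mulr_gt0// subr_gt0; lra.
rewrite ler_pdivlMr ?sqrtr_gt0//.
have sp : 0 <= Num.sqrt p%:R :> R by exact: sqrtr_ge0.
have [thr0|thr0] := lerP 0 thr.
  apply: (@le_trans _ _ (thr * Num.sqrt c)).
    rewrite ler_wpM2l// ler_sqrt//; nra.
  by apply: (le_trans hthr); rewrite ler_wpM2l// lerD2l lerN2.
apply: (@le_trans _ _ 0); first by rewrite nmulr_rle0// sqrtr_ge0.
rewrite mulr_ge0//; lra.
Qed.

Lemma IHC_ge p (Om : 'M[R]_p) (y : p.-tuple R) (k : nat) (t thr : R) :
  (0 < k)%N -> (k <= p./2)%N -> 0 < t -> tail2 0 t <= 1 / 2 ->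
  k%:R <= exceed_count Om t y ->
  0 <= k%:R / p%:R - tail2 0 t ->
  thr * Num.sqrt (tail2 0 t) <= Num.sqrt p%:R * (k%:R / p%:R - tail2 0 t) ->
  (thr%:E <= IHC Om y)%E.
Proof.
move=> k0 kp t0 c2 kc d0 hthr; apply: (HC_max_ge k0 kp _ c2 _ d0 hthr).
  by move=> x /tnthP[i ->]; rewrite tnth_mktuple pvalue_gt0.
rewrite -(ler_nat R) (le_trans kc)//.
rewrite /exceed_count -sum1_count natr_sum [leRHS]big_mkcond [leRHS]big_tuple/=.
apply: ler_sum => i _; rewrite indicE; case: (boolP (_ \in _)) => [|_]; last by case: ifP.
rewrite inE /exceed/= add0r => h; rewrite ifT// tnth_mktuple pvalueE.
exact: tail2_anti.
Qed.

End higher_criticism.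

(** * The detectable region *)

Section power_bound.
Context {R : realType}.

Lemma test_power_le1 d (T : measurableType d) (P : probability T R) p
    (beta z : {RV P >-> p.-tuple R}) (phi : p.-tuple R -> R) :
  (forall y, 0 <= phi y <= 1) -> (test_power P beta z phi <= 1)%E.
Proof.
move=> phi01; rewrite /test_power /rejection_prob.
apply: (@le_trans _ _ (\int[P]_w (cst 1 w))%E).
  apply: ge0_le_integral_nomeas => w; rewrite lee_fin.
    by case/andP: (phi01 (alt_obs beta z w)).
  by case/andP: (phi01 (alt_obs beta z w)).
by rewrite integral_cst//= probability_setT mul1e.
Qed.

Lemma IHC_test01 p (Om : 'M[R]_p) alpha y : 0 <= IHC_test Om alpha y <= 1.
Proof. by rewrite /IHC_test indicE; case: (_ \in _); rewrite ?lexx ?ler01. Qed.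

(** The two subtracted groups are the conditional Chebyshev failure given a good support, and the
    probability that fewer than p eps / 4 signals are isolated. *)
Lemma power_lower_bound d (T : measurableType d) (P : probability T R) p
    (Sigma : 'M[R]_p) (beta z : {RV P >-> p.-tuple R}) (eps tau t alpha : R)
    (k : nat) (Delta : R) :
  Sigma \in unitmx -> (forall i, invmx Sigma i i = 1) ->
  centered_gaussian Sigma (distribution P z) ->
  iid_with_law P beta (two_point_mixture eps tau) -> independent_rv P beta z ->
  tau != 0 -> 0 <= eps <= 1 -> 0 < p%:R * eps -> 0 < t ->
  let m := (max_degree (invmx Sigma))%:R in
  let pi := tail2 0 t in
  pi <= 1 / 2 -> Delta = p%:R * eps / 4 * (tail2 tau t - pi) -> 0 < Delta ->
  (0 < k)%N -> (k <= p./2)%N ->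
  0 <= k%:R / p%:R - pi ->
  m * critical_value p alpha * Num.sqrt pi <= Num.sqrt p%:R * (k%:R / p%:R - pi) ->
  k%:R <= p%:R * pi + Delta / 2 ->
  ((1 - (4 * m * (p%:R * pi / Delta ^+ 2 + Delta^-1) +
     (4 / (p%:R * eps) + 4 * (m * eps))))%:E <=
   test_power P beta z (IHC_test (invmx Sigma) alpha))%E.
Proof.
move=> uS O1 [A AE zA] biid bz tau0 e01 mu0 t0 m pi pi2 DE D0 k0 kp kpi hthr kD.
rewrite -AE in uS O1 m hthr *.
set Om := invmx (A *m A^T).
have m0 : 0 <= m by rewrite ler0n.
have pi0 : 0 <= pi by exact: mean_ge0 (mean_exceed 0 t).
set kap := 4 * m * _; set bet := 4 / _ + _.
have mct := @measurable_count_test R p Om t k%:R.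
have ct01 := @count_test01 R p Om t k%:R.
have m2 := mean_alt_obs tau0 zA biid bz mct ct01.
apply: (@le_trans _ _ (\int[P]_w (count_test Om t k%:R (alt_obs beta z w))%:E)%E); last first.
  apply: ge0_le_integral_nomeas => w; rewrite lee_fin.
    by case/andP: (ct01 (alt_obs beta z w)).
  rewrite /count_test /IHC_test !indicE ler_nat.
  case: (boolP (_ \in [set y | k%:R <= exceed_count Om t y])) => //.
  rewrite inE /= => kc; rewrite mem_set//=.
  exact: (IHC_ge k0 kp t0 pi2 kc kpi hthr).
case: m2 => _ _ ->; rewrite lee_fin.
have degO i : (#|[pred j | Om i j != 0%R]| <= max_degree Om)%N by exact: leq_bigmax.
have kap0 : 0 <= kap.
  by rewrite !mulr_ge0// addr_ge0 ?divr_ge0 ?mulr_ge0 ?sqr_ge0 ?invr_ge0// ltW.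
have muE : p%:R * eps = #|'I_p|%:R * eps by rewrite card_ord.
have bad := few_isolated_weight e01 degO muE mu0.
(* The subtracted indicator marks the bad supports. There the bracket equals - kap, so nonnegativity
   of the conditional power is enough. *)
apply: (@le_trans _ _ (\sum_(S : {set 'I_p}) bernoulli_weight eps S *
   (1 - kap - (#|isolated_in (fun i j => Om i j != 0) S|%:R < p%:R * eps / 4)%R%:R))).
  rewrite (eq_bigr (fun S : {set 'I_p} => (1 - kap) * bernoulli_weight eps S -
    bernoulli_weight eps S *
     (#|isolated_in (fun i j => Om i j != 0) S|%:R < p%:R * eps / 4)%R%:R)); last first.
    by move=> S _; rewrite mulrBr mulrC.
  by rewrite sumrB -mulr_sumr bernoulli_weight_sum mulr1 opprD addrA lerD2l lerN2.
apply: ler_sum => S _; apply: ler_wpM2l; first exact: bernoulli_weight_ge0.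
have cm0 : 0 <= cond_mean A tau (count_test Om t k%:R) S.
  exact: mean_ge0 (mean_cond_test A tau mct ct01 S).
case: ltP => [_|good]; first by apply: (le_trans _ cm0); rewrite addrAC subrr sub0r oppr_le0.
rewrite subr0.
have D4 : 0 <= p%:R * eps / 4 by rewrite divr_ge0// ltW.
have := @exceed_mean_ge R p A O1 tau t S t0 (p%:R * eps / 4) good D4.
rewrite -/pi -DE => hmu.
have kmu : k%:R < exceed_mean A tau t S.
  by apply: lt_le_trans hmu; apply: (le_lt_trans kD); rewrite ltrD2l; lra.
apply: le_trans (@cond_count_test R p A uS O1 tau t S k%:R kmu).
rewrite lerD2l lerN2; apply: chebyshev_ratio => //.
by rewrite mulr_ge0.
Qed.

End power_bound.

Section power_asymptotics.
Context {R : realType}.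

(* w = sqrt q is the exponent of the level t = sqrt(2 q log p) at which the
   p-values are counted, s that of t - tau. *)
Lemma supercritical_exponents (theta r : R) : 0 < theta < 1 -> 0 < r -> rho_star theta < r ->
  exists w s g : R, [/\ 0 < w <= 1, 0 <= s < w, w - Num.sqrt r <= s, 0 < g &
    g <= 1 / 2 - theta + w ^+ 2 / 2 - s ^+ 2].
Proof.
move=> /andP[th0 th1] r0 rr.
pose x := Num.sqrt r; have x0 : 0 < x by rewrite sqrtr_gt0.
have xr : x ^+ 2 = r by rewrite sqr_sqrtr// ltW.
pose u := Num.sqrt (1 - theta).
have u0 : 0 < u by rewrite sqrtr_gt0 subr_gt0.
have ur : u ^+ 2 = 1 - theta by rewrite sqr_sqrtr// subr_ge0 ltW.
suff [w [s [w01 s0w ws g0]]] : exists w s : R, [/\ 0 < w <= 1, 0 <= s < w, w - x <= s &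
    0 < 1 / 2 - theta + w ^+ 2 / 2 - s ^+ 2].
  by exists w, s, (1 / 2 - theta + w ^+ 2 / 2 - s ^+ 2); rewrite lexx.
(* With s = w - x the gain 1/2 - theta + w^2 / 2 - s^2 is largest at w = 2 x, where it is x^2 -
   (theta - 1/2). When 2 x exceeds 1 the choice is w = 1 and s = max(1 - x, 0), treated here: the
   gain is then 1 - theta - s^2, and [v] separates s from sqrt(1 - theta). For theta <= 1/2 and x <=
   1, w = x with s = 0 already gives a positive gain. *)
have one v : 0 < v -> 1 - x < v -> v <= 1 -> v ^+ 2 <= 1 - theta ->
    exists w s : R, [/\ 0 < w <= 1, 0 <= s < w, w - x <= s &
    0 < 1 / 2 - theta + w ^+ 2 / 2 - s ^+ 2].
  move=> v0 xv v1 vt; have [x1|x1] := lerP x 1.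
    by exists 1, (1 - x); split; try (apply/andP; split); nra.
  by exists 1, 0; split; try (apply/andP; split); nra.
move: rr; rewrite /rho_star -/u -xr.
case: ifP => [t12 _|/negbT].
  have [x1|x1] := lerP x 1.
    by exists x, 0; split; try (apply/andP; split); nra.
  by exists 1, 0; split; try (apply/andP; split); nra.
rewrite -ltNge => t12; case: ifP => [t34 h|/negbT].
  have [x12|x12] := lerP x (1 / 2).
    by exists (2 * x), x; split; try (apply/andP; split); nra.
  by apply: (one (1 / 2)); lra.
rewrite -ltNge => t34 h; apply: (one u) => //; nra.
Qed.

Lemma power_lower_exponents d (T : measurableType d) (P : probability T R) p
    (Sigma : 'M[R]_p) (beta z : {RV P >-> p.-tuple R}) (theta r alpha w s dl : R) :
  0 < theta < 1 -> 0 < r -> (1 < p)%N ->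
  Sigma \in unitmx -> (forall i, invmx Sigma i i = 1) ->
  centered_gaussian Sigma (distribution P z) ->
  iid_with_law P beta (two_point_mixture (signal_rate theta p) (signal_strength r p)) ->
  independent_rv P beta z ->
  0 < w <= 1 -> 0 <= s < w -> w - Num.sqrt r <= s -> 0 < dl ->
  10 * dl <= 1 / 2 - theta + w ^+ 2 / 2 - s ^+ 2 ->
  2 * dl <= w ^+ 2 - s ^+ 2 -> 4 * dl <= w ^+ 2 -> 2 * dl <= theta ->
  8 <= dl ^+ 2 * ln p%:R ->
  2 * (1 / 2 + ln (Num.sqrt (trigo.pi *+ 2))) <= dl * ln p%:R ->
  100 <= p%:R `^ dl ->
  (max_degree (invmx Sigma))%:R <= p%:R `^ dl ->
  (max_degree (invmx Sigma))%:R * critical_value p alpha <= p%:R `^ dl ->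
  ((1 - 20 * p%:R `^ (- dl))%:E <=
   test_power P beta z (IHC_test (invmx Sigma) alpha))%E.
Proof.
move=> /andP[th0 th1] r0 p1 uS O1 zN biid bz /andP[w0 w1] /andP[s0 sw] wxs dl0 d1 d2 d3 d4.
move=> h8 hK; rewrite !powR_natE//; set L := ln p%:R in h8 hK *.
pose E (u : R) : R := expR (u * L).
rewrite -/(E dl) -/(E (- dl)) => hE hm hmc.
have L0 : 0 < L := ln_nat_gt0 p1.
have E_gt0 u : 0 < E u by exact: expR_gt0.
have E_ge0 u : 0 <= E u := ltW (E_gt0 u).
have L_ge0 : 0 <= L := ltW L0.
have dl_ge0 : 0 <= dl := ltW dl0.
have ED u v : E (u + v) = E u * E v by rewrite /E mulrDl expRD.
have Ele u v : u <= v -> E u <= E v by move=> uv; rewrite ler_expR ler_wpM2r// ltW.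
have E0 : E 0 = 1 by rewrite /E mul0r expR0.
have EV u : (E u)^-1 = E (- u) by rewrite /E mulNr expRN.
have E1 : E 1 = p%:R by rewrite /E mul1r expR_ln_nat.
(* [E u] is p^u. One [dl] of slack in the exponent absorbs any numerical constant up to 100. *)
have step u v : u + dl <= v -> 100 * E u <= E v.
  move=> uv; apply: le_trans (Ele _ _ uv); rewrite ED mulrC ler_wpM2l//.
have p0 : 0 < p%:R :> R by exact: natr_pos.
set eps := signal_rate theta p in biid.
have epsE : eps = E (- theta) by exact: signal_rateE.
have e01 : 0 <= eps <= 1 by exact: signal_rate01.
set tau := signal_strength r p in biid.
pose l := Num.sqrt (2 * L).
have l2 : l ^+ 2 = 2 * L by exact: sqrt_2ln_sqr.
have l0 : 0 < l by rewrite sqrtr_gt0 mulr_gt0.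
have tauE : tau = Num.sqrt r * l by exact: signal_strengthE.
have tau0 : tau != 0 by rewrite gt_eqF// signal_strength_gt0.
pose t := w * l.
have t0 : 0 < t by exact: mulr_gt0.
pose y := s * l.
have y0 : 0 <= y by rewrite mulr_ge0// ltW.
have ty : t - tau <= y by rewrite tauE /t /y -mulrBl ler_wpM2r// ltW.
set pi := tail2 0 t.
have pi_ge0 : 0 <= pi by exact: mean_ge0 (mean_exceed 0 t).
have piE : pi <= 2 * E (- w ^+ 2).
  apply: (le_trans (tail2_le (ltW t0))); rewrite /t exprMn l2.
  by rewrite (_ : _ * _ / 2 = w ^+ 2 * L); [rewrite -mulNr|field].
(* This makes the factor e^(-y) of the Gaussian density at y + 1 cost at most p^(-dl / 2); the
   constants 1/2 and log sqrt(2 pi) cost as much again, by [hK]. *)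
have lE : l <= dl * L / 2.
  have dL0 : 0 <= dl * L / 2 by rewrite divr_ge0// mulr_ge0.
  rewrite -ler_sqr ?nnegrE ?(ltW l0)// l2.
  rewrite (_ : (dl * L / 2) ^+ 2 = dl ^+ 2 * L * L / 4); last by field.
  rewrite ler_pdivlMr// (_ : 2 * L * 4 = 8 * L); last by ring.
  by rewrite ler_wpM2r// ltW.
have tailE : E (- (s ^+ 2 + dl)) <= tail2 tau t.
  apply: le_trans (tail2_ge y0 ty); rewrite gaussE.
  have c0 : 0 < Num.sqrt (trigo.pi *+ 2) :> R by rewrite sqrtr_gt0 mulrn_wgt0// pi_gt0.
  rewrite -[X in X^-1]lnK ?posrE// -expRN -expRD ler_expR.
  have yl : y <= dl * L / 2.
    apply: le_trans lE; rewrite /y ler_piMl ?(ltW l0)//; exact: ltW (lt_le_trans sw w1).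
  have ysq : y ^+ 2 = s ^+ 2 * (2 * L) by rewrite /y exprMn l2.
  move: hK; set c := ln _ => hK.
  rewrite (_ : - (y + 1) ^+ 2 / 2 = - (y ^+ 2 / 2) - y - 1 / 2); last by field.
  by rewrite ysq; nra.
set Delta := p%:R * eps / 4 * (tail2 tau t - pi).
(* Exponent of the lift of the mean, with one [dl] for the tail bound and one for the numerical
   constants. Below, [b] is the exponent of the null standard deviation of the count, and a >= b + 8
   dl is the separation on which everything rests. *)
pose a := 1 - theta - s ^+ 2 - 2 * dl.
have peE : p%:R * eps = E (1 - theta) by rewrite -E1 epsE -ED.
have piw : 50 * pi <= E (- (s ^+ 2 + dl)).
  apply: (@le_trans _ _ (100 * E (- w ^+ 2))).
    by apply: (@le_trans _ _ (50 * (2 * E (- w ^+ 2)))); [rewrite ler_wpM2l|lra].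
  by apply: step; lra.
have DE : E a <= Delta.
  rewrite /Delta peE; apply: (@le_trans _ _ (E (1 - theta) / 4 * (E (- (s ^+ 2 + dl)) / 2))).
    apply: (@le_trans _ _ (E (1 - theta - s ^+ 2 - dl) / 8)).
      have := step a (1 - theta - s ^+ 2 - dl); rewrite /a => /(_ ltac:(lra)).
      by move: (E_gt0 a); rewrite /a; lra.
    rewrite (_ : 1 - theta - s ^+ 2 - dl = (1 - theta) + (- (s ^+ 2 + dl))); last by ring.
    by rewrite ED le_eqVlt; apply/orP; left; apply/eqP; field.
  rewrite ler_wpM2l ?divr_ge0//; lra.
have D0 : 0 < Delta := lt_le_trans (E_gt0 a) DE.
pose b := (1 - w ^+ 2) / 2.
have pp : p%:R * pi <= 2 * E (1 - w ^+ 2).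
  rewrite ED E1 mulrCA ler_wpM2l//.
have spp : Num.sqrt (p%:R * pi) <= 2 * E b.
  rewrite -[leRHS]ger0_norm ?mulr_ge0// -sqrtr_sqr ler_sqrt ?sqr_ge0//.
  apply: (le_trans pp); rewrite exprMn !expr2 -ED.
  rewrite (_ : b + b = 1 - w ^+ 2); last by rewrite /b; field.
  by rewrite ler_wpM2r//; lra.
(* The k-th term is at least (k - p pi) / sqrt(p pi), so k >= x makes it reach p^dl, which dominates
   the critical value. Taking the successor of the truncation also gives k >= 1. *)
pose x := p%:R * pi + E dl * Num.sqrt (p%:R * pi).
have x0 : 0 <= x by rewrite addr_ge0 ?mulr_ge0 ?sqrtr_ge0// ?(ltW p0).
have [xk1 xk2] := andP (truncn_itv x0).
set k := (Num.truncn x).+1 in xk2.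
have kx : k%:R <= x + 1 by rewrite /k -natr1 lerD2r.
have b0 : 0 <= b by rewrite /b divr_ge0// subr_ge0 expr_le1// ltW.
have Hs : E dl * Num.sqrt (p%:R * pi) <= 2 * E (b + dl).
  by rewrite ED [E b * _]mulrC mulrCA ler_wpM2l//.
have Ebd1 : 1 <= E (b + dl) by rewrite -E0 Ele// addr_ge0//.
have kpp : k%:R - p%:R * pi <= 3 * E (b + dl) by move: kx; rewrite /x; lra.
have ab : b + 10 * dl - 2 * dl <= a by rewrite /b /a; lra.
have kD : k%:R <= p%:R * pi + Delta / 2.
  have st := step (b + dl) a ltac:(lra).
  by move: kpp DE Ebd1 st; lra.
have kp : (k <= p./2)%N.
  have : k%:R <= p%:R / 2 :> R.
    have st1 := step (1 - w ^+ 2) 1 ltac:(lra).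
    have st2 := step (b + dl) 1 ltac:(rewrite /b; nra).
    by rewrite -E1; move: kpp pp st1 st2 (E_gt0 1); lra.
  rewrite ler_pdivlMr// -natrM ler_nat => h.
  by rewrite -(half_bit_double k false) add0n half_leq// -muln2.
have kge : E dl * Num.sqrt (p%:R * pi) <= k%:R - p%:R * pi by move: xk2; rewrite /x; lra.
have kpi : 0 <= k%:R / p%:R - pi.
  rewrite subr_ge0 ler_pdivlMr// mulrC -subr_ge0; apply: le_trans kge.
  by rewrite mulr_ge0 ?sqrtr_ge0.
have pi2 : pi <= 1 / 2.
  have := step (- w ^+ 2) 0 ltac:(lra); rewrite E0; move: piE (E_gt0 (- w ^+ 2)); lra.
have hthr : (max_degree (invmx Sigma))%:R * critical_value p alpha * Num.sqrt pi <=
    Num.sqrt p%:R * (k%:R / p%:R - pi).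
  apply: (@le_trans _ _ (E dl * Num.sqrt pi)); first by rewrite ler_wpM2r// sqrtr_ge0.
  have sp0 : 0 < Num.sqrt p%:R :> R by rewrite sqrtr_gt0.
  have sp2 : Num.sqrt p%:R * Num.sqrt p%:R = p%:R :> R by rewrite -expr2 sqr_sqrtr// ltW.
  rewrite -(ler_pM2l sp0) [leRHS]mulrA sp2 mulrBr.
  rewrite (_ : p%:R * (k%:R / p%:R) = k%:R); last by field; rewrite gt_eqF.
  by rewrite mulrCA -sqrtrM// ltW.
have mu0 : 0 < p%:R * eps by rewrite peE.
apply: le_trans (power_lower_bound uS O1 zN biid bz tau0 e01 mu0 t0 pi2 erefl D0
  (ltn0Sn _) kp kpi hthr kD).
rewrite lee_fin lerD2l lerN2 -/pi -/Delta.
set m : R := (max_degree (invmx Sigma))%:R in hm *.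
have m0 : 0 <= m by rewrite ler0n.
have Ed := E_gt0 (- dl).
have i1 : p%:R * pi / Delta ^+ 2 <= 2 * E (- (16 * dl)).
  apply: (@le_trans _ _ (2 * E (1 - w ^+ 2) / E a ^+ 2)).
    apply: ler_pM; rewrite ?mulr_ge0 ?invr_ge0 ?sqr_ge0 ?(ltW p0)//.
    rewrite lef_pV2 ?posrE ?exprn_gt0//.
    by apply: lerXn2r; rewrite ?nnegrE ?(ltW D0) ?(ltW (E_gt0 a)).
  rewrite (_ : E a ^+ 2 = E (a + a)); last by rewrite (ED a a); exact: expr2.
  rewrite -mulrA EV -ED ler_wpM2l// Ele// /a; move: d1; lra.
have i2 : Delta^-1 <= E (- (8 * dl)).
  apply: (@le_trans _ _ (E a)^-1); first by rewrite lef_pV2 ?posrE.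
  by rewrite EV Ele// lerN2; lra.
have i3 : 4 / (p%:R * eps) <= 4 * E (- dl).
  by rewrite peE EV ler_wpM2l// Ele//; rewrite /a in ab; nra.
have i4 : m * eps <= E (- dl).
  apply: (@le_trans _ _ (E dl * E (- theta))); first by rewrite epsE ler_wpM2r.
  by rewrite -ED Ele//; lra.
have i5 : m * (p%:R * pi / Delta ^+ 2 + Delta^-1) <= 3 * E (- dl).
  apply: (@le_trans _ _ (E dl * (3 * E (- (8 * dl))))).
    apply: ler_pM => //.
      rewrite addr_ge0 ?invr_ge0 ?(ltW D0)// divr_ge0 ?sqr_ge0//.
      by rewrite mulr_ge0// (ltW p0).
    have : E (- (16 * dl)) <= E (- (8 * dl)) by apply: Ele; lra.
    by move: i1 i2; lra.
  rewrite mulrCA -ED ler_wpM2l// Ele//; lra.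
(* The constant 20 is 4 * 3 + 4 + 4. *)
rewrite -mulrA; move: i3 i4 i5; set u1 := m * _; set u2 := 4 / _; set u3 := m * eps.
lra.
Qed.

End power_asymptotics.

Section power.
Context {R : realType}.

Lemma critical_value_le (alpha : nat -> R) (dl : R) : 0 < dl -> slowly_enough alpha ->
  \forall p \near \oo, critical_value p (alpha p) <= p%:R `^ dl.
Proof.
move=> dl0 [_ _ hcv]; near=> p.
have p1 : (1 < p)%N by near: p; exact: nbhs_infty_ge.
have L2 : 2 <= ln p%:R :> R by near: p; exact: ln_nat_large.
have hL : 16 / dl ^+ 2 <= ln p%:R by near: p; exact: ln_nat_large.
have L0 : 0 < ln p%:R :> R by exact: ln_nat_gt0.
have lL0 : 0 < ln (ln p%:R) :> R by rewrite ln_gt0//; lra.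
have s0 : 0 < Num.sqrt (2 * ln (ln p%:R)) :> R by rewrite sqrtr_gt0 mulr_gt0.
have : critical_value p (alpha p) / Num.sqrt (2 * ln (ln p%:R)) <= 2.
  by near: p; apply: (cvgr_le _ hcv); lra.
rewrite ler_pdivrMr// => /le_trans; apply.
rewrite powR_natE//; set L := ln p%:R in L2 hL L0 lL0 s0 *.
have e0 : 0 <= expR (dl * L) by exact: expR_ge0.
rewrite -ler_sqr ?nnegrE ?(mulr_ge0 _ (ltW s0))// exprMn sqr_sqrtr; last first.
  by rewrite mulr_ge0// ltW.
have lnL : ln L <= L by exact: ltW (ln_sublinear L0).
have x0 : 0 <= dl * L by rewrite mulr_ge0 ?(ltW dl0) ?(ltW L0).
have sq : 1 + (dl * L) <= expR (dl * L) by exact: expR_ge1Dx.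
have h16 : 16 * L <= (dl * L) ^+ 2.
  rewrite exprMn [L ^+ 2]expr2 mulrA ler_wpM2r ?(ltW L0)//.
  by rewrite -ler_pdivrMl ?exprn_gt0// mulrC.
apply: (@le_trans _ _ ((dl * L) ^+ 2)).
  by apply: le_trans h16; rewrite (_ : 2 ^+ 2 * (2 * ln L) = 8 * ln L); [lra|ring].
by apply: lerXn2r; rewrite ?nnegrE//; lra.
Unshelve. all: by end_near. Qed.

Lemma power_tends_to_1 (theta r : R) (d : nat -> measure_display)
    (T : forall p : nat, measurableType (d p)) (P : forall p, probability (T p) R)
    (Sigma Omega : forall p : nat, 'M[R]_p)
    (beta z : forall p, {RV (P p) >-> p.-tuple R}) (alpha : nat -> R) :
  0 < theta < 1 -> 0 < r -> ARW theta r Sigma Omega beta z ->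
  rho_star theta < r -> slowly_enough alpha ->
  test_power (P p) (beta p) (z p) (IHC_test (Omega p) (alpha p))
    @[p --> \oo] --> 1%E.
Proof.
move=> th r0 [uS OE O1 Osp zN biid bz] rr sl.
have [th0 th1] := andP th.
have [w [s [g [w01 s0w wxs g0 gle]]]] := supercritical_exponents th r0 rr.
have [w0 w1] := andP w01; have [s0 sw] := andP s0w.
(* The four bounds are the slack conditions of [power_lower_exponents]. The degree and the critical
   value are each kept below p^(dl / 2), so that their product stays below p^dl. *)
pose dl := Num.min (Num.min (g / 10) ((w ^+ 2 - s ^+ 2) / 2))
                   (Num.min (w ^+ 2 / 4) (theta / 2)).
have ws : s ^+ 2 < w ^+ 2 by nra.
have dl0 : 0 < dl.
  by rewrite !lt_min !divr_gt0// ?subr_gt0// exprn_gt0.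
have dl1 : dl <= g / 10 by rewrite !ge_min lexx.
have dl2 : dl <= (w ^+ 2 - s ^+ 2) / 2 by rewrite !ge_min lexx orbT.
have dl3 : dl <= w ^+ 2 / 4 by rewrite !ge_min lexx !orbT.
have dl4 : dl <= theta / 2 by rewrite !ge_min lexx !orbT.
have dl20 : 0 < dl / 2 by rewrite divr_gt0.
have large (c : R) : \forall p \near \oo, c <= p%:R `^ dl.
  near=> p; have p1 : (1 < p)%N by near: p; exact: nbhs_infty_ge.
  rewrite powR_natE//; apply: le_trans (expR_ge1Dx _).
  apply: (@le_trans _ _ (dl * (c / dl))); first by rewrite mulrC divfK// gt_eqF.
  apply: (@le_trans _ _ (dl * ln p%:R)); last by rewrite lerDr.
  by rewrite ler_wpM2l ?(ltW dl0)//; near: p; exact: ln_nat_large.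
have main : \forall p \near \oo, ((1 - 20 * p%:R `^ (- dl))%:E <=
    test_power (P p) (beta p) (z p) (IHC_test (Omega p) (alpha p)))%E.
  near=> p.
  have p1 : (1 < p)%N by near: p; exact: nbhs_infty_ge.
  have p0 : 0 < p%:R :> R by exact: natr_pos.
  have deg : (max_degree (Omega p))%:R <= p%:R `^ (dl / 2).
    have : (max_degree (Omega p))%:R * p%:R `^ (- (dl / 2)) <= 1.
      by near: p; apply: (cvgr_le _ (Osp _ dl20)).
    by rewrite powRN ler_pdivrMr ?powR_gt0// mul1r.
  have crit : critical_value p (alpha p) <= p%:R `^ (dl / 2).
    by near: p; exact: critical_value_le.
  have dd : p%:R `^ (dl / 2) * p%:R `^ (dl / 2) = p%:R `^ dl :> R.
    by rewrite -powRD -?splitr// gt_eqF// implybT.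
  rewrite OE in deg *.
  apply: (power_lower_exponents th r0 p1 (uS p) _ (zN p) (biid p) (bz p) w01 s0w wxs dl0) => //.
  - by move=> i; rewrite -OE.
  - lra.
  - lra.
  - lra.
  - lra.
  - rewrite mulrC -ler_pdivrMr ?exprn_gt0//; near: p; exact: ln_nat_large.
  - rewrite [leRHS]mulrC -ler_pdivrMr//; near: p; exact: ln_nat_large.
  - by near: p; exact: large.
  - apply: (le_trans deg); rewrite ler_powR//; last by lra.
    by rewrite ler1n ltnW.
  (* Multiplying the two upper bounds requires a nonnegative critical value; for a negative one the
     product is at most 0. *)
  - have [c0|c0] := lerP 0 (critical_value p (alpha p)).
      by rewrite -dd ler_pM// ler0n.
    apply: (@le_trans _ _ 0); last exact: powR_ge0.
    by rewrite mulr_ge0_le0// ?ler0n// ltW.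
have le1 p : (test_power (P p) (beta p) (z p) (IHC_test (Omega p) (alpha p)) <= 1)%E.
  exact: test_power_le1 (IHC_test01 _ _).
have ge0 p : (0 <= test_power (P p) (beta p) (z p) (IHC_test (Omega p) (alpha p)))%E.
  by apply: integral_ge0 => v _; rewrite lee_fin;
    case/andP: (IHC_test01 (Omega p) (alpha p) (alt_obs (beta p) (z p) v)).
have fin p : test_power (P p) (beta p) (z p) (IHC_test (Omega p) (alpha p)) \is a fin_num.
  by rewrite ge0_fin_numE//; apply: le_lt_trans (le1 p) _; rewrite ltry.
apply/fine_cvgP; split; first by near=> p; exact: fin.
apply/cvgrPdist_le => e e0; near=> p.
have f1 : fine (test_power (P p) (beta p) (z p) (IHC_test (Omega p) (alpha p))) <= 1.
  by rewrite -lee_fin fineK.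
have f2 : 1 - 20 * p%:R `^ (- dl) <=
    fine (test_power (P p) (beta p) (z p) (IHC_test (Omega p) (alpha p))).
  by rewrite -lee_fin fineK//; near: p.
have f3 : p%:R `^ (- dl) <= e / 20 by near: p; apply: powRN_small => //; rewrite divr_gt0.
rewrite /= ger0_norm ?subr_ge0//; lra.
Unshelve. all: by end_near. Qed.

End power.

Theorem theorem4p1 (R : realType) (theta r : R)
    (htheta : 0 < theta < 1) (hr : 0 < r)
    (d : nat -> measure_display) (T : forall p : nat, measurableType (d p))
    (P : forall p : nat, probability (T p) R)
    (Sigma Omega : forall p : nat, 'M[R]_p)
    (beta z : forall p : nat, {RV (P p) >-> p.-tuple R})
    (hARW : ARW theta r Sigma Omega beta z) :
  (rho_star theta < r ->
    forall alpha : nat -> R, slowly_enough alpha ->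
      test_power (P p) (beta p) (z p) (IHC_test (Omega p) (alpha p))
        @[p --> \oo] --> 1%E) /\
  (r < rho_star theta ->
    forall phi : forall p : nat, p.-tuple R -> R,
      (forall p : nat, is_test (phi p)) ->
      (type1_error (P p) (z p) (phi p)
        + type2_error (P p) (beta p) (z p) (phi p))%E @[p --> \oo] --> 1%E).
Proof.
split=> [rr alpha sl|rr phi tphi].
  exact: power_tends_to_1 htheta hr hARW rr sl.
exact: lower_bound htheta hr hARW rr tphi.
Qed.
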